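(* For every $n\ge 1$, the map $\gamma:S_n\to\mathrm{gRec}_n$ is surjective.
   Context: **Permutations.** Permutations $x\in S_n$ are written in one-line notation $x=x_1x_2\cdots x_n$. **Generic rectangulations.** Consider tilings of a rectangle $S$ (with horizontal and vertical edges) by finitely many rectangles. A tiling is *generic* if no point is a corner of four distinct tiles. A tile $U$ is *below* a tile $V$ if the top edge of $U$ intersects the bottom edge of $V$; $U$ is *left of* $V$ if the right edge of $U$ intersects the left edge of $V$. Two tilings (of possibly different rectangles) are combinatorially equivalent if there is a bijection between their tiles that exactly preserves the relations ''below'' and ''left of''. A *generic rectangulation* is an equivalence class of generic tilings; $\mathrm{gRec}_n$ is the set of generic rectangulations with $n$ rectangles. Rectangulations are described by representative tilings. **Diagonal rectangulations.** The diagonal of $S$ is the segment from its top-left corner to its bottom-right corner. A *diagonal rectangulation* is a rectangulation having a representative in which the interior of every rectangle meets the diagonal; it is automatically generic. Its rectangles are numbered $1,\dots,n$ in the order in which they meet the diagonal, from top-left to bottom-right. **The map $\rho$ from $S_n$ to diagonal rectangulations with $n$ rectangles.** Place $n+1$ distinct points on the diagonal of $S$, including the top-left and bottom-right corners of $S$, and label the spaces between consecutive points $1,\dots,n$ from top-left to bottom-right. Given $x\in S_n$, draw rectangles in steps $i=1,\dots,n$. In step $i$, let $T$ be the union of the left and bottom edges of $S$ with the rectangles drawn in the first $i-1$ steps ($T$ is left- and bottom-justified). Let $p$ and $p'$ be the diagonal points immediately above/left of, respectively immediately below/right of, the label $x_i$. The new rectangle has the following corners. Top-left corner: if $p\notin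 T$, the rightmost point of $T$ directly left of $p$; if $p\in T$, the highest point of $T$ directly above $p$ (possibly $p$ itself). Bottom-right corner: if $p'\notin T$, the highest point of $T$ directly below $p'$; if $p'\in T$, the rightmost point of $T$ directly to the right of $p'$ (possibly $p'$ itself). The result after $n$ steps is $\rho(x)$; the rectangle drawn in step $i$ is the one numbered $x_i$. **Walls, wall slides, numbering.** A *wall* of a rectangulation is a line segment in $S$, not contained in an edge of $S$, that is maximal with respect to not intersecting the interior of any rectangle. A *wall slide* along a wall $W$ takes two walls that end in $W$ from opposite sides and slides them past each other, changing no other incidences. Two generic rectangulations are *equivalent as mosaic floorplans* if they are related by a sequence of wall slides. It is known that each generic rectangulation $R$ is equivalent as a mosaic floorplan to a unique diagonal rectangulation $R'$. The walls and rectangles of $R$ correspond to those of $R'$ along wall slides (preserving, for each wall, which rectangles are adjacent to it on each side and their order), and the rectangles of $R$ inherit the numbering $1,\dots,n$ from $R'$. **Wall shuffles.** For a vertical wall $W$ of $R$, the *wall shuffle* $\sigma_W$ is the following sequence: moving along $W$ from bottom to top, at each wall $W'$ that ends at $W$ on the left, record the number of the rectangle with right edge in $W$ and bottom edge in $W'$; at each wall $W'$ that ends at $W$ on the right, record the number of the rectangle with left edge in $W$ and top edge in $W'$. Thus $\sigma_W$ is a shuffle of the (decreasing) sequence of numbers, from bottom to top, of rectangles whose right edge is in $W$, excluding the bottom one, with the (decreasing) sequence of numbers, from bottom to top, of rectangles whose left edge is in $W$, excluding the top one. For a horizontal wall $W$: moving from left to right, at each wall $W'$ that ends at $W$ from above,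 record the number of the rectangle with bottom edge in $W$ and right edge in $W'$; at each $W'$ that ends at $W$ from below, record the number of the rectangle with top edge in $W$ and left edge in $W'$. Thus $\sigma_W$ is a shuffle of the (increasing) sequence of numbers, from left to right, of rectangles whose bottom edge is in $W$, excluding the rightmost, with the (increasing) sequence of numbers, from left to right, of rectangles whose top edge is in $W$, excluding the leftmost. Specifying a generic rectangulation is equivalent to specifying its diagonal rectangulation $R'$ together with an arbitrary, independently chosen wall shuffle (a shuffle of the two sequences just described) for each wall of $R'$. **The map $\gamma:S_n\to\mathrm{gRec}_n$.** Given $x\in S_n$, let $R'=\rho(x)$. For each wall $W$ of $R'$, each of the two sequences of rectangle numbers to be shuffled for $W$ is a subsequence of $x_1\cdots x_n$, so a wall shuffle $\sigma_W$ is obtained as the subsequence of $x_1\cdots x_n$ consisting of all numbers occurring in these two sequences. Then $\gamma(x)$ is the generic rectangulation determined by $R'=\rho(x)$ and these wall shuffles. *)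

(* Defs.v *)
From mathcomp Require Import all_boot all_order all_algebra perm.
From mathcomp Require Import boolp classical_sets functions reals.
From Stdlib Require Import Relation_Operators.

Set Implicit Arguments.
Unset Strict Implicit.
Unset Printing Implicit Defensive.

Import Order.TTheory GRing.Theory Num.Theory.
Local Open Scope classical_set_scope.
Local Open Scope ring_scope.

(* A box [lft, rgt] x [bot, top] in the plane; degenerate boxes serve as      *)
(* axis-parallel segments (edges and walls).                                  *)
Record box (R : realType) := Box { lft : R; rgt : R; bot : R; top : R }.

Section Boxes.
Variable R : realType.
Implicit Types (b W : box R) (p : R * R).

Definition pts b : set (R * R) :=
  [set p | lft b <= p.1 <= rgt b /\ bot b <= p.2 <= top b].

Definition interior_pts b : set (R * R) :=
  [set p | lft b < p.1 < rgt b /\ bot b < p.2 < top b].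

Definition rectangle b := lft b < rgt b /\ bot b < top b.

Definition left_edge b := Box (lft b) (lft b) (bot b) (top b).
Definition right_edge b := Box (rgt b) (rgt b) (bot b) (top b).
Definition bottom_edge b := Box (lft b) (rgt b) (bot b) (bot b).
Definition top_edge b := Box (lft b) (rgt b) (top b) (top b).

Definition corner b p :=
  (p.1 = lft b \/ p.1 = rgt b) /\ (p.2 = bot b \/ p.2 = top b).

Definition vertical W := lft W = rgt W /\ bot W < top W.
Definition horizontal W := bot W = top W /\ lft W < rgt W.
Definition segment W := vertical W \/ horizontal W.

End Boxes.

(* A frame with n boxes numbered by 'I_n; the numbers 1, ..., n of the        *)
(* rectangles are shifted to 0, ..., n-1.                                     *)
Record layout (R : realType) (n : nat) :=
  Layout { frame : box R; tile : 'I_n -> box R }.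

Section Rectangulations.
Variables (R : realType) (n : nat).
Implicit Types (T : layout R n) (W : box R) (i j k : 'I_n) (x : 'S_n).

Definition tiling T :=
  [/\ rectangle (frame T),
      forall i, rectangle (tile T i),
      \bigcup_(i in [set: 'I_n]) pts (tile T i) = pts (frame T) &
      forall i j, i != j ->
        interior_pts (tile T i) `&` interior_pts (tile T j) = set0].

Definition generic T :=
  forall p i j k l, corner (tile T i) p -> corner (tile T j) p ->
    corner (tile T k) p -> corner (tile T l) p -> ~~ uniq [:: i; j; k; l].

Definition generic_tiling T := tiling T /\ generic T.

Definition below T i j :=
  pts (top_edge (tile T i)) `&` pts (bottom_edge (tile T j)) !=set0.

Definition left_of T i j :=
  pts (right_edge (tile T i)) `&` pts (left_edge (tile T j)) !=set0.

Definition equivalent T T' := exists s : 'S_n, forall i j,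
  (below T i j <-> below T' (s i) (s j)) /\
  (left_of T i j <-> left_of T' (s i) (s j)).

(* Equivalence by a bijection that also respects the numbering.               *)
Definition same_incidences T T' := forall i j,
  (below T i j <-> below T' i j) /\ (left_of T i j <-> left_of T' i j).

(* A generic rectangulation is an equivalence class of generic tilings.       *)
Definition gRec : set (set (layout R n)) :=
  [set C | exists2 T, generic_tiling T &
     C = [set T' | generic_tiling T' /\ equivalent T T']].

Definition avoids_interiors T W :=
  forall i, interior_pts (tile T i) `&` pts W = set0.

Definition in_frame_edge T W :=
  [\/ pts W `<=` pts (left_edge (frame T)),
      pts W `<=` pts (right_edge (frame T)),
      pts W `<=` pts (bottom_edge (frame T)) |
      pts W `<=` pts (top_edge (frame T))].

Definition wall T W :=
  [/\ segment W, pts W `<=` pts (frame T), avoids_interiors T W,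
      ~ in_frame_edge T W &
      forall W', segment W' -> pts W' `<=` pts (frame T) ->
        avoids_interiors T W' -> pts W `<=` pts W' -> pts W' `<=` pts W].

(* ends_left T W W': the wall W' ends at the vertical wall W on the left      *)
(* of W; similarly for the three other sides.                                 *)
Definition ends_left T W W' :=
  [/\ wall T W', horizontal W' & pts W (rgt W', bot W')].
Definition ends_right T W W' :=
  [/\ wall T W', horizontal W' & pts W (lft W', bot W')].
Definition ends_above T W W' :=
  [/\ wall T W', vertical W' & pts W (lft W', bot W')].
Definition ends_below T W W' :=
  [/\ wall T W', vertical W' & pts W (lft W', top W')].

(* A slide along a vertical wall W: W1 ends at W on the left, W2 ends at W on *)
(* the right, immediately above W1, and W1 is moved past W2. The tiles at the *)
(* end of W1 are a (above W1) and b (below W1), those at the end of W2 are    *)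
(* c (above W2) and d (below W2).                                             *)
Definition vslide T T' := exists W W1 W2 a b c d,
  [/\ [/\ wall T W, vertical W, ends_left T W W1 & ends_right T W W2],
      bot W1 < bot W2 /\ (forall W', ends_left T W W' \/ ends_right T W W' ->
        ~~ (bot W1 < bot W' < bot W2)),
      [/\ pts (right_edge (tile T a)) `<=` pts W,
          pts (bottom_edge (tile T a)) `<=` pts W1,
          pts (right_edge (tile T b)) `<=` pts W &
          pts (top_edge (tile T b)) `<=` pts W1],
      [/\ pts (left_edge (tile T c)) `<=` pts W,
          pts (bottom_edge (tile T c)) `<=` pts W2,
          pts (left_edge (tile T d)) `<=` pts W &
          pts (top_edge (tile T d)) `<=` pts W2] &
      forall i j, (below T' i j <-> below T i j) /\
        (left_of T' i j <->
           (left_of T i j /\ (i, j) <> (a, d)) \/ (i, j) = (b, c))].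

(* A slide along a horizontal wall W: W1 ends at W from above, W2 ends at W   *)
(* from below, immediately to the right of W1, and W1 is moved past W2. The   *)
(* tiles at the end of W1 are a (left of W1) and b (right of W1), those at    *)
(* the end of W2 are c (left of W2) and d (right of W2).                      *)
Definition hslide T T' := exists W W1 W2 a b c d,
  [/\ [/\ wall T W, horizontal W, ends_above T W W1 & ends_below T W W2],
      lft W1 < lft W2 /\ (forall W', ends_above T W W' \/ ends_below T W W' ->
        ~~ (lft W1 < lft W' < lft W2)),
      [/\ pts (bottom_edge (tile T a)) `<=` pts W,
          pts (right_edge (tile T a)) `<=` pts W1,
          pts (bottom_edge (tile T b)) `<=` pts W &
          pts (left_edge (tile T b)) `<=` pts W1],
      [/\ pts (top_edge (tile T c)) `<=` pts W,
          pts (right_edge (tile T c)) `<=` pts W2,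
          pts (top_edge (tile T d)) `<=` pts W &
          pts (left_edge (tile T d)) `<=` pts W2] &
      forall i j, (left_of T' i j <-> left_of T i j) /\
        (below T' i j <->
           (below T i j /\ (i, j) <> (c, b)) \/ (i, j) = (d, a))].

(* Slides in the opposite direction are obtained by exchanging T and T'.      *)
Definition wall_slide T T' :=
  [\/ vslide T T', hslide T T', vslide T' T | hslide T' T].

(* The slides act on numbered tilings, so that the numbering of one end of a  *)
(* sequence of slides is inherited from the other end.                        *)
Definition mosaic_step T T' :=
  [/\ generic_tiling T, generic_tiling T' &
      same_incidences T T' \/ wall_slide T T'].

Definition mosaic_equivalent : layout R n -> layout R n -> Prop :=
  clos_refl_trans (layout R n) mosaic_step.

(* The numbers recorded in the wall shuffle of a vertical wall W, and the     *)
(* height at which each of them is recorded.                                  *)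
Definition recorded_left T W k := pts (right_edge (tile T k)) `<=` pts W /\
  exists2 W', ends_left T W W' & pts (bottom_edge (tile T k)) `<=` pts W'.

Definition recorded_right T W k := pts (left_edge (tile T k)) `<=` pts W /\
  exists2 W', ends_right T W W' & pts (top_edge (tile T k)) `<=` pts W'.

Definition record_height T W k :=
  if `[< recorded_left T W k >] then bot (tile T k) else top (tile T k).

Definition vshuffle T W : seq 'I_n :=
  sort (fun k l => record_height T W k <= record_height T W l)
    [seq k <- enum 'I_n | `[< recorded_left T W k \/ recorded_right T W k >]].

(* Likewise for a horizontal wall W, read from left to right.                 *)
Definition recorded_above T W k := pts (bottom_edge (tile T k)) `<=` pts W /\
  exists2 W', ends_above T W W' & pts (right_edge (tile T k)) `<=` pts W'.

Definition recorded_below T W k := pts (top_edge (tile T k)) `<=` pts W /\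
  exists2 W', ends_below T W W' & pts (left_edge (tile T k)) `<=` pts W'.

Definition record_abscissa T W k :=
  if `[< recorded_above T W k >] then rgt (tile T k) else lft (tile T k).

Definition hshuffle T W : seq 'I_n :=
  sort (fun k l => record_abscissa T W k <= record_abscissa T W l)
    [seq k <- enum 'I_n | `[< recorded_above T W k \/ recorded_below T W k >]].

Definition one_line x : seq 'I_n := [seq x i | i <- enum 'I_n].

(* The construction of rho in the frame [0, n] x [0, n] with the diagonal     *)
(* points diag m = (m, n - m), m = 0, ..., n; the label k : 'I_n is between   *)
(* diag k and diag k.+1.                                                      *)
Definition rho_frame : box R := Box 0 n%:R 0 n%:R.

Definition diag (m : nat) : R * R := (m%:R, n%:R - m%:R).

(* D is the union of the left and bottom edges of the frame with the          *)
(* rectangles drawn so far.                                                   *)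
Definition new_top_left (D : set (R * R)) (p : R * R) : R * R :=
  if `[< D p >] then (p.1, sup [set y | D (p.1, y) /\ p.2 <= y])
  else (sup [set a | D (a, p.2) /\ a <= p.1], p.2).

Definition new_bottom_right (D : set (R * R)) (p' : R * R) : R * R :=
  if `[< D p' >] then (sup [set a | D (a, p'.2) /\ p'.1 <= a], p'.2)
  else (p'.1, sup [set y | D (p'.1, y) /\ y <= p'.2]).

Definition new_rectangle (D : set (R * R)) k : box R :=
  let tl := new_top_left D (diag k) in
  let br := new_bottom_right D (diag k.+1) in
  Box tl.1 br.1 br.2 tl.2.

Definition drawn (s : seq 'I_n) : set (R * R) :=
  foldl (fun D k => D `|` pts (new_rectangle D k))
    (pts (left_edge rho_frame) `|` pts (bottom_edge rho_frame)) s.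

Definition rho x : layout R n := Layout rho_frame (fun k =>
  new_rectangle (drawn (take (index k (one_line x)) (one_line x))) k).

(* The subsequence of x consisting of the numbers that occur in s.            *)
Definition subword x (s : seq 'I_n) := [seq k <- one_line x | k \in s].

(* gamma x is the class of the tilings T whose tiles can be numbered, giving  *)
(* T', so that T' inherits its numbering from rho x along wall slides and     *)
(* every wall shuffle of T' is a subsequence of x. Wall slides preserve the   *)
(* two sequences to be shuffled for a wall, hence these are read off from T'. *)
Definition gamma x : set (layout R n) :=
  [set T | generic_tiling T /\ exists T',
     [/\ equivalent T' T, mosaic_equivalent (rho x) T',
         forall W, wall T' W -> vertical W ->
           vshuffle T' W = subword x (vshuffle T' W) &
         forall W, wall T' W -> horizontal W ->
           hshuffle T' W = subword x (hshuffle T' W)]].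

End Rectangulations.

Arguments gRec : clear implicits.
Arguments gamma R n x : clear implicits.

(* Main.v *)
(** A generic tiling T can be redrawn from the bottom left: draw a tile once
everything below it, to its left, or before it in a wall shuffle is drawn. The
undrawn region is bounded by a staircase. The tile at a corner can be blocked
from the left or from the right: at the first corner not from the left, at the
last not from the right, and at two consecutive corners not both from the side
of the other; so some corner is free. Numbering the tiles from top left to
bottom right gives a permutation x for which T is rho x with other coordinates
of the grid lines ([realization]). Any two such choices of coordinates are connected by
exchanging adjacent values, that is, by wall slides ([mosaic_mk]). Conversely
slides preserve such realizations ([realized_mosaic]), whose incidences are
determined by the relative order of the opposite ends at each wall
([left_of_change]), hence by the wall shuffles. *)

Require Import Defs.
From mathcomp Require Import all_boot all_order all_algebra perm.
From mathcomp Require Import boolp classical_sets functions reals.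
From mathcomp Require Import zify ring lra.
From Stdlib Require Import Relation_Operators.

Set Implicit Arguments.
Unset Strict Implicit.
Unset Printing Implicit Defensive.

Import Order.TTheory GRing.Theory Num.Theory.
Local Open Scope classical_set_scope.
Local Open Scope ring_scope.

(** * Linear orders and the grid *)

Local Open Scope nat_scope.

(** Slides act on tilings only through incidences and are hard to follow in coordinates. With the
    drawing order fixed, a realization merely assigns coordinates to the vertical and the horizontal
    grid lines [0, ..., n], not necessarily monotonically, and the only condition is that every tile
    has positive width and height. That this condition suffices for a tiling is not shown
    geometrically but by a bilinear area identity evaluated at step functions. Each inner diagonal
    point carries exactly one wall, vertical or horizontal according to the order of the two
    adjacent labels; this is why lines can be identified with walls. Two obstacles shape the rest.
    [gamma x] contains every tiling whose numbering comes from [rho x] by some sequence of slides,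
    so one inclusion needs an invariant that survives when only incidences of the next tiling are
    known. And the slide conditions speak of walls in arbitrary generic tilings, where wall ends are
    awkward to produce; they are imported from a realization, which every generic tiling has. *)

(* For the drawing order bf, tile k spans the columns lo bf k, ...,           *)
(* hi n bf k - 1 of the n x n grid, and flip bf gives its rows likewise.      *)
Definition lo (bf : rel nat) (k : nat) : nat := \max_(j < k | bf j k) j.+1.

Definition hi (n : nat) (bf : rel nat) (k : nat) : nat :=
  (k.+1 + find (bf k) (iota k.+1 (n - k.+1))).

Definition flip (bf : rel nat) : rel nat := fun i j => bf j i.

(** Totality is restricted to labels below [n] because the order [before x] read off from a word
    does not compare numbers outside the word. *)
Record torder (n : nat) (bf : rel nat) : Prop := Torder {
  to_irr : irreflexive bf;
  to_trans : transitive bf;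
  to_total : forall i j, (i < n) -> j < n -> i != j -> bf i j || bf j i }.

Lemma torder_flip n bf : torder n bf -> torder n (flip bf).
Proof.
case=> Hi Ht Hc; split=> [i|j i k H1 H2|i j Hn Hm ij]; first exact: Hi.
  exact: Ht H2 H1.
by rewrite /flip orbC Hc.
Qed.

Section LoHi.
Variables (n : nat) (bf : rel nat).

Lemma lo_leP k a :
  (lo bf k <= a) <-> (forall j, (a <= j < k) -> ~~ bf j k).
Proof.
split=> [H j /andP[aj jk]|H].
  apply/negP=> bjk.
  have : j.+1 <= lo bf k.
    by have := @leq_bigmax_cond _ (fun i : 'I_k => bf i k) (fun i => i.+1) (Ordinal jk) bjk.
  lia.
apply/bigmax_leqP => i bik; rewrite ltnNge; apply/negP=> ai.
by have := H i; rewrite bik ai ltn_ord => /(_ isT).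
Qed.

Lemma hi_gtP k a : k < n ->
  (a < hi n bf k) <-> (a <= k \/ (a < n /\ forall j, (k < j <= a) -> ~~ bf k j)).
Proof.
move=> kn; rewrite /hi.
set s := iota _ _.
have ss : size s = (n - k.+1) by rewrite size_iota.
have fs : find (bf k) s <= n - k.+1 by rewrite -ss find_size.
split=> [H|].
  case: (leqP a k) => ak; [by left|right]; split; first lia.
  move=> j /andP[kj ja].
  have jf : j - k.+1 < find (bf k) s by lia.
  have := before_find 0 jf; rewrite nth_iota; last lia.
  by rewrite subnKC // => ->.
case=> [|[an H]]; first lia.
case: (leqP a k) => ak; first lia.
rewrite ltnNge; apply/negP=> Hf.
have hs : has (bf k) s by rewrite has_find ss; lia.
have := nth_find 0 hs; rewrite nth_iota; last by rewrite -ss -has_find.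
by apply/negP/H; lia.
Qed.

Lemma lo_le k : lo bf k <= k.
Proof. by apply/lo_leP=> j; lia. Qed.

Lemma hi_gt k : k < n -> (k < hi n bf k).
Proof. by move=> kn; apply/(hi_gtP _ kn); left. Qed.

Lemma hi_le k : k < n -> (hi n bf k <= n).
Proof.
by move=> kn; rewrite leqNgt; apply/negP => /(hi_gtP _ kn); lia.
Qed.

Lemma lo_eqP k m : 0 < m ->
  (lo bf k = m <-> [/\ m <= k, bf m.-1 k & forall j, (m <= j < k) -> ~~ bf j k]).
Proof.
move=> m0; split=> [E|[mk b H]].
  have H : forall j, (m <= j < k) -> ~~ bf j k by apply/lo_leP; rewrite E.
  have mk := lo_le k; rewrite E in mk.
  split=> //; apply/negPn/negP=> nb.
  suff : lo bf k <= m.-1 by lia.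
  apply/lo_leP=> j jk; case: (eqVneq j m.-1) => [->//|?]; apply: H; lia.
have /lo_leP lm := H.
apply/eqP; rewrite eqn_leq lm /= leqNgt; apply/negP=> lt.
have /lo_leP H2 : lo bf k <= m.-1 by lia.
by move: (H2 m.-1); rewrite b /= => H3; suff : false by []; apply: H3; lia.
Qed.

Lemma hi_eqP k m : k < n -> m < n ->
  (hi n bf k = m <-> [/\ k < m, bf k m & forall j, (k < j < m) -> ~~ bf k j]).
Proof.
move=> kn mn; split=> [E|[km b H]].
  have km := hi_gt kn; rewrite E in km.
  have /(hi_gtP _ kn) [?|[_ H]] : m.-1 < hi n bf k by lia.
    have mE : m = k.+1 by lia.
    split=> //; last by lia.
    apply/negPn/negP=> nb.
    suff : m < hi n bf k by lia.
    apply/(hi_gtP _ kn); right; split=> // j jm.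
    by have -> : j = m by lia.
  have H' : forall j, (k < j < m) -> ~~ bf k j by move=> j jm; apply: H; lia.
  split=> //; apply/negPn/negP=> nb.
  suff : m < hi n bf k by lia.
  apply/(hi_gtP _ kn); right; split=> // j jm.
  by case: (eqVneq j m) => [->//|?]; apply: H'; lia.
apply/eqP; rewrite eqn_leq; apply/andP; split.
  rewrite leqNgt; apply/negP=> /(hi_gtP _ kn) [|[_ H2]]; first lia.
  by move: (H2 m); rewrite b /= => H3; suff : false by []; apply: H3; lia.
suff : m.-1 < hi n bf k by lia.
apply/(hi_gtP _ kn); right; split; first lia.
by move=> j jm; apply: H; lia.
Qed.

End LoHi.

Section Order.
Variables (n : nat) (bf : rel nat).
Hypothesis bfT : torder n bf.

Lemma bf_asym i j : bf i j -> ~~ bf j i.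
Proof.
by move=> b; apply/negP=> b'; have := to_trans bfT b b'; rewrite (to_irr bfT).
Qed.

Lemma bf_tr i j k : bf i j -> bf j k -> bf i k.
Proof. exact: (to_trans bfT). Qed.

Lemma bf_neg i j : i < n -> j < n -> i <> j -> ~~ bf i j -> bf j i.
Proof.
by move=> ilt jlt /eqP ij /negbTE nb; have := to_total bfT ilt jlt ij; rewrite nb.
Qed.

Lemma last_in_interval b a : b <= a < n ->
  exists2 k, (b <= k <= a) & forall j, (b <= j <= a) -> j <> k -> bf j k.
Proof.
elim: a => [|a IH] /andP[ba an].
  by exists 0 => //; lia.
case: (leqP b a) => [ba'|ab]; last by exists a.+1 => //; lia.
case: IH => [|k kba H]; first lia.
have kn : k < n by lia.
have k1 : k <> a.+1 by lia.
case/boolP: (bf k a.+1) => [b1|nb1].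
  exists a.+1; first lia.
  move=> j jb ja; case: (eqVneq j k) => [->//|/eqP jk].
  by apply: (to_trans bfT) b1; apply: H => //; lia.
have b2 := bf_neg kn an k1 nb1.
exists k; first lia.
move=> j jb jk; case: (eqVneq j a.+1) => [->//|?]; apply: H => //; lia.
Qed.

End Order.

Lemma first_in_interval n bf b a : torder n bf -> b <= a < n ->
  exists2 k, (b <= k <= a) & forall j, (b <= j <= a) -> j <> k -> bf k j.
Proof. by move=> /torder_flip/last_in_interval H /H. Qed.

(* The cell in column a and row b of the n x n grid lies in tile k. *)
Definition cell n bf a b k :=
  (lo bf k <= a < hi n bf k) && (lo (flip bf) k <= b < hi n (flip bf) k).

Lemma cell_flip n bf a b k : cell n (flip bf) a b k = cell n bf b a k.
Proof. by rewrite /cell andbC. Qed.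

(** Rows count from the top, so [b <= a] means on or above the diagonal. Going right from [k] to
    column [a], or up to row [b], tile [k] is stopped exactly by a label drawn after [k]. So the
    cell belongs to the last drawn label in [[b, a]]. Cells on the other side follow by reversing
    the order. *)
Lemma cell_last n bf a b k : torder n bf -> b <= a < n -> k < n ->
  cell n bf a b k <-> (b <= k <= a) /\ forall j, (b <= j <= a) -> j <> k -> bf j k.
Proof.
move=> bfT ban kn; have T' := torder_flip bfT; split.
  move=> /andP[/andP[/lo_leP h1 /(hi_gtP _ _ kn) h2] /andP[/lo_leP h3 /(hi_gtP _ _ kn) h4]].
  have bk : b <= k.
    rewrite leqNgt; apply/negP=> kb.
    case: h2 => [|[_ h2]]; first lia.
    case: h4 => [|[_ h4]]; first lia.
    have bn : b < n by lia.
    have := @h4 b; have := @h2 b; rewrite /flip.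
    have: bf k b || bf b k by apply: (to_total bfT); lia.
    case: (bf k b) => /=; [move=> _ /(_ ltac:(lia))//|move=> -> _ /(_ ltac:(lia))//].
  have ka : k <= a.
    rewrite leqNgt; apply/negP=> ak.
    have := @h1 a; have := @h3 a; rewrite /flip.
    have: bf k a || bf a k by apply: (to_total bfT); lia.
    case: (bf k a) => /=; [move=> _ /(_ ltac:(lia))//|move=> -> _ /(_ ltac:(lia))//].
  split; first lia.
  move=> j jb jk; have jn : j < n by lia.
  case: (ltngtP j k) => [lt|gt|//].
    by apply: (bf_neg bfT) => //; [lia|apply: h3; lia].
  case: h2 => [|[_ h2]]; first lia.
  by apply: (bf_neg bfT) => //; [lia|apply: h2; lia].
move=> [bka H]; have Hn j : b <= j <= a -> j <> k -> ~~ bf k j.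
  by move=> h h'; apply: (bf_asym bfT); apply: H.
apply/andP; split; apply/andP; split.
- by apply/lo_leP => j; lia.
- by apply/(hi_gtP _ _ kn); right; split; [lia|move=> j jk; apply: Hn; lia].
- by apply/lo_leP => j jk; apply: Hn; lia.
by apply/(hi_gtP _ _ kn); left; lia.
Qed.

Lemma cell_ex n bf a b : torder n bf -> a < n -> b < n ->
  exists2 k, (k < n) & cell n bf a b k.
Proof.
move=> bfT an bn; case: (leqP b a) => ab.
  case: (last_in_interval bfT (b:=b) (a:=a)) => [|k kb H]; first lia.
  exists k; first lia.
  by apply/cell_last => //; lia.
have T' := torder_flip bfT.
case: (last_in_interval T' (b:=a) (a:=b)) => [|k kb H]; first lia.
exists k; first lia.
by rewrite -cell_flip; apply/cell_last => //; lia.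
Qed.

Lemma cell_uniq n bf a b k l : torder n bf -> a < n -> b < n ->
  (k < n) -> l < n -> cell n bf a b k -> cell n bf a b l -> k = l.
Proof.
move=> bfT an bn kn ln.
suff main bf' a' b' : torder n bf' -> b' <= a' < n ->
    cell n bf' a' b' k -> cell n bf' a' b' l -> k = l.
  case: (leqP b a) => ab; first by apply: main => //; lia.
  by rewrite -!(cell_flip _ _ b a); apply: main; [exact: torder_flip|lia].
move=> T' ba /(cell_last T' ba kn)[kb Hk] /(cell_last T' ba ln)[lb Hl].
case: (eqVneq k l) => [//|/eqP kl].
have := bf_asym T' (Hk l lb (nesym kl)).
by rewrite (Hl k kb kl).
Qed.

Local Open Scope ring_scope.

Section Identity.
Variables (n : nat) (bf : rel nat).
Hypothesis bfT : torder n bf.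

Lemma telescope_cut (f : nat -> int) l h : (l <= h <= n)%N ->
  f h - f l = \sum_(a < n) (f a.+1 - f a) *+ (l <= a < h)%N.
Proof.
move=> /andP[lh hn].
rewrite -(telescope_sumr _ lh) -(big_mkord predT (fun a => (f a.+1 - f a) *+ (l <= a < h)%N)).
have ln := leq_trans lh hn.
rewrite (big_cat_nat (leq0n l) ln) (big_cat_nat lh hn) /=.
rewrite [X in _ = X + _]big1_seq ?add0r; last first.
  move=> i /=; rewrite mem_index_iota => Hi; have -> // : (l <= i < h)%N = false.
  by apply/negP=> /andP[]; lia.
rewrite [X in _ = _ + X]big1_seq ?addr0; last first.
  move=> i /=; rewrite mem_index_iota => Hi; have -> // : (l <= i < h)%N = false.
  by apply/negP=> /andP[]; lia.
by apply: eq_big_nat => i ->; rewrite mulr1n.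
Qed.

Lemma sum_cell a b : (a < n)%N -> (b < n)%N -> (\sum_(k < n) cell n bf a b k)%N = 1%N.
Proof.
move=> an bn; case: (cell_ex bfT an bn) => k kn ck.
rewrite (bigD1 (Ordinal kn)) //= ck big1 // => i ik.
case/boolP: (cell n bf a b i) => // ci.
by case/eqP: ik; apply: val_inj => /=; apply: cell_uniq ci ck => //.
Qed.

(* The area of the frame is the sum of the areas of the tiles; being bilinear *)
(* in the coordinates, this holds for arbitrary coordinate functions.         *)
Lemma area_identity (f g : nat -> int) :
  \sum_(k < n) (f (hi n bf k) - f (lo bf k)) *
     (g (hi n (flip bf) k) - g (lo (flip bf) k)) = (f n - f 0%N) * (g n - g 0%N).
Proof.
have tc (h : nat -> int) bf' (k : 'I_n) : h (hi n bf' k) - h (lo bf' k) =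
    \sum_(a < n) (h a.+1 - h a) *+ (lo bf' k <= a < hi n bf' k)%N.
  apply: telescope_cut.
  by have := lo_le bf' k; have := hi_gt bf' (ltn_ord k); have := hi_le bf' (ltn_ord k); lia.
have t0 (h : nat -> int) : h n - h 0%N = \sum_(a < n) (h a.+1 - h a).
  by rewrite -(big_mkord predT (fun a => h a.+1 - h a)) telescope_sumr.
under eq_bigr => k _ do rewrite !tc big_distrlr /=.
rewrite exchange_big /= !t0 big_distrlr /=; apply: eq_bigr => a _.
rewrite exchange_big /=; apply: eq_bigr => b _.
transitivity (\sum_(k < n) (f a.+1 - f a) * (g b.+1 - g b) *+ cell n bf a b k).
  apply: eq_bigr => k _; rewrite /cell.
  by case: (_ <= a < _)%N; case: (_ <= b < _)%N; rewrite /= ?mulr0n ?mulr1n ?mulr0 ?mul0r.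
rewrite sumrMnr sum_cell // ; exact: ltn_ord.
Qed.

End Identity.

(** * Tiles along a wall of the grid *)

Section Neighbours.
Local Open Scope nat_scope.
Variables (n : nat) (bf : rel nat).
Hypothesis bfT : torder n bf.

(** The diagonal point [m] carries a vertical wall if [m.-1] is drawn before [m] and a horizontal
    one otherwise; so a right side strictly inside the frame lies on a line that carries a vertical
    wall. *)
Lemma hi_wall k m : k < n -> hi n bf k = m -> m < n -> (0 < m) /\ bf m.-1 m.
Proof.
move=> kn /hi_eqP H mn; case: H => // km b H; split; first lia.
case: (eqVneq k m.-1) => [<-//|km1].
apply: (to_trans bfT) b; apply: (bf_neg bfT) => //; [lia|lia|apply: H; lia].
Qed.

Lemma lo_wall k m : k < n -> lo bf k = m -> 0 < m -> (m < n) /\ bf m.-1 m.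
Proof.
move=> kn E m0; move/(lo_eqP _ _ m0): E => [mk b H]; split; first lia.
case: (eqVneq k m) b H => [->//|km1 b H].
apply: (bf_tr bfT b); apply: (bf_neg bfT) => //; [lia|lia|apply: H; lia].
Qed.

Lemma lo_wall_self m : m < n -> 0 < m -> bf m.-1 m -> lo bf m = m.
Proof. by move=> mn m0 b; apply/lo_eqP => //; split=> //; lia. Qed.

Lemma hi_wall_self m : m < n -> 0 < m -> bf m.-1 m -> hi n bf m.-1 = m.
Proof. by move=> mn m0 b; apply/hi_eqP => //; [lia|split=> //; lia]. Qed.

(** Tile [m.-1] is the lowest one on the left of wall [m]. Any other tile [k] there has a tile [b]
    under it on the same wall: the last drawn label strictly between [k] and [m]. *)
Lemma hi_below k m : hi n bf k = m -> m < n -> k.+1 < m ->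
  [/\ hi n (flip bf) k = k.+1, bf k.+1 k &
     exists b, [/\ k < b < m, hi n bf b = m & lo (flip bf) b = k.+1]].
Proof.
move=> E mn km; have kn : k < n by lia.
move/(hi_eqP _ kn mn): E => [_ bkm H].
have bk1 : bf k.+1 k.
  by apply: (bf_neg bfT); [lia|lia|lia|apply: H; lia].
split=> //.
  by apply/hi_eqP => //; [lia|split=> //; lia].
case: (last_in_interval bfT (b:=k.+1) (a:=m.-1)) => [|b kb Hb]; first lia.
have bbk : bf b k by apply: (bf_neg bfT); [lia|lia|lia|apply: H; lia].
exists b; split; first lia.
  apply/hi_eqP; [lia|lia|split; [lia|exact: (bf_tr bfT bbk bkm)|]].
  by move=> j jb; apply: (bf_asym bfT); apply: Hb; lia.
apply/lo_eqP => //; split; [lia|exact: bbk|].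
by move=> j jb; apply: (bf_asym bfT); apply: Hb; lia.
Qed.

Lemma lo_above k m : k < n -> lo bf k = m -> 0 < m -> m < k ->
  [/\ lo (flip bf) k = k, bf k k.-1 &
     exists c, [/\ m <= c < k, lo bf c = m & hi n (flip bf) c = k]].
Proof.
move=> kn E m0 mk.
move/(lo_eqP _ _ m0): E => [_ bkm H].
have bk1 : bf k k.-1.
  by apply: (bf_neg bfT); [lia|lia|lia|apply: H; lia].
split=> //.
  by apply/lo_eqP; [lia|split=> //; lia].
case: (first_in_interval (b:=m) (a:=k.-1) bfT) => [|c kc Hc]; first lia.
have bbk : bf k c by apply: (bf_neg bfT); [lia|lia|lia|apply: H; lia].
exists c; split; first lia.
  apply/lo_eqP => //; split; [lia|exact: (bf_tr bfT bkm bbk)|].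
  by move=> j jb; apply: (bf_asym bfT); apply: Hc; lia.
apply/hi_eqP; [lia|lia|split; [lia|exact: bbk|]].
by move=> j jb; apply: (bf_asym bfT); apply: Hc; lia.
Qed.

Local Notation bf' := (flip bf).

(** Either the wall continues above [i], and then the next tile on its left is [q.-1], or [i]
    reaches the upper end of the wall, which is the top of tile [m]. *)
Lemma lo_flip_up i m q : i < n -> hi n bf i = m -> m < n -> lo bf' i = q ->
  [/\ 0 < q, bf q q.-1 & hi n bf q.-1 = m] \/ lo bf' m = q.
Proof.
move=> ilt im mn iq; have qi : q <= i by rewrite -iq lo_le.
move/(hi_eqP _ ilt mn): im => [im bim Him].
have Hiq j : q <= j < i -> ~~ bf i j by move: j; apply/(lo_leP bf'); rewrite iq.
have Hb j : q <= j < m -> j <> i -> bf j i.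
  move=> jqm ji; apply: (bf_neg bfT); [lia|lia|lia|].
  by case: (ltngtP j i) => // h; [apply: Hiq; lia|apply: Him; lia].
have Hm j : q <= j < m -> bf j m.
  by move=> jqm; case: (eqVneq j i) => [->//|/eqP ji]; apply: (bf_tr bfT) bim; apply: Hb.
have lq : lo bf' m <= q.
  by apply/lo_leP => j jq; apply: (bf_asym bfT); apply: Hm; lia.
case: (posnP q) => [e|q0]; first by right; lia.
move/(lo_eqP _ _ q0): iq => [_ biq _]; rewrite /flip in biq.
have bq j : q <= j < m -> bf j q.-1.
  by move=> jqm; case: (eqVneq j i) => [->//|/eqP ji]; apply: (bf_tr bfT) biq; apply: Hb.
case: (boolP (bf q.-1 m)) => b; [left|right].
  split=> //; first by apply: bq; lia.
  apply/hi_eqP; [lia|lia|split=> //; first lia].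
  by move=> j jq; apply: (bf_asym bfT); apply: bq; lia.
apply/lo_eqP => //; split; [lia|by apply: (bf_neg bfT _ _ _ b); lia|].
by move=> j jq; rewrite /flip; apply: (bf_asym bfT); apply: Hm; lia.
Qed.

Lemma hi_flip_down j m p : j < n -> lo bf j = m -> 0 < m -> hi n bf' j = p ->
  [/\ p < n, bf p p.-1 & lo bf p = m] \/ hi n bf' m.-1 = p.
Proof.
move=> jn jm m0 jp; have jpn : j < p <= n by rewrite -jp hi_gt ?hi_le.
move/(lo_eqP _ _ m0): jm => [mj bmj Hj]; have m1n : m.-1 < n by lia.
have Hp i : j < i < p -> ~~ bf i j.
  by move=> ijp; have /(hi_gtP _ _ jn)[|[_ H]] : p.-1 < hi n bf' j; [lia|lia|apply: H; lia].
have Hb i : m <= i < p -> i <> j -> bf j i.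
  move=> ip ij; apply: (bf_neg bfT); [lia|lia|lia|].
  by case: (ltngtP i j) => // h; [apply: Hj; lia|apply: Hp; lia].
have Hm i : m <= i < p -> bf m.-1 i.
  by move=> ip; case: (eqVneq i j) => [->//|/eqP ij]; apply: (bf_tr bfT bmj); apply: Hb.
have lp : p <= hi n bf' m.-1.
  suff : p.-1 < hi n bf' m.-1 by lia.
  apply/(hi_gtP _ _ m1n); right; split; first lia.
  by move=> i im; apply: (bf_asym bfT); apply: Hm; lia.
case: (ltnP p n) => [pn|np]; last by right; have := hi_le bf' m1n; lia.
move/(hi_eqP _ jn pn): jp => [_ bpj _]; rewrite /flip in bpj.
have bp i : m <= i < p -> bf p i.
  by move=> ip; case: (eqVneq i j) => [->//|/eqP ij]; apply: (bf_tr bfT bpj); apply: Hb.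
case: (boolP (bf m.-1 p)) => b; [left|right].
  split=> //; first by apply: bp; lia.
  apply/lo_eqP => //; split=> //; first lia.
  by move=> i ip; apply: (bf_asym bfT); apply: bp; lia.
apply/hi_eqP; [lia|lia|split; [lia|by apply: (bf_neg bfT _ _ _ b); lia|]].
by move=> i im; rewrite /flip; apply: (bf_asym bfT); apply: Hm; lia.
Qed.

End Neighbours.

Section Columns.
Local Open Scope nat_scope.
Variables (n : nat) (bf : rel nat).
Hypothesis bfT : torder n bf.
Local Notation bf' := (flip bf).

Lemma left_tile_at (P : pred nat) m : 0 < m < n -> bf m.-1 m ->
  P (lo bf' m) -> ~~ P (hi n bf' m.-1) ->
  exists k : 'I_n, [/\ hi n bf k = m, P (lo bf' k) & ~~ P (hi n bf' k)].
Proof.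
move=> /andP[m0 mn] bm P1 P2; have bfT' := torder_flip bfT.
have : m.-1 < n by lia.
have := hi_wall_self mn m0 bm; move: P2; move: (m.-1); elim/ltn_ind => i IH P2 im ilt.
case: (boolP (P (lo bf' i))) => P3; first by exists (Ordinal ilt).
have qi := lo_le bf' i.
case: (lo_flip_up bfT ilt im mn erefl) P3 => [[q0 bq hq]|<-]; last by rewrite P1.
have qn : lo bf' i < n by lia.
by rewrite -{1}(@hi_wall_self n bf' _ qn q0 bq) => P3; apply: IH P3 hq _; lia.
Qed.

Lemma right_tile_at (P : pred nat) m : 0 < m < n -> bf m.-1 m ->
  P (lo bf' m) -> ~~ P (hi n bf' m.-1) ->
  exists k : 'I_n, [/\ lo bf k = m, P (lo bf' k) & ~~ P (hi n bf' k)].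
Proof.
move=> /andP[m0 mn] bm P1 P2.
suff H d j : n - j <= d -> j < n -> lo bf j = m -> P (lo bf' j) ->
    exists k : 'I_n, [/\ lo bf k = m, P (lo bf' k) & ~~ P (hi n bf' k)].
  by apply: (H _ m (leqnn _)) => //; apply: lo_wall_self.
elim: d j => [|d IH] j jd jn jm P3; first lia.
case: (boolP (P (hi n bf' j))) => P4; last by exists (Ordinal jn).
have jp := hi_gt bf' jn.
case: (hi_flip_down bfT jn jm m0 erefl) P4 => [[pn bp lp]|<-]; last by rewrite (negbTE P2).
have p0 : 0 < hi n bf' j by lia.
by rewrite -{1}(@lo_wall_self n bf' _ pn p0 bp) => P4; apply: IH pn lp P4; lia.
Qed.

End Columns.

(** * Tilings *)

Section Cuts.
Variable R : realType.
Implicit Types (u v z a b : R) (s : bool).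

(* The cut (u, true) is just above u and (u, false) just below u.            *)
Definition cut s u z := if s then z <= u else z < u.

Lemma cut_lt s u a b : cut s u a -> ~~ cut s u b -> a < b.
Proof. by case: s => /=; rewrite -?ltNge -?leNgt; lra. Qed.

Lemma cut_le s u a b : a <= b -> cut s u b -> cut s u a.
Proof. by case: s => /=; lra. Qed.

Lemma cut_near s u a : cut s u a -> a <= u.
Proof. by case: s => /=; lra. Qed.

Lemma ncut_near s u a : ~~ cut s u a -> u <= a.
Proof. by case: s => /=; rewrite -?ltNge -?leNgt; lra. Qed.

Lemma cut_separates u a b : a < b -> a <= u <= b -> exists s, cut s u a /\ ~~ cut s u b.
Proof.
move=> ab /andP[au ub]; case: (ltP u b) => h; [exists true|exists false].
  by rewrite /= au -ltNge.
by rewrite /= (lt_le_trans ab h) -leNgt.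
Qed.

(** Only finitely many coordinates matter, so the infinitesimal shift can be replaced by a small
    real one. *)
Lemma cut_point (l : seq R) s u :
  exists u', forall z, z \in l -> (z < u') = cut s u z /\ (z <= u') = cut s u z.
Proof.
have [e e0 He] : exists2 e : R, 0 < e &
    forall z, z \in l -> (u < z -> u + e < z) /\ (z < u -> z < u - e).
  elim: l => [|a l [e e0 He]]; first by exists 1.
  have [d [d0 de da1 da2]] : exists d : R, [/\ 0 < d, d <= e,
      u < a -> u + d < a & a < u -> a < u - d].
    case: (ltgtP a u) => [lt|gt|_]; last by exists e; split=> //; lra.
      by case: (leP e ((u - a) / 2)) => h; [exists e|exists ((u - a) / 2)]; split; lra.
    by case: (leP e ((a - u) / 2)) => h; [exists e|exists ((a - u) / 2)]; split; lra.
  exists d => // z; rewrite inE => /orP[/eqP ->//|/He [h1 h2]].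
  by split=> [/h1|/h2]; lra.
exists (if s then u + e else u - e) => z /He [h1 h2].
case: s => /=; split; apply/idP/idP; case: (ltgtP u z) => // h;
  try (have := h1 h); try (have := h2 h); try lra.
Qed.

End Cuts.

Section Tilings.
Variables (R : realType) (n : nat).
Implicit Types (T : layout R n) (W : box R) (i j k : 'I_n) (s : bool) (u v : R).

(** Tile [k] contains the point [(u, v)] after an infinitesimal shift to one side in each direction.
    A shifted point lies on no side, hence in exactly one tile, which avoids case distinctions at
    the boundaries. *)
Definition occ T s u s' v k :=
  [&& cut s u (lft (tile T k)), ~~ cut s u (rgt (tile T k)),
      cut s' v (bot (tile T k)) & ~~ cut s' v (top (tile T k))].

Definition in_frame T s u s' v :=
  [&& cut s u (lft (frame T)), ~~ cut s u (rgt (frame T)),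
      cut s' v (bot (frame T)) & ~~ cut s' v (top (frame T))].

Local Ltac in_frame_lra := rewrite /in_frame /= -?leNgt -?ltNge; apply/and4P; split; lra.

Lemma occP T s u s' v k : reflect
  [/\ cut s u (lft (tile T k)), ~~ cut s u (rgt (tile T k)),
      cut s' v (bot (tile T k)) & ~~ cut s' v (top (tile T k))] (occ T s u s' v k).
Proof. exact: and4P. Qed.

Section Facts.
Variable T : layout R n.
Hypothesis tT : tiling T.

Lemma tile_x k : lft (tile T k) < rgt (tile T k).
Proof. by case: tT => _ /(_ k) []. Qed.

Lemma tile_y k : bot (tile T k) < top (tile T k).
Proof. by case: tT => _ /(_ k) []. Qed.

Lemma frame_x : lft (frame T) < rgt (frame T).
Proof. by case: tT => [[]]. Qed.

Lemma frame_y : bot (frame T) < top (frame T).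
Proof. by case: tT => [[]]. Qed.

Lemma tile_sub k : pts (tile T k) `<=` pts (frame T).
Proof. by case: tT => _ _ <- _ p pk; exists k. Qed.

Lemma tile_in_frame k : [/\ lft (frame T) <= lft (tile T k), rgt (tile T k) <= rgt (frame T),
  bot (frame T) <= bot (tile T k) & top (tile T k) <= top (frame T)].
Proof.
have hx := tile_x k; have hy := tile_y k.
have [] : pts (frame T) (lft (tile T k), bot (tile T k)).
  by apply: (@tile_sub k); rewrite /pts /=; lra.
have [] : pts (frame T) (rgt (tile T k), top (tile T k)).
  by apply: (@tile_sub k); rewrite /pts /=; lra.
by move=> /= /andP[h1 h2] /andP[h3 h4] /andP[h5 h6] /andP[h7 h8].
Qed.

Lemma overlap i j :
  lft (tile T i) < rgt (tile T j) -> lft (tile T j) < rgt (tile T i) ->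
  bot (tile T i) < top (tile T j) -> bot (tile T j) < top (tile T i) -> i = j.
Proof.
move=> h1 h2 h3 h4; apply/eqP/negPn/negP => ij.
have hx := tile_x; have hy := tile_y.
case: tT => _ _ _ /(_ i j ij) E.
have mid (a b c d : R) : a < b -> c < d -> a < d -> c < b ->
    exists z, a < z < b /\ c < z < d.
  move=> ? ? ? ?; exists ((Num.max a c + Num.min b d) / 2).
  by case: (leP a c) => ?; case: (leP b d) => ?; split; lra.
have [x [x1 x2]] := mid _ _ _ _ (hx i) (hx j) h1 h2.
have [y [y1 y2]] := mid _ _ _ _ (hy i) (hy j) h3 h4.
suff : set0 (x, y) by [].
by rewrite -E; split; split.
Qed.

Lemma abut_right e k : bot (tile T e) < top (tile T k) -> bot (tile T k) < top (tile T e) ->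
  lft (tile T e) <= rgt (tile T k) -> rgt (tile T k) < rgt (tile T e) ->
  lft (tile T e) = rgt (tile T k).
Proof.
move=> h1 h2 h3 h4; apply/eqP; rewrite eq_le h3 /= leNgt; apply/negP=> h5.
by move: (h4); rewrite (overlap h5 (lt_trans (tile_x k) h4) h1 h2) ltxx.
Qed.

Lemma abut_left e k : bot (tile T e) < top (tile T k) -> bot (tile T k) < top (tile T e) ->
  lft (tile T k) <= rgt (tile T e) -> lft (tile T e) < lft (tile T k) ->
  rgt (tile T e) = lft (tile T k).
Proof.
move=> h1 h2 h3 h4; apply/eqP; rewrite eq_le h3 andbT leNgt; apply/negP=> h5.
by move: (h4); rewrite (overlap (lt_trans h4 (tile_x k)) h5 h1 h2) ltxx.
Qed.

Lemma abut_above e k : lft (tile T e) < rgt (tile T k) -> lft (tile T k) < rgt (tile T e) ->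
  bot (tile T e) <= top (tile T k) -> top (tile T k) < top (tile T e) ->
  bot (tile T e) = top (tile T k).
Proof.
move=> h1 h2 h3 h4; apply/eqP; rewrite eq_le h3 /= leNgt; apply/negP=> h5.
by move: (h4); rewrite (overlap h1 h2 h5 (lt_trans (tile_y k) h4)) ltxx.
Qed.

Lemma abut_below e k : lft (tile T e) < rgt (tile T k) -> lft (tile T k) < rgt (tile T e) ->
  bot (tile T k) <= top (tile T e) -> bot (tile T e) < bot (tile T k) ->
  top (tile T e) = bot (tile T k).
Proof.
move=> h1 h2 h3 h4; apply/eqP; rewrite eq_le h3 andbT leNgt; apply/negP=> h5.
by move: (h4); rewrite (overlap h1 h2 (lt_trans h4 (tile_y k)) h5) ltxx.
Qed.

Lemma occ_uniq s u s' v i j : occ T s u s' v i -> occ T s u s' v j -> i = j.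
Proof.
move=> /occP[a1 a2 a3 a4] /occP[b1 b2 b3 b4]; apply: overlap.
- exact: cut_lt a1 b2.
- exact: cut_lt b1 a2.
- exact: cut_lt a3 b4.
exact: cut_lt b3 a4.
Qed.

Lemma occ_ex s u s' v : in_frame T s u s' v -> exists k, occ T s u s' v k.
Proof.
move=> /and4P[f1 f2 f3 f4].
have [x Hx] := cut_point ([:: lft (frame T); rgt (frame T)] ++
  [seq lft (tile T k) | k <- enum 'I_n] ++ [seq rgt (tile T k) | k <- enum 'I_n]) s u.
have [y Hy] := cut_point ([:: bot (frame T); top (frame T)] ++
  [seq bot (tile T k) | k <- enum 'I_n] ++ [seq top (tile T k) | k <- enum 'I_n]) s' v.
have : pts (frame T) (x, y).
  have [_ a] := Hx (lft (frame T)) (mem_head _ _).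
  have [b _] : (rgt (frame T) < x) = _ /\ _ := Hx (rgt (frame T)) ltac:(by rewrite !inE eqxx orbT).
  have [_ c] := Hy (bot (frame T)) (mem_head _ _).
  have [d _] : (top (frame T) < y) = _ /\ _ := Hy (top (frame T)) ltac:(by rewrite !inE eqxx orbT).
  by split=> /=; rewrite leNgt ?[_ <= x]a ?[_ <= y]c ?a ?b ?c ?d; apply/andP; split=> //; rewrite -?leNgt ?a ?b ?c ?d // leNgt ?b ?d.
case: tT => _ _ <- _ [k _ [/= /andP[kx1 kx2] /andP[ky1 ky2]]].
have mem (f : 'I_n -> R) : f k \in [seq f k | k <- enum 'I_n].
  by apply: map_f; rewrite mem_enum.
exists k; apply/occP; split.
- by case: (Hx (lft (tile T k))) => [|_ <-//]; rewrite !mem_cat mem !orbT.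
- by case: (Hx (rgt (tile T k))) => [|<- _]; rewrite ?mem_cat ?mem ?orbT // -leNgt.
- by case: (Hy (bot (tile T k))) => [|_ <-//]; rewrite !mem_cat mem !orbT.
- by case: (Hy (top (tile T k))) => [|<- _]; rewrite ?mem_cat ?mem ?orbT // -leNgt.
Qed.

End Facts.

Lemma tiling_intro T : rectangle (frame T) -> (forall k, rectangle (tile T k)) ->
  (forall k, [/\ lft (frame T) <= lft (tile T k), rgt (tile T k) <= rgt (frame T),
     bot (frame T) <= bot (tile T k) & top (tile T k) <= top (frame T)]) ->
  (forall s u s' v, in_frame T s u s' v -> exists k, occ T s u s' v k) ->
  (forall s u s' v i j, occ T s u s' v i -> occ T s u s' v j -> i = j) -> tiling T.
Proof.
move=> [fx fy] rT iT eT uT; split=> // [|i j ij].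
  rewrite eqEsubset; split=> p.
    by case=> k _ []; case: (iT k) => ? ? ? ?; rewrite /pts /=; lra.
  case=> /andP[x1 x2] /andP[y1 y2].
  have [s [s1 s2]] := cut_separates (u := p.1) fx ltac:(by rewrite x1 x2).
  have [s' [s3 s4]] := cut_separates (u := p.2) fy ltac:(by rewrite y1 y2).
  have [|k /occP[k1 k2 k3 k4]] := eT s p.1 s' p.2; first exact/and4P.
  exists k => //; split; apply/andP; split;
    by [apply: cut_near; eassumption|apply: ncut_near; eassumption].
rewrite -subset0 => p [[/andP[a1 a2] /andP[a3 a4]] [/andP[b1 b2] /andP[b3 b4]]].
case/eqP: ij; apply: (uT true p.1 true p.2); apply/occP; rewrite /= -!ltNge.
  by split=> //; apply: ltW.
by split=> //; apply: ltW.
Qed.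

Lemma no_cross T x y a b c d : generic_tiling T ->
  rgt (tile T a) = x -> bot (tile T a) = y -> lft (tile T b) = x -> bot (tile T b) = y ->
  rgt (tile T c) = x -> top (tile T c) = y -> lft (tile T d) = x -> top (tile T d) = y -> False.
Proof.
move=> [tT gT] a1 a2 b1 b2 c1 c2 d1 d2.
have hx := tile_x tT; have hy := tile_y tT.
suff : ~~ uniq [:: a; b; c; d].
  apply/negP/negPn; rewrite /= !inE !negb_or !andbT.
  have [ha hb hc hd] := And4 (hx a) (hx b) (hx c) (hx d).
  have [ha' hb' hc' hd'] := And4 (hy a) (hy b) (hy c) (hy d).
  do !(apply/andP; split); apply/eqP=> E; subst; lra.
apply: (gT (x, y)); split=> /=; by auto.
Qed.

(* At such a corner of two tiles, the two tiles filling the other quadrants    *)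
(* would have corners as well.                                                *)
Lemma no_touch_down T i j : generic_tiling T ->
  rgt (tile T i) = lft (tile T j) -> bot (tile T i) <> top (tile T j).
Proof.
move=> gT xE yE; have [tT _] := gT.
have [xi xj yi yj] := And4 (tile_x tT i) (tile_x tT j) (tile_y tT i) (tile_y tT j).
have [fi1 fi2 fi3 fi4] := tile_in_frame tT i.
have [fj1 fj2 fj3 fj4] := tile_in_frame tT j.
have [|e /occP/= []] := @occ_ex _ tT true (rgt (tile T i)) true (bot (tile T i)).
  by in_frame_lra.
have [|f /occP/= []] := @occ_ex _ tT false (rgt (tile T i)) false (bot (tile T i)).
  by in_frame_lra.
rewrite -?leNgt -?ltNge => f1 f2 f3 f4 e1 e2 e3 e4.
have e5 := abut_right tT (e := e) (k := i) ltac:(lra) ltac:(lra) e1 e2.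
have e6 : bot (tile T e) = top (tile T j) by apply: (abut_above tT); lra.
have f5 : rgt (tile T f) = lft (tile T j) by apply: (abut_left tT); lra.
have f6 := abut_below tT (e := f) (k := i) ltac:(lra) ltac:(lra) f4 f3.
exact: (no_cross gT erefl yE e5 e6 (etrans f5 (esym xE)) (etrans f6 yE) (esym xE) erefl).
Qed.

Lemma no_touch_up T i j : generic_tiling T ->
  rgt (tile T i) = lft (tile T j) -> top (tile T i) <> bot (tile T j).
Proof.
move=> gT xE yE; have [tT _] := gT.
have [xi xj yi yj] := And4 (tile_x tT i) (tile_x tT j) (tile_y tT i) (tile_y tT j).
have [fi1 fi2 fi3 fi4] := tile_in_frame tT i.
have [fj1 fj2 fj3 fj4] := tile_in_frame tT j.
have [|e /occP/= []] := @occ_ex _ tT false (rgt (tile T i)) true (top (tile T i)).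
  by in_frame_lra.
have [|f /occP/= []] := @occ_ex _ tT true (rgt (tile T i)) false (top (tile T i)).
  by in_frame_lra.
rewrite -?leNgt -?ltNge => f1 f2 f3 f4 e1 e2 e3 e4.
have e5 : rgt (tile T e) = lft (tile T j) by apply: (abut_left tT); lra.
have e6 := abut_above tT (e := e) (k := i) ltac:(lra) ltac:(lra) e3 e4.
have f5 := abut_right tT (e := f) (k := i) ltac:(lra) ltac:(lra) f1 f2.
have f6 : top (tile T f) = bot (tile T j) by apply: (abut_below tT); lra.
exact: (no_cross gT (etrans e5 (esym xE)) e6 (esym xE) (esym yE) erefl erefl f5 (etrans f6 (esym yE))).
Qed.

Lemma left_of_weakE T i j : tiling T -> left_of T i j <->
  [/\ rgt (tile T i) = lft (tile T j), bot (tile T i) <= top (tile T j) &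
      bot (tile T j) <= top (tile T i)].
Proof.
move=> tT; have hy := tile_y tT; have [yi yj] := conj (hy i) (hy j).
split=> [[p [[/andP[a1 a2] /andP[a3 a4]] [/andP[b1 b2] /andP[b3 b4]]]]|[xE h1 h2]].
  by move: a1 a2 a3 a4 b1 b2 b3 b4 => /=; split; lra.
exists (rgt (tile T i), Num.max (bot (tile T i)) (bot (tile T j))).
by case: (leP (bot (tile T i)) (bot (tile T j))) => h; split; split=> /=; lra.
Qed.

(** Edges are closed, so a contact could be a single point; genericity excludes this, and weak and
    strict overlap become interchangeable. *)
Lemma left_ofE T i j : generic_tiling T -> left_of T i j <->
  [/\ rgt (tile T i) = lft (tile T j), bot (tile T i) < top (tile T j) &
      bot (tile T j) < top (tile T i)].
Proof.
move=> gT; have [tT _] := gT; rewrite left_of_weakE //.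
split=> -[xE h1 h2]; last by split=> //; apply: ltW.
split=> //; rewrite lt_neqAle ?h1 ?h2 andbT; apply/eqP.
  exact: no_touch_down.
by move/esym; apply: no_touch_up.
Qed.

Lemma left_neighbour T k : tiling T -> lft (frame T) < lft (tile T k) ->
  exists i, left_of T i k.
Proof.
move=> tT lk; have hx := tile_x tT; have hy := tile_y tT.
have [f1 f2 f3 f4] := tile_in_frame tT k; have [xk yk] := conj (hx k) (hy k).
have [|e /occP/= []] := @occ_ex _ tT false (lft (tile T k)) true (bot (tile T k)).
  by in_frame_lra.
rewrite -?leNgt -?ltNge => e1 e2 e3 e4; exists e; apply/left_of_weakE => //.
by split; [apply: (abut_left tT)|..]; lra.
Qed.

Lemma right_neighbour T k : tiling T -> rgt (tile T k) < rgt (frame T) ->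
  exists i, left_of T k i.
Proof.
move=> tT lk; have hx := tile_x tT; have hy := tile_y tT.
have [f1 f2 f3 f4] := tile_in_frame tT k; have [xk yk] := conj (hx k) (hy k).
have [|e /occP/= []] := @occ_ex _ tT true (rgt (tile T k)) true (bot (tile T k)).
  by in_frame_lra.
rewrite -?leNgt -?ltNge => e1 e2 e3 e4; exists e; apply/left_of_weakE => //.
by split; [apply/esym/(abut_right tT)|..]; lra.
Qed.

End Tilings.

(* Reflection in a line of slope -1; it preserves the numbering of a diagonal *)
(* rectangulation and reverses the drawing order.                             *)
Section Anti.
Variables (R : realType) (n : nat).
Implicit Types (T : layout R n) (W b : box R) (p : R * R).

Definition ap p : R * R := (- p.2, - p.1).
Definition abox b := Box (- top b) (- bot b) (- rgt b) (- lft b).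
Definition anti T : layout R n := Layout (abox (frame T)) (fun k => abox (tile T k)).

Lemma apK : involutive ap.
Proof. by case=> x y; rewrite /ap /= !opprK. Qed.

Lemma aboxK : involutive abox.
Proof. by case=> a b c d; rewrite /abox /= !opprK. Qed.

Lemma antiK : involutive anti.
Proof.
case=> f t; rewrite /anti /= aboxK; congr Layout.
by apply: funext => k; rewrite aboxK.
Qed.

Lemma pts_abox b p : pts (abox b) p <-> pts b (ap p).
Proof. by case: b p => [a b c d] [x y]; rewrite /pts /=; split; lra. Qed.

Lemma interior_abox b p : interior_pts (abox b) p <-> interior_pts b (ap p).
Proof. by case: b p => [a b c d] [x y]; rewrite /interior_pts /=; split; lra. Qed.

Lemma corner_abox b p : corner (abox b) p <-> corner b (ap p).
Proof.
case: b p => [a b c d] [x y]; rewrite /corner /=.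
by split=> -[[] h1 [] h2]; split; lra.
Qed.

Lemma pts_abox_sub b b' : pts (abox b) `<=` pts (abox b') <-> pts b `<=` pts b'.
Proof.
split=> H p.
  by rewrite -(apK p) => /pts_abox/H/pts_abox.
by move=> /pts_abox/H/pts_abox.
Qed.

Lemma rectangle_abox b : rectangle b -> rectangle (abox b).
Proof. by case; split; rewrite /=; lra. Qed.

Lemma tiling_anti T : tiling T -> tiling (anti T).
Proof.
case=> rF rT cT dT; split=> [|k||i j ij]; [exact: rectangle_abox|exact: rectangle_abox| |].
  apply/seteqP; split=> p.
    case=> k _ /= /pts_abox h; apply/pts_abox; rewrite -cT.
    by exists k.
  move/pts_abox; rewrite -cT => -[k _ h]; exists k => //.
  exact/pts_abox.
rewrite -subset0 => p [/interior_abox h1 /interior_abox h2].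
have : set0 (ap p) by rewrite -(dT i j ij).
by [].
Qed.

Lemma generic_anti T : generic T -> generic (anti T).
Proof.
move=> gT p i j k l /corner_abox h1 /corner_abox h2 /corner_abox h3 /corner_abox h4.
exact: gT h1 h2 h3 h4.
Qed.

Lemma generic_tiling_anti T : generic_tiling T -> generic_tiling (anti T).
Proof. by case=> t g; split; [exact: tiling_anti|exact: generic_anti]. Qed.

Lemma setI_abox_nonempty b b' :
  pts (abox b) `&` pts (abox b') !=set0 <-> pts b `&` pts b' !=set0.
Proof.
split=> -[p [h1 h2]]; exists (ap p).
  by split; apply/pts_abox.
by split; apply/pts_abox; rewrite apK.
Qed.

Lemma left_of_anti T i j : left_of (anti T) i j <-> below T j i.
Proof.
rewrite /left_of /below -setI_abox_nonempty setIC.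
by rewrite /abox /= !opprK; split.
Qed.

Lemma below_anti T i j : below (anti T) i j <-> left_of T j i.
Proof. by rewrite -left_of_anti antiK. Qed.

Lemma segment_abox W : segment (abox W) <-> segment W.
Proof.
rewrite /segment /vertical /horizontal /=.
by split=> -[[h1 h2]|[h1 h2]]; [right|left|right|left]; split; lra.
Qed.

Lemma vertical_abox W : vertical (abox W) <-> horizontal W.
Proof. by rewrite /vertical /horizontal /=; split=> -[h1 h2]; split; lra. Qed.

Lemma horizontal_abox W : horizontal (abox W) <-> vertical W.
Proof. by rewrite /vertical /horizontal /=; split=> -[h1 h2]; split; lra. Qed.

Lemma avoids_anti T W : avoids_interiors (anti T) (abox W) <-> avoids_interiors T W.
Proof.
split=> H i; rewrite -subset0 => p [h1 h2].
  suff : set0 (ap p) by [].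
  rewrite -(H i); split; first by apply/interior_abox; rewrite apK.
  by apply/pts_abox; rewrite apK.
suff : set0 (ap p) by [].
rewrite -(H i); split; first exact/interior_abox.
exact/pts_abox.
Qed.

Lemma in_frame_edge_anti T W : in_frame_edge T W -> in_frame_edge (anti T) (abox W).
Proof.
have E b : [/\ left_edge (abox b) = abox (top_edge b), right_edge (abox b) = abox (bottom_edge b),
  bottom_edge (abox b) = abox (right_edge b) & top_edge (abox b) = abox (left_edge b)] by [].
case: (E (frame T)) => e1 e2 e3 e4.
by case=> h; [constructor 4|constructor 3|constructor 2|constructor 1];
  rewrite /= ?e1 ?e2 ?e3 ?e4; apply/pts_abox_sub.
Qed.

Lemma wall_anti T W : wall T W -> wall (anti T) (abox W).
Proof.
case=> h1 h2 h3 h4 h5; split.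
- exact/segment_abox.
- exact/pts_abox_sub.
- exact/avoids_anti.
- by move=> /in_frame_edge_anti; rewrite antiK aboxK.
move=> W'; rewrite -(aboxK W') => /segment_abox s1 /pts_abox_sub s2 /avoids_anti s3 /pts_abox_sub s4.
by apply/pts_abox_sub; apply: h5.
Qed.

Lemma wall_antiE T W : wall (anti T) (abox W) <-> wall T W.
Proof. by split=> [/wall_anti|/wall_anti//]; rewrite antiK aboxK. Qed.

Lemma ends_above_anti T W W' : ends_above (anti T) (abox W) (abox W') <-> ends_left T W W'.
Proof.
split=> -[/wall_antiE w /vertical_abox h p].
  by split=> //; case: (h) => e _; move/pts_abox: p; rewrite /ap /= !opprK e.
split=> //; apply/pts_abox; rewrite /ap /= !opprK.
by move/vertical_abox: h => [<- _].
Qed.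

Lemma ends_below_anti T W W' : ends_below (anti T) (abox W) (abox W') <-> ends_right T W W'.
Proof.
split=> -[/wall_antiE w /vertical_abox h p].
  by split=> //; case: (h) => e _; move/pts_abox: p; rewrite /ap /= !opprK e.
split=> //; apply/pts_abox; rewrite /ap /= !opprK.
by move/vertical_abox: h => [<- _].
Qed.

Lemma ends_left_anti T W W' : ends_left (anti T) (abox W) (abox W') <-> ends_above T W W'.
Proof. by rewrite -ends_above_anti antiK !aboxK. Qed.

Lemma ends_right_anti T W W' : ends_right (anti T) (abox W) (abox W') <-> ends_below T W W'.
Proof. by rewrite -ends_below_anti antiK !aboxK. Qed.

End Anti.

(** * Realizations of a drawing order *)

Section SumOne.
Variables (n : nat) (b : pred 'I_n).

Lemma sum_bool_ex : (\sum_k (b k)%:R = 1 :> int) -> exists k, b k.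
Proof.
move=> E; have [/existsP //|/existsPn H] := boolP [exists k, b k]; move: E.
by rewrite big1 // => k _; rewrite (negbTE (H k)).
Qed.

Lemma sum_bool_uniq i j : (\sum_k (b k)%:R = 1 :> int) -> b i -> b j -> i = j.
Proof.
move=> E bi bj; apply/eqP/negPn/negP=> ij; move: E.
rewrite (bigD1 i) //= (bigD1 j) /= 1?eq_sym // bi bj.
have : 0 <= \sum_(k | (k != i) && (k != j)) (b k)%:R :> int.
  by apply: sumr_ge0 => k _; rewrite ler0n.
by move: (\sum_(k | _) _) => x; lia.
Qed.

End SumOne.

Section Realization.
Variables (R : realType) (n : nat).
Implicit Types (bf : rel nat) (X Z : nat -> R) (P Q : pred R).

(** Heights are negated because rows count from the top; the reflection then exchanges [X] with [Z]
    and flips the order. Monotone [X] and [Z] give the diagonal rectangulation; other coordinates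
    give tilings obtained from it by slides. *)
Definition mk bf X Z : layout R n :=
  Layout (Box (X 0%N) (X n) (- Z n) (- Z 0%N))
    (fun k : 'I_n => Box (X (lo bf k)) (X (hi n bf k))
        (- Z (hi n (flip bf) k)) (- Z (lo (flip bf) k))).

Definition increasing_sides bf X := forall k, (k < n)%N -> X (lo bf k) < X (hi n bf k).

Definition inj_upto X := forall a b, (a <= n)%N -> (b <= n)%N -> X a = X b -> a = b.

Definition lower_set P := forall a b, a <= b -> P b -> P a.

Lemma anti_mk bf X Z : anti (mk bf X Z) = mk (flip bf) Z X.
Proof.
rewrite /anti /mk /abox /= !opprK; congr Layout.
by apply: funext => k; rewrite !opprK.
Qed.

Lemma tiling_sides bf X Z : tiling (mk bf X Z) ->
  increasing_sides bf X /\ increasing_sides (flip bf) Z.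
Proof.
move=> tT; split=> k kn; first exact: (tile_x tT (Ordinal kn)).
by have := tile_y tT (Ordinal kn); rewrite /= ltrN2.
Qed.

Section Bf.
Variable bf : rel nat.
Hypothesis bfT : torder n bf.

(** Since [X] need not be monotone, the wall is followed leftwards: tile [m.-1] ends at line [m] and
    starts at a line of smaller index, which is the frame or another vertical wall. *)
Lemma wall_gt0 X m : increasing_sides bf X -> (0 < m < n)%N -> bf m.-1 m -> X 0%N < X m.
Proof.
move=> wX; elim/ltn_ind: m => m IH mn bm.
have m1 : (m.-1 < n)%N by lia.
have := wX _ m1; rewrite hi_wall_self //; [|lia|lia].
have l1 := lo_le bf m.-1.
case: (posnP (lo bf m.-1)) => [->//|l0]; apply: lt_trans; apply: IH; [lia|lia|].
by case: (lo_wall bfT m1 erefl l0).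
Qed.

Lemma wall_ltn X m : increasing_sides bf X -> (0 < m < n)%N -> bf m.-1 m -> X m < X n.
Proof.
move=> wX; move: {2}(n - m)%N (leqnn (n - m)%N) => d; elim: d m => [|d IH] m; first lia.
move=> dm mn bm; have mn' : (m < n)%N by lia.
have := wX _ mn'; rewrite (lo_wall_self mn') //; [|lia].
have h1 := hi_gt bf mn'; have h2 := hi_le bf mn'.
case: (eqVneq (hi n bf m) n) => [->//|hn] lt.
have hn' : (hi n bf m < n)%N by lia.
apply: (lt_trans lt); case: (hi_wall bfT mn' erefl hn') => h3 h4.
by apply: IH => //; lia.
Qed.

Lemma side_gt0 X k : increasing_sides bf X -> (k < n)%N -> X 0%N <= X (lo bf k).
Proof.
move=> wX kn; case: (posnP (lo bf k)) => [->//|l0]; apply: ltW.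
by case: (lo_wall bfT kn erefl l0) => h1 h2; apply: wall_gt0; rewrite ?l0.
Qed.

Lemma side_ltn X k : increasing_sides bf X -> (k < n)%N -> X (hi n bf k) <= X n.
Proof.
move=> wX kn; have h2 := hi_le bf kn.
case: (eqVneq (hi n bf k) n) => [->//|hn]; apply: ltW.
have hn' : (hi n bf k < n)%N by lia.
by case: (hi_wall bfT kn erefl hn') => h3 h4; apply: wall_ltn; rewrite ?h3.
Qed.

Lemma width_gt0 X : increasing_sides bf X -> (0 < n)%N -> X 0%N < X n.
Proof.
move=> wX n0; have := wX _ n0; have := side_ltn wX n0; have := side_gt0 wX n0; lra.
Qed.

Lemma cut_term X P k : lower_set P -> X (lo bf k) < X (hi n bf k) ->
  (- (P (X (hi n bf k)))%:R) - (- (P (X (lo bf k)))%:R)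
   = (P (X (lo bf k)) && ~~ P (X (hi n bf k)))%:R :> int.
Proof.
move=> dP lt; have := dP _ _ (ltW lt).
by case: (P (X (lo bf k))); case: (P (X (hi n bf k))) => //= /(_ isT).
Qed.

End Bf.

(** The area identity with negated indicators as coordinates. Each factor becomes the indicator that
    the cut falls inside the span of the tile, so the sum counts the tiles that contain a shifted
    point. *)
Lemma count_occ bf X Z P Q : torder n bf -> lower_set P -> lower_set Q ->
  increasing_sides bf X -> increasing_sides (flip bf) Z ->
  \sum_(k < n) (P (X (lo bf k)) && ~~ P (X (hi n bf k)) &&
     (Q (Z (lo (flip bf) k)) && ~~ Q (Z (hi n (flip bf) k))))%:R =
  ((P (X 0%N))%:R - (P (X n))%:R) * ((Q (Z 0%N))%:R - (Q (Z n))%:R) :> int.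
Proof.
move=> bfT dP dQ wX wZ.
transitivity ((- (P (X n))%:R - - (P (X 0%N))%:R) * (- (Q (Z n))%:R - - (Q (Z 0%N))%:R) : int);
  last by ring.
rewrite -(area_identity bfT (fun c => - (P (X c))%:R) (fun c => - (Q (Z c))%:R)).
apply: eq_bigr => k _; rewrite (cut_term dP (wX _ (ltn_ord k))) (cut_term dQ (wZ _ (ltn_ord k))).
by rewrite -natrM mulnb.
Qed.

Lemma lower_cut s u : lower_set (cut s u).
Proof. by move=> a b; apply: cut_le. Qed.

Lemma lower_ncut s u : lower_set (fun z => ~~ cut s u (- z)).
Proof. by move=> a b ab; apply: contra; apply: cut_le; rewrite lerN2. Qed.

(** By [count_occ] the number of tiles at a shifted point of the frame is exactly one, which gives
    covering and disjointness at once. Positivity of widths and heights is needed only to make each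
    summand an indicator. *)
Lemma mk_tiling bf X Z : (0 < n)%N -> torder n bf ->
  increasing_sides bf X -> increasing_sides (flip bf) Z -> tiling (mk bf X Z).
Proof.
move=> n0 bfT wX wZ; have bfT' := torder_flip bfT.
have inF (k : 'I_n) : [/\ X 0%N <= X (lo bf k), X (hi n bf k) <= X n,
    - Z n <= - Z (hi n (flip bf) k) & - Z (lo (flip bf) k) <= - Z 0%N].
  split; rewrite ?lerN2;
  by [apply: (side_gt0 bfT)|apply: (side_ltn bfT)|apply: (side_ltn bfT')|apply: (side_gt0 bfT')].
have cnt s u s' v := count_occ bfT (@lower_cut s u) (@lower_ncut s' v) wX wZ.
have occE s u s' v k : occ (mk bf X Z) s u s' v k =
    (cut s u (X (lo bf k)) && ~~ cut s u (X (hi n bf k)) &&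
    (~~ cut s' v (- Z (lo (flip bf) k)) && ~~ ~~ cut s' v (- Z (hi n (flip bf) k)))).
  by rewrite /occ /= negbK -andbA; congr [&& _, _ & _]; rewrite andbC.
have cnt1 s u s' v : in_frame (mk bf X Z) s u s' v ->
    \sum_(k < n) (occ (mk bf X Z) s u s' v k)%:R = 1 :> int.
  move=> /and4P[/= h1 /negbTE h2 h3 /negbTE h4].
  under eq_bigr => k _ do rewrite occE.
  by rewrite cnt h1 h2 h3 h4.
apply: tiling_intro => /=.
- by split=> /=; rewrite ?ltrN2; [apply: (width_gt0 bfT)|apply: (width_gt0 bfT')].
- by move=> k; split=> /=; rewrite ?ltrN2; [apply: wX|apply: wZ].
- exact: inF.
- by move=> s u s' v /cnt1/sum_bool_ex.
move=> s u s' v i j oi oj; apply: (sum_bool_uniq (b := occ (mk bf X Z) s u s' v)) => //.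
apply: cnt1; move: oi; rewrite occE /in_frame /=; case: (inF i) => i1 i2 i3 i4.
move=> /andP[/andP[a1 a2] /andP[a3]]; rewrite negbK => a4.
apply/and4P; split.
- exact: cut_le a1.
- by apply: contra a2; apply: cut_le.
- exact: cut_le a4.
by apply: contra a3; apply: cut_le.
Qed.

(** Four tiles at a point fill all four quadrants. With distinct line coordinates, the upper right
    tile [a] and the lower left tile [b] satisfy [b < hi n bf b = lo bf a <= a] as well as [a < hi n
    (flip bf) a = lo (flip bf) b <= b]. *)
Lemma mk_generic bf X Z : tiling (mk bf X Z) -> inj_upto X -> inj_upto Z ->
  generic (mk bf X Z).
Proof.
move=> tT iX iZ p i j k l ci cj ck cl; apply/negP=> u.
set T := mk bf X Z in tT ci cj ck cl.
pose q a := (lft (tile T a) == p.1, bot (tile T a) == p.2).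
have cut_side (c d x : R) : c < d -> x = c \/ x = d -> cut (c == x) x c && ~~ cut (c == x) x d.
  move=> cd [->|->]; first by rewrite eqxx /= lexx -ltNge.
  by rewrite (lt_eqF cd) /= cd ltxx.
have qocc a : corner (tile T a) p -> occ T (q a).1 p.1 (q a).2 p.2 a.
  case=> /(cut_side _ _ _ (tile_x tT a)) hx' /(cut_side _ _ _ (tile_y tT a)) hy'.
  by rewrite /occ andbA hx' hy'.
pose s := [:: i; j; k; l].
have cs a : a \in s -> corner (tile T a) p.
  by rewrite !inE => /or4P[] /eqP ->.
have uq : uniq (map q s).
  rewrite map_inj_in_uniq // => a b /cs ca /cs cb E; apply: (occ_uniq tT (qocc _ ca)).
  by rewrite E; apply: qocc.
have full : map q s =i [set: bool * bool]%SET.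
  apply/subset_cardP; last by apply/fintype.subsetP=> x; rewrite inE.
  by rewrite (card_uniqP uq) cardsT card_prod card_bool.
have /mapP[a /cs ca qa] : (true, true) \in map q s by rewrite full inE.
have /eqP a1 : lft (tile T a) == p.1 := esym (congr1 fst qa).
have /eqP a2 : bot (tile T a) == p.2 := esym (congr1 snd qa).
have /mapP[b /cs [cb1 cb2] qb] : (false, false) \in map q s by rewrite full inE.
have b1 : (lft (tile T b) == p.1) = false := esym (congr1 fst qb).
have b2 : (bot (tile T b) == p.2) = false := esym (congr1 snd qb).
have {}cb1 : rgt (tile T b) = p.1 by case: cb1 => // E; rewrite -E eqxx in b1.
have {}cb2 : top (tile T b) = p.2 by case: cb2 => // E; rewrite -E eqxx in b2.
have := lo_le bf a; have := hi_gt (flip bf) (ltn_ord a); have := hi_le (flip bf) (ltn_ord a).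
have := lo_le (flip bf) b; have := hi_gt bf (ltn_ord b); have := hi_le bf (ltn_ord b).
have an := ltn_ord a; have bn := ltn_ord b.
have E1 : X (lo bf a) = X (hi n bf b) by move: a1 cb1 => /= -> ->.
have E2 : Z (hi n (flip bf) a) = Z (lo (flip bf) b) by apply: oppr_inj; move: a2 cb2 => /= -> ->.
move=> g1 g2 g3 g4 g5 g6.
have := iX _ _ _ _ E1; have := iZ _ _ _ _ E2.
move=> /(_ ltac:(lia) ltac:(lia)) h1 /(_ ltac:(lia) ltac:(lia)) h2; lia.
Qed.

(** Tile [m.-1] is the lowest on the left of the wall and tile [m] the highest on its right; the
    wall runs from the bottom of the former to the top of the latter. *)
Definition vwall bf X Z m : box R :=
  Box (X m) (X m) (- Z (hi n (flip bf) m.-1)) (- Z (lo (flip bf) m)).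

End Realization.

(** * Walls of a realization *)

Section Avoid.
Variables (R : realType) (n : nat).
Implicit Types (T : layout R n) (W : box R).

Lemma avoid_vertical T W i : tiling T -> avoids_interiors T W -> vertical W ->
  lft (tile T i) < lft W -> lft W < rgt (tile T i) ->
  bot (tile T i) < top W -> bot W < top (tile T i) -> False.
Proof.
move=> tT aW [xE yl] h1 h2 h3 h4; have hy := tile_y tT i.
suff : set0 (lft W, (Num.max (bot (tile T i)) (bot W) + Num.min (top (tile T i)) (top W)) / 2) by [].
rewrite -(aW i).
by case: (leP (bot (tile T i)) (bot W)) => ?;
   case: (leP (top (tile T i)) (top W)) => ?; do !split => /=; lra.
Qed.

Lemma avoid_horizontal T W i : tiling T -> avoids_interiors T W -> horizontal W ->
  bot (tile T i) < bot W -> bot W < top (tile T i) ->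
  lft (tile T i) < rgt W -> lft W < rgt (tile T i) -> False.
Proof.
move=> tT aW hW h1 h2 h3 h4; have [E _] := hW.
apply: (@avoid_vertical (anti T) (abox W) i); rewrite /= ?ltrN2 -?E //.
- exact: tiling_anti.
- exact/avoids_anti.
exact/vertical_abox.
Qed.

(** If the segment went on upwards, the tile to its right just above the common level would touch
    [k] in a corner only, which a generic tiling excludes. *)
Lemma wall_stops_at_tops T W k m : generic_tiling T -> avoids_interiors T W -> vertical W ->
  pts W `<=` pts (frame T) -> rgt (tile T k) = lft W -> lft (tile T m) = lft W ->
  top (tile T k) = top (tile T m) -> bot W < top (tile T k) < top W -> False.
Proof.
move=> gT aW vW fW k1 m1 km /andP[lt1 lt2].
have [tT _] := gT; have [v1 v2] := vW.
have [xm yk ym] := And3 (tile_x tT m) (tile_y tT k) (tile_y tT m).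
have [i1 i2 i3 i4] := tile_in_frame tT k; have [j1 j2 j3 j4] := tile_in_frame tT m.
have [_ /andP[/= f3 f4]] : pts (frame T) (lft W, top W) by apply: fW; split=> /=; lra.
have [|e /occP/= []] := @occ_ex _ _ _ tT true (lft W) true (top (tile T k)).
  by rewrite /in_frame /= -?leNgt -?ltNge; apply/and4P; split; lra.
rewrite -?leNgt -?ltNge => e1 e2 e3 e4.
have e5 : lft (tile T e) = lft W.
  apply/eqP; rewrite eq_le e1 /= leNgt; apply/negP=> h.
  by apply: (avoid_vertical tT aW vW h e2); lra.
apply: (no_touch_up gT (i := k) (j := e)); first by rewrite e5.
by apply/esym; rewrite km; apply: (abut_above tT); lra.
Qed.

Lemma wall_stops_at_bottoms T W k m : generic_tiling T -> avoids_interiors T W -> vertical W ->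
  pts W `<=` pts (frame T) -> rgt (tile T k) = lft W -> lft (tile T m) = lft W ->
  bot (tile T k) = bot (tile T m) -> bot W < bot (tile T k) < top W -> False.
Proof.
move=> gT aW vW fW k1 m1 km /andP[lt1 lt2].
have [tT _] := gT; have [v1 v2] := vW.
have [xm yk ym] := And3 (tile_x tT m) (tile_y tT k) (tile_y tT m).
have [i1 i2 i3 i4] := tile_in_frame tT k; have [j1 j2 j3 j4] := tile_in_frame tT m.
have [_ /andP[/= f3 f4]] : pts (frame T) (lft W, bot W) by apply: fW; split=> /=; lra.
have [|e /occP/= []] := @occ_ex _ _ _ tT true (lft W) false (bot (tile T k)).
  by rewrite /in_frame /= -?leNgt -?ltNge; apply/and4P; split; lra.
rewrite -?leNgt -?ltNge => e1 e2 e3 e4.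
have e5 : lft (tile T e) = lft W.
  apply/eqP; rewrite eq_le e1 /= leNgt; apply/negP=> h.
  by apply: (avoid_vertical tT aW vW h e2); lra.
apply: (no_touch_down gT (i := k) (j := e)); first by rewrite e5.
by apply/esym; rewrite km; apply: (abut_below tT); lra.
Qed.

End Avoid.

Section Walls.
Variables (R : realType) (n : nat) (bf : rel nat) (X Z : nat -> R).
Hypothesis bfT : torder n bf.
Hypothesis gT : generic_tiling (mk n bf X Z).
Let T := mk n bf X Z.
Local Notation bf' := (flip bf).
Local Notation vw := (vwall n bf X Z).

Let tT : tiling T. Proof. by case: gT. Qed.
Let wX : increasing_sides n bf X. Proof. by case: (tiling_sides tT). Qed.
Let wZ : increasing_sides n bf' Z. Proof. by case: (tiling_sides tT). Qed.

Lemma right_side_bounds (k : 'I_n) m : (0 < m < n)%N -> bf m.-1 m -> hi n bf k = m ->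
  Z (lo bf' m) <= Z (lo bf' k) /\ Z (hi n bf' k) <= Z (hi n bf' m.-1).
Proof.
move=> /andP[m0 mn] bm; move: k => [/= i ilt] im; split.
  elim/ltn_ind: i ilt im => i IH ilt im.
  have qi := lo_le bf' i; case: (lo_flip_up bfT ilt im mn erefl) => [[q0 bq hq]|<-//].
  have qn : (lo bf' i < n)%N := leq_ltn_trans qi ilt.
  have q1n : ((lo bf' i).-1 < n)%N by lia.
  apply: le_trans (IH (lo bf' i).-1 _ q1n hq) _; first by lia.
  by have := wZ q1n; rewrite (@hi_wall_self n bf' _ qn q0 bq) => /ltW.
move: {2}(m - i)%N (leqnn (m - i)) => d.
elim: d i ilt im => [|d IH] i ilt im id; have := hi_gt bf ilt; rewrite im => im1; first lia.
case: (ltngtP i.+1 m) => [h| |e]; [|lia|by rewrite -e].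
have [-> _ [b [b1 b2 b3]]] := hi_below bfT im mn h; have bn : (b < n)%N by lia.
by have := wZ bn; rewrite b3 => /ltW h1; apply: le_trans h1 (IH b bn b2 _); lia.
Qed.

Lemma left_side_bounds (k : 'I_n) m : (0 < m < n)%N -> bf m.-1 m -> lo bf k = m ->
  Z (lo bf' m) <= Z (lo bf' k) /\ Z (hi n bf' k) <= Z (hi n bf' m.-1).
Proof.
move=> /andP[m0 mn] bm; move: k => [/= j jn] jm; split.
  elim/ltn_ind: j jn jm => j IH jn jm; have := lo_le bf j; rewrite jm => mj.
  case: (ltngtP m j) => [h|h|->//]; last lia.
  have [-> _ [c [c1 c2 c3]]] := lo_above bfT jn jm m0 h; have cn : (c < n)%N by lia.
  by have := wZ cn; rewrite c3 => /ltW h1; apply: le_trans (IH c _ cn c2) h1; lia.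
move: {2}(n - j)%N (leqnn (n - j)) => d.
elim: d j jn jm => [|d IH] j jn jm jd; first lia.
have jp := hi_gt bf' jn; case: (hi_flip_down bfT jn jm m0 erefl) => [[pn bp lp]|->//].
have p0 : (0 < hi n bf' j)%N by lia.
apply: le_trans (IH _ pn lp _); last by lia.
by have := wZ pn; rewrite (@lo_wall_self n bf' _ pn p0 bp) => /ltW.
Qed.

(* If the tiles touched along two different walls, one of the walls could be  *)
(* moved, giving a tiling with overlapping tiles.                             *)
Lemma mk_left_of i j : left_of T i j -> hi n bf i = lo bf j.
Proof.
move=> /(left_ofE _ _ gT) [/= xE h1 h2].
apply/eqP/negPn/negP=> ne.
have [e e0 He] : exists2 e : R, 0 < e & forall k : 'I_n, X (lo bf k) + e < X (hi n bf k).
  have [e e0 He] : exists2 e : R, 0 < e &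
      forall k, k \in enum 'I_n -> X (lo bf k) + e < X (hi n bf k).
    elim: (enum 'I_n) => [|a l [e e0 He]]; first by exists 1.
    have ha := wX (ltn_ord a).
    exists (Num.min e ((X (hi n bf a) - X (lo bf a)) / 2)).
      by case: (leP e); lra.
    move=> k; rewrite inE => /orP[/eqP ->|/He]; case: (leP e); lra.
  by exists e => // k; apply: He; rewrite mem_enum.
pose X1 c := X c + (if c == hi n bf i then e else 0).
have n0 : (0 < n)%N by have := ltn_ord i; lia.
have wX1 : increasing_sides n bf X1.
  move=> k kn; have := He (Ordinal kn); rewrite /X1 /=.
  by case: (lo bf k == _); case: (hi n bf k == _); lra.
have tT1 := mk_tiling n0 bfT wX1 wZ.
have E : i = j.
  apply: (overlap tT1) => //=; rewrite /X1; last first.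
    by rewrite eqxx eq_sym (negbTE ne); lra.
  have := wX (ltn_ord i); have := wX (ltn_ord j).
  have := lo_le bf i; have := hi_gt bf (ltn_ord i).
  by case: (lo bf i == _) / eqP; [lia|]; case: (hi n bf j == _); lra.
by move: xE; rewrite E => xE; have := wX (ltn_ord j); lra.
Qed.

Lemma vwall_length m : (0 < m < n)%N -> bf m.-1 m ->
  Z (lo bf' m) < Z (hi n bf' m.-1).
Proof.
move=> mn bm; have mn' : (m < n)%N by lia.
have m0 : (0 < m)%N by lia.
have [_] := @left_side_bounds (Ordinal mn') m mn bm (lo_wall_self mn' m0 bm).
by apply: lt_le_trans; apply: wZ.
Qed.

Lemma vwall_inside m : (0 < m < n)%N -> bf m.-1 m -> X 0%N < X m < X n.
Proof.
by move=> mn bm; rewrite (wall_gt0 bfT wX mn bm) (wall_ltn bfT wX mn bm).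
Qed.

Lemma side_depth k : (k < n)%N -> Z 0%N <= Z (lo bf' k) /\ Z (hi n bf' k) <= Z n.
Proof.
by move=> kn; split; [apply: (side_gt0 (torder_flip bfT))|apply: (side_ltn (torder_flip bfT))].
Qed.

Lemma right_edge_vwall (k : 'I_n) m : (m < n)%N -> hi n bf k = m ->
  pts (right_edge (tile T k)) `<=` pts (vw m).
Proof.
move=> mn km; case: (hi_wall bfT (ltn_ord k) km mn) => m0 bm.
have [] := @right_side_bounds k m ltac:(lia) bm km.
rewrite /vwall /right_edge /= km => ? ? p [/andP[a1 a2] /andP[a3 a4]].
by move: a1 a2 a3 a4 => /= ? ? ? ?; split=> /=; lra.
Qed.

Lemma left_edge_vwall (k : 'I_n) m : (0 < m)%N -> lo bf k = m ->
  pts (left_edge (tile T k)) `<=` pts (vw m).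
Proof.
move=> m0 km; case: (lo_wall bfT (ltn_ord k) km m0) => mn bm.
have [] := @left_side_bounds k m ltac:(lia) bm km.
rewrite /vwall /left_edge /= km => ? ? p [/andP[a1 a2] /andP[a3 a4]].
by move: a1 a2 a3 a4 => /= ? ? ? ?; split=> /=; lra.
Qed.

Lemma vwall_vertical m : (0 < m < n)%N -> bf m.-1 m -> vertical (vw m).
Proof. by move=> mn bm; split=> //=; rewrite ltrN2; apply: vwall_length. Qed.

Lemma vwall_in_frame m : (0 < m < n)%N -> bf m.-1 m -> pts (vw m) `<=` pts (frame T).
Proof.
move=> mn bm; have := vwall_inside mn bm.
have [z1 _] := side_depth (k := m) ltac:(lia); have [_ z2] := side_depth (k := m.-1) ltac:(lia).
move=> /andP[? ?] p [/andP[a1 a2] /andP[a3 a4]].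
by move: a1 a2 a3 a4 => /= ? ? ? ?; split=> /=; lra.
Qed.

(** At the height of the offending point there is a tile [j] starting at the wall on its right. A
    tile containing the point in its interior overlaps [j], hence is [j], but the wall is a side of
    [j]. *)
Lemma vwall_avoids m : (0 < m < n)%N -> bf m.-1 m -> avoids_interiors T (vw m).
Proof.
move=> mn bm i; rewrite -subset0 => p [[/andP[a1 a2] /andP[a3 a4]] [/andP[b1 b2] /andP[b3 b4]]].
have len := vwall_length mn bm.
have [|s [s1 s2]] := cut_separates (u := - p.2) len; first by move: b3 b4 => /=; lra.
have [j [j1 /cut_near j2 /ncut_near j3]] :=
  @right_tile_at n bf bfT (fun c => cut s (- p.2) (Z c)) m mn bm s1 s2.
have xj := tile_x tT j; have E : i = j.
  by apply: (overlap tT); move: a1 a2 a3 a4 b1 b2 xj => /=; rewrite j1; lra.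
by move: a1 a2 a3 a4 b1 b2; rewrite E /= j1; lra.
Qed.

(** At each end of the wall a tile on the left and a tile on the right end at the same height: one
    of them is [m] or [m.-1], the other is found by [left_tile_at] or [right_tile_at]. A segment
    cannot pass such a point. *)
Lemma vwall_maximal m W : (0 < m < n)%N -> bf m.-1 m -> segment W ->
  pts W `<=` pts (frame T) -> avoids_interiors T W -> pts (vw m) `<=` pts W ->
  pts W `<=` pts (vw m).
Proof.
move=> mn bm sW fW aW sub; have len := vwall_length mn bm.
have mn' : (m < n)%N by lia.
have m1n : (m.-1 < n)%N by lia.
have m0 : (0 < m)%N by lia.
have lm : lo bf m = m by apply: lo_wall_self.
have hm : hi n bf m.-1 = m by apply: hi_wall_self.
have [/andP[w1 w2] /andP[w3 w4]] : pts W (X m, - Z (hi n bf' m.-1)) by apply: sub; split=> /=; lra.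
have [/andP[w5 w6] /andP[w7 w8]] : pts W (X m, - Z (lo bf' m)) by apply: sub; split=> /=; lra.
move: w1 w2 w3 w4 w5 w6 w7 w8 => /= w1 w2 w3 w4 w5 w6 w7 w8.
have vW : vertical W by case: sW => // -[h1 h2]; lra.
have [v1 v2] := vW; have xW : lft W = X m by lra.
have tW : top W <= - Z (lo bf' m).
  rewrite leNgt; apply/negP=> lt.
  have [|k [k1 k2 k3]] := @left_tile_at n bf bfT (fun c => Z c <= Z (lo bf' m)) m mn bm (lexx _).
    by rewrite /= -ltNge; lra.
  have [k4 _] := @right_side_bounds k m mn bm k1.
  have zE : Z (lo bf' k) = Z (lo bf' m) by apply/eqP; rewrite eq_le k4 andbT.
  by apply: (@wall_stops_at_tops _ _ T W k (Ordinal mn')) => //=; rewrite ?k1 ?lm ?zE //; lra.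
have bW : - Z (hi n bf' m.-1) <= bot W.
  rewrite leNgt; apply/negP=> lt.
  have [||k [k1 k2 k3]] := @right_tile_at n bf bfT (fun c => Z c < Z (hi n bf' m.-1)) m mn bm.
  - by rewrite /=; lra.
  - by rewrite /= ltxx.
  have [_ k4] := @left_side_bounds k m mn bm k1.
  have zE : Z (hi n bf' k) = Z (hi n bf' m.-1) by apply/eqP; rewrite eq_le k4 leNgt.
  by apply: (@wall_stops_at_bottoms _ _ T W (Ordinal m1n) k) => //=; rewrite ?k1 ?hm ?zE //; lra.
move=> p [/andP[p1 p2] /andP[p3 p4]]; split=> /=; lra.
Qed.

Lemma vwall_wall m : (0 < m < n)%N -> bf m.-1 m -> wall T (vw m).
Proof.
move=> mn bm; split.
- by left; apply: vwall_vertical.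
- exact: vwall_in_frame.
- exact: vwall_avoids.
- have len := vwall_length mn bm; have /andP[x0 xn] := vwall_inside mn bm.
  have p1 : pts (vw m) (X m, - Z (hi n bf' m.-1)) by split=> /=; lra.
  have p2 : pts (vw m) (X m, - Z (lo bf' m)) by split=> /=; lra.
  by case=> h; move: (h _ p1) (h _ p2) => [/= /andP[? ?] /andP[? ?]] [/= /andP[? ?] /andP[? ?]]; lra.
by move=> W; apply: vwall_maximal.
Qed.

End Walls.

Definition hwall (R : realType) n bf (X Z : nat -> R) q := abox (vwall n (flip bf) Z X q).

Section Ends.
Variables (R : realType) (n : nat) (bf : rel nat) (X Z : nat -> R).
Hypothesis bfT : torder n bf.
Hypothesis gT : generic_tiling (mk n bf X Z).
Let T := mk n bf X Z.
Local Notation bf' := (flip bf).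
Local Notation vw := (vwall n bf X Z).

Local Notation hw := (hwall n bf X Z).

Let bfT' := torder_flip bfT.
Let gT' : generic_tiling (mk n bf' Z X).
Proof. by rewrite -anti_mk; apply: generic_tiling_anti. Qed.
Let TE : T = anti (mk n bf' Z X). Proof. by rewrite anti_mk. Qed.

Lemma hwallE q : hw q = Box (X (lo bf q)) (X (hi n bf q.-1)) (- Z q) (- Z q).
Proof. by rewrite /hwall /abox /= !opprK. Qed.

Lemma hwall_wall q : (0 < q < n)%N -> bf q q.-1 -> wall T (hw q).
Proof. by move=> qn bq; rewrite TE wall_antiE; apply: vwall_wall. Qed.

Lemma hwall_horizontal q : (0 < q < n)%N -> bf q q.-1 -> horizontal (hw q).
Proof. by move=> qn bq; apply/horizontal_abox/vwall_vertical. Qed.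

Lemma bottom_edge_hwall (k : 'I_n) q : (q < n)%N -> hi n bf' k = q ->
  pts (bottom_edge (tile T k)) `<=` pts (hw q).
Proof.
move=> qn kq; rewrite TE; have := right_edge_vwall bfT' gT' qn kq.
by move=> /pts_abox_sub.
Qed.

Lemma top_edge_hwall (k : 'I_n) q : (0 < q)%N -> lo bf' k = q ->
  pts (top_edge (tile T k)) `<=` pts (hw q).
Proof.
move=> qn kq; rewrite TE; have := left_edge_vwall bfT' gT' qn kq.
by move=> /pts_abox_sub.
Qed.

Lemma hwall_ends_left q m : (0 < q < n)%N -> bf q q.-1 -> hi n bf q.-1 = m -> (m < n)%N ->
  ends_left T (vw m) (hw q).
Proof.
move=> qn bq qm mn; have q1n : (q.-1 < n)%N by lia.
split; [exact: hwall_wall|exact: hwall_horizontal|].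
apply: (right_edge_vwall bfT gT (k := Ordinal q1n) mn qm).
have hq : hi n bf' q.-1 = q by apply: hi_wall_self => //; lia.
rewrite hwallE /=; split=> /=; rewrite ?lexx // hq lexx /=.
by apply: ltW; have := tile_y (proj1 gT) (Ordinal q1n); rewrite /= hq.
Qed.

Lemma hwall_ends_right q m : (0 < q < n)%N -> bf q q.-1 -> lo bf q = m -> (0 < m)%N ->
  ends_right T (vw m) (hw q).
Proof.
move=> qn bq qm m0; have qn' : (q < n)%N by lia.
split; [exact: hwall_wall|exact: hwall_horizontal|].
apply: (left_edge_vwall bfT gT (k := Ordinal qn') m0 qm).
have hq : lo bf' q = q by apply: (@lo_wall_self n) => //; lia.
rewrite hwallE /=; split=> /=; rewrite ?lexx // hq lexx andbT.
by apply: ltW; have := tile_y (proj1 gT) (Ordinal qn'); rewrite /= hq.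
Qed.

End Ends.

Section WallCoordinates.
Variables (R : realType) (n : nat).

(** Heights of walls are thereby heights of grid lines, so no wall can end between two adjacent
    values of the coordinate function. *)
Lemma horizontal_wall_bot (T : layout R n) W : tiling T -> wall T W -> horizontal W ->
  exists k, bot (tile T k) = bot W.
Proof.
move=> tT [_ fW aW eW _] hW; have [h1 h2] := hW.
have [/andP[f1 f2] /andP[f3 f4]] : pts (frame T) (lft W, bot W) by apply: fW; split=> /=; lra.
have [/andP[f5 f6] /andP[f7 f8]] : pts (frame T) (rgt W, bot W) by apply: fW; split=> /=; lra.
move: f1 f2 f3 f4 f5 f6 f7 f8 => /= f1 f2 f3 f4 f5 f6 f7 f8.
have f9 : bot W < top (frame T).
  rewrite lt_neqAle f4 andbT; apply/eqP=> E; apply: eW; constructor 4.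
  by move=> p [/andP[p1 p2] /andP[p3 p4]]; split=> /=; lra.
have [|k /occP/= []] := @occ_ex _ _ _ tT true (lft W) true (bot W).
  by rewrite /in_frame /= -?leNgt -?ltNge; apply/and4P; split; lra.
rewrite -?ltNge => k1 k2 k3 k4; exists k; apply/eqP; rewrite eq_le k3 /= leNgt; apply/negP=> h.
by apply: (avoid_horizontal tT aW hW h) => //; lra.
Qed.

End WallCoordinates.

(** * Slides *)

Section NeighboursUp.
Variables (n : nat) (bf : rel nat).
Hypothesis bfT : torder n bf.
Local Notation bf' := (flip bf).

(* The horizontal wall p ends on the left, and the horizontal wall q on the   *)
(* right, of the same vertical wall.                                          *)
Definition opposite_ends p q :=
  [/\ (0 < p < n)%N, bf p p.-1, (0 < q < n)%N, bf q q.-1 & hi n bf p.-1 = lo bf q].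

Lemma opposite_ends_wall p q : opposite_ends p q ->
  [/\ (0 < lo bf q < n)%N, (p < lo bf q)%N & (lo bf q < q)%N].
Proof.
case=> pn bp qn bq E.
have p1 : (p.-1 < n)%N by lia.
have := hi_gt bf p1; have := lo_le bf q => h1 h2.
have mn : (lo bf q < n)%N by lia.
split; first lia.
  rewrite ltn_neqAle; apply/andP; split; last lia.
  apply/eqP=> pE; have [_ b _] := proj1 (hi_eqP _ p1 mn) E.
  by rewrite -pE in b; have := bf_asym bfT bp; rewrite b.
rewrite ltn_neqAle h1 andbT; apply/eqP=> qE.
have m0 : (0 < q)%N by lia.
by have [_ b _] := proj1 (lo_eqP _ _ m0) qE; have := bf_asym bfT bq; rewrite b.
Qed.

(** Tiles [p.-1] and [q] lie above the left end and below the right end; [b] and [c], on the other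
    sides of these ends, complete the four tiles of a slide. *)
Lemma opposite_ends_tiles p q : opposite_ends p q ->
  exists b c : 'I_n, [/\ hi n bf b = lo bf q, lo bf' b = p,
                         lo bf c = lo bf q & hi n bf' c = q].
Proof.
move=> opq; have [m0 pm mq] := opposite_ends_wall opq; case: opq => pn bp qn bq E.
have [_ _ [b [b1 b2 b3]]] := hi_below bfT E ltac:(lia) ltac:(lia).
have [_ _ [c [c1 c2 c3]]] := @lo_above _ _ bfT q _ ltac:(lia) erefl ltac:(lia) mq.
have bn : (b < n)%N by lia.
have cn : (c < n)%N by lia.
by exists (Ordinal bn), (Ordinal cn); split=> //=; rewrite b3 prednK //; lia.
Qed.

End NeighboursUp.

Section SlideData.
Variables (R : realType) (n : nat).
Implicit Types (T : layout R n) (W : box R) (X Z : nat -> R).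

(** The part of a slide that says nothing about the order of [W1] and [W2]; it therefore holds both
    before and after the slide. *)
Definition slide_data T W W1 W2 a b c d :=
  [/\ [/\ wall T W, vertical W, ends_left T W W1 & ends_right T W W2],
      [/\ pts (right_edge (tile T a)) `<=` pts W,
          pts (bottom_edge (tile T a)) `<=` pts W1,
          pts (right_edge (tile T b)) `<=` pts W &
          pts (top_edge (tile T b)) `<=` pts W1] &
      [/\ pts (left_edge (tile T c)) `<=` pts W,
          pts (bottom_edge (tile T c)) `<=` pts W2,
          pts (left_edge (tile T d)) `<=` pts W &
          pts (top_edge (tile T d)) `<=` pts W2]].

Definition hslide_data T W W1 W2 a b c d :=
  [/\ [/\ wall T W, horizontal W, ends_above T W W1 & ends_below T W W2],
      [/\ pts (bottom_edge (tile T a)) `<=` pts W,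
          pts (right_edge (tile T a)) `<=` pts W1,
          pts (bottom_edge (tile T b)) `<=` pts W &
          pts (left_edge (tile T b)) `<=` pts W1] &
      [/\ pts (top_edge (tile T c)) `<=` pts W,
          pts (right_edge (tile T c)) `<=` pts W2,
          pts (top_edge (tile T d)) `<=` pts W &
          pts (left_edge (tile T d)) `<=` pts W2]].

Definition no_end T W (y1 y2 : R) := forall W', ends_left T W W' \/ ends_right T W W' ->
  ~~ (y1 < bot W' < y2).

Lemma slide_data_anti T W W1 W2 a b c d :
  slide_data (anti T) (abox W) (abox W1) (abox W2) a b c d <-> hslide_data T W W1 W2 a b c d.
Proof.
have S (U V : box R) : pts U `<=` pts V -> pts (abox U) `<=` pts (abox V) by move/pts_abox_sub.
split=> -[[w v e1 e2]].
  move=> [a1 a2 b1 b2] [c1 c2 d1 d2]; split; split;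
    by [exact/wall_antiE|exact/vertical_abox|exact/ends_left_anti|exact/ends_right_anti|
        apply/pts_abox_sub; assumption].
move=> [/S a1 /S a2 /S b1 /S b2] [/S c1 /S c2 /S d1 /S d2]; split; split;
  by [assumption|exact/wall_antiE|exact/vertical_abox|exact/ends_left_anti|exact/ends_right_anti].
Qed.

(** The reflection turns left to right into top to bottom, so in the reflected tiling [W1] lies
    above [W2]. *)
Lemma hslideE T T' : hslide T T' <-> exists W W1 W2 a b c d,
  [/\ slide_data (anti T) W W1 W2 a b c d, bot W2 < bot W1,
      no_end (anti T) W (bot W2) (bot W1) &
      forall i j, (left_of T' i j <-> left_of T i j) /\
        (below T' i j <-> (below T i j /\ (i, j) <> (c, b)) \/ (i, j) = (d, a))].
Proof.
split=> [[W [W1 [W2 [a [b [c [d [h [lt ne] ab cd rel]]]]]]]]|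
         [W [W1 [W2 [a [b [c [d [sd lt ne rel]]]]]]]]].
  have [_ _ [_ [v1 _] _] [_ [v2 _] _]] := h.
  exists (abox W), (abox W1), (abox W2), a, b, c, d; split=> //.
  - exact/slide_data_anti.
  - by rewrite /= ltrN2 -v1 -v2.
  move=> W'; rewrite -(aboxK W') ends_left_anti ends_right_anti => H; have := ne _ H.
  have [e _] : vertical (abox W') by case: H => -[].
  by rewrite /= in e *; rewrite -e !ltrN2 -v1 -v2 andbC.
rewrite -(aboxK W) -(aboxK W1) -(aboxK W2) in sd; rewrite -(aboxK W) in ne.
move/slide_data_anti: sd => [h ab cd]; have [_ _ [_ [v1 _] _] [_ [v2 _] _]] := h.
exists (abox W), (abox W1), (abox W2), a, b, c, d; split=> //.
split=> [|W' H]; first by rewrite v1 v2 /= ltrN2.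
have [e _] : vertical W' by case: H => -[].
have := ne (abox W'); rewrite ends_left_anti ends_right_anti => /(_ H).
by rewrite v1 v2 e /= ltrNl ltrNr andbC.
Qed.

End SlideData.

Section Swap.
Variables (R : realType) (n : nat) (bf : rel nat) (X : nat -> R).
Hypothesis bfT : torder n bf.
Local Notation bf' := (flip bf).
Let bfT' := torder_flip bfT.

Lemma mk_left_ofE Z (i j : 'I_n) : generic_tiling (mk n bf X Z) ->
  left_of (mk n bf X Z) i j <->
  [/\ hi n bf i = lo bf j, Z (lo bf' j) < Z (hi n bf' i) & Z (lo bf' i) < Z (hi n bf' j)].
Proof.
move=> gT; split=> [l|[E h1 h2]].
  have E := mk_left_of bfT gT l; move/(left_ofE _ _ gT): l => [/= _].
  by rewrite !ltrN2.
by apply/(left_ofE _ _ gT) => /=; rewrite E !ltrN2.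
Qed.

Lemma mk_belowE Z (i j : 'I_n) : generic_tiling (mk n bf X Z) ->
  below (mk n bf X Z) i j <->
  [/\ lo bf' i = hi n bf' j, X (lo bf i) < X (hi n bf j) & X (lo bf j) < X (hi n bf i)].
Proof.
move=> gT; have gT' := generic_tiling_anti gT; rewrite anti_mk in gT'.
rewrite -left_of_anti anti_mk.
split=> [l|[E h1 h2]].
  have E := mk_left_of bfT' gT' l; move/(left_ofE _ _ gT'): l => [/= _].
  by rewrite !ltrN2.
by apply/(left_ofE _ _ gT') => /=; rewrite E !ltrN2.
Qed.

(** Each of the two horizontal walls would lie entirely to the left of the other. *)
Lemma opposite_ends_excl Z p q : generic_tiling (mk n bf X Z) ->
  opposite_ends n bf p q -> opposite_ends n bf q p -> False.
Proof.
move=> /generic_tiling_anti; rewrite anti_mk => gT [pn bp qn bq E] [_ _ _ _ E'].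
have := vwall_length bfT' gT pn bp; have := vwall_length bfT' gT qn bq.
by rewrite /= E E'; move=> h1 h2; have := lt_trans h1 h2; rewrite ltxx.
Qed.

Lemma opposite_ends_data Z p q (a b c d : 'I_n) : generic_tiling (mk n bf X Z) ->
  opposite_ends n bf p q -> a = p.-1 :> nat -> d = q :> nat ->
  hi n bf b = lo bf q -> lo bf' b = p -> lo bf c = lo bf q -> hi n bf' c = q ->
  slide_data (mk n bf X Z) (vwall n bf X Z (lo bf q)) (hwall n bf X Z p)
    (hwall n bf X Z q) a b c d.
Proof.
move=> gT opq ap dq b1 b2 c1 c2.
have [m0 pm mq] := opposite_ends_wall bfT opq; have [pn bp qn bq E] := opq.
set m := lo bf q in m0 pm mq b1 c1 E *.
have bm : bf m.-1 m by case: (@lo_wall _ _ bfT q m); lia.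
have [p0 p1] := andP pn; have [q0 q1] := andP qn; have [m1 m2] := andP m0.
have hp : hi n bf' p.-1 = p by apply: hi_wall_self.
have hq : lo bf' q = q by apply: (@lo_wall_self n).
split.
- split; [exact: vwall_wall|exact: (vwall_vertical bfT gT)| |].
    exact: hwall_ends_left.
  exact: hwall_ends_right.
- split.
  + by apply: (right_edge_vwall bfT gT) => //; rewrite ap.
  + by apply: (bottom_edge_hwall bfT gT) => //; rewrite ap.
  + exact: (right_edge_vwall bfT gT).
  + exact: (top_edge_hwall bfT gT).
split.
- exact: (left_edge_vwall bfT gT).
- exact: (bottom_edge_hwall bfT gT).
- by apply: (left_edge_vwall bfT gT) => //; rewrite dq.
by apply: (top_edge_hwall bfT gT) => //; rewrite dq.
Qed.

(** Both tiles keep their sides on the same wall, so contact is lost only if [i] has moved above [j]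
    or below [j]. The bottom of the upper tile and the top of the lower one are then walls ending
    from opposite sides, and their order has changed. *)
Lemma left_of_change (X' Z Z' : nat -> R) (i j : 'I_n) : generic_tiling (mk n bf X Z) ->
  generic_tiling (mk n bf X' Z') -> left_of (mk n bf X Z) i j -> ~ left_of (mk n bf X' Z') i j ->
  [/\ opposite_ends n bf i.+1 j, Z j < Z i.+1 & Z' i.+1 <= Z' j] \/
  (opposite_ends n bf (lo bf' i) (hi n bf' j) /\
   [/\ hi n bf i = lo bf (hi n bf' j), lo bf j = lo bf (hi n bf' j),
      Z (lo bf' i) < Z (hi n bf' j) & Z' (hi n bf' j) <= Z' (lo bf' i)]).
Proof.
move=> gT gT' /(mk_left_ofE _ _ gT)[E h1 h2] nl.
have l' : Z' (lo bf' j) < Z' (hi n bf' i) -> Z' (lo bf' i) < Z' (hi n bf' j) -> False.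
  move=> g1 g2; apply: nl; have := tile_x (proj1 gT') i; have := tile_x (proj1 gT') j => /= xj xi.
  by apply/(left_ofE _ _ gT'); rewrite /= !ltrN2 E.
have [_ wZ'] := tiling_sides (proj1 gT').
set m := lo bf j in E; have jm : lo bf j = m by [].
have mj := lo_le bf j; rewrite jm in mj.
have im := hi_gt bf (ltn_ord i); rewrite E in im.
have mn : (m < n)%N := leq_ltn_trans mj (ltn_ord j).
have m0 : (0 < m)%N := leq_ltn_trans (leq0n i) im.
have mn' : (0 < m < n)%N by rewrite m0 mn.
have bm : bf m.-1 m by case: (lo_wall bfT (ltn_ord j) jm m0).
have [ri1 ri2] := right_side_bounds bfT gT' mn' bm E.
have [lj1 lj2] := left_side_bounds bfT gT' mn' bm jm.
have [zi zj] := conj (wZ' _ (ltn_ord i)) (wZ' _ (ltn_ord j)).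
case: (ltP (Z' (lo bf' j)) (Z' (hi n bf' i))) => [g1|g1]; last first.
  left; have im1 : (i.+1 < m)%N.
    rewrite ltn_neqAle im andbT; apply/eqP=> e.
    by have e' : m.-1 = i by [rewrite -e]; rewrite e' in lj2; lra.
  have jm1 : (m < j)%N.
    by rewrite ltn_neqAle mj andbT; apply/eqP=> e; rewrite e in ri1; lra.
  have [i1 i2 _] := hi_below bfT E mn im1.
  have [j1 j2 _] := lo_above bfT (ltn_ord j) jm m0 jm1.
  rewrite i1 j1 in h1 g1; split=> //.
  split; rewrite //= ?E //; first by rewrite (ltn_trans im1 mn).
  by rewrite ltn_ord (leq_ltn_trans (leq0n m) jm1).
case: (ltP (Z' (lo bf' i)) (Z' (hi n bf' j))) => [g2|g2]; first by case: l'.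
right; set p := lo bf' i in h2 g2 zi ri1 *; set q := hi n bf' j in h2 g2 zj lj2 *.
have [ip jq] : lo bf' i = p /\ hi n bf' j = q by [].
have [[p0 bp hp]|e] := lo_flip_up bfT (ltn_ord i) E mn ip; last by rewrite e in lj1; lra.
have [[qn bq lq]|e] := hi_flip_down bfT (ltn_ord j) jm m0 jq; last by rewrite e in ri2; lra.
rewrite lq; split; last by split.
split; rewrite ?hp ?lq //; by rewrite p0 -ip (leq_ltn_trans (lo_le _ _) (ltn_ord i)).
Qed.

Definition transposed (Z Z' : nat -> R) p q := [/\ (p <= n)%N, (q <= n)%N, Z q < Z p, Z' p < Z' q &
  forall u v, (u <= n)%N -> (v <= n)%N -> (u, v) <> (p, q) -> (u, v) <> (q, p) ->
    (Z u < Z v) = (Z' u < Z' v)].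

Lemma transposed_sym Z Z' p q : transposed Z Z' p q -> transposed Z' Z q p.
Proof. by case=> p1 q1 h1 h2 h; split=> // u v un vn uv vu; rewrite h. Qed.

Section Diff.
Variables (Z Z' : nat -> R) (p q : nat).
Hypothesis gT : generic_tiling (mk n bf X Z).
Hypothesis gT' : generic_tiling (mk n bf X Z').
Hypothesis tr : transposed Z Z' p q.
Let T := mk n bf X Z.
Let T' := mk n bf X Z'.

Lemma left_of_lost (i j : 'I_n) : left_of T i j -> ~ left_of T' i j ->
  (opposite_ends n bf p q /\ (i = p.-1 :> nat /\ j = q :> nat)) \/
  (opposite_ends n bf q p /\ [/\ hi n bf i = lo bf p, lo bf j = lo bf p,
      lo bf' i = q & hi n bf' j = p]).
Proof.
have [pn qn lt1 lt2 Hs] := tr.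
have key u v : (u <= n)%N -> (v <= n)%N -> Z u < Z v -> Z' v <= Z' u -> u = q /\ v = p.
  move=> un vn uv vu; case: (pselect ((u, v) = (q, p))) => [[-> ->]//|ne1].
  case: (pselect ((u, v) = (p, q))) => [[e1 e2]|ne2].
    by have := lt_trans lt1; rewrite -e1 -e2 => /(_ _ uv); rewrite ltxx.
  by move: vu; rewrite leNgt -Hs // uv.
move=> l nl; case: (left_of_change gT gT' l nl) => [[o h1 h2]|[o [e1 e2 h1 h2]]].
  by have [<- <-] := key _ _ (ltnW (ltn_ord j)) (ltn_ord i) h1 h2; left.
have [e3 e4] := key _ _ (leq_trans (lo_le _ _) (ltnW (ltn_ord i))) (hi_le _ (ltn_ord j)) h1 h2.
by right; rewrite -e4 -{1}e3.
Qed.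

End Diff.

(** A slide without the condition that the two ends are adjacent. The data are kept for both tilings
    because [hslide_core] reads the slide backwards. *)
Definition slide_core (Z Z' : nat -> R) p q := exists m a b c d,
  [/\ slide_data (mk n bf X Z) (vwall n bf X Z m) (hwall n bf X Z p)
        (hwall n bf X Z q) a b c d,
      slide_data (mk n bf X Z') (vwall n bf X Z' m) (hwall n bf X Z' p)
        (hwall n bf X Z' q) a b c d,
      left_of (mk n bf X Z) a d, ~ left_of (mk n bf X Z) b c &
      forall i j, left_of (mk n bf X Z') i j <->
        (left_of (mk n bf X Z) i j /\ (i, j) <> (a, d)) \/ (i, j) = (b, c)].

Lemma slide_coreP Z Z' p q : generic_tiling (mk n bf X Z) -> generic_tiling (mk n bf X Z') ->
  transposed Z Z' p q -> opposite_ends n bf p q -> slide_core Z Z' p q.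
Proof.
move=> gT gT' tr opq; have tr' := transposed_sym tr.
have [pn0 qn0 lt1 lt2 Hs] := tr.
have [b [c [b1 b2 c1 c2]]] := opposite_ends_tiles bfT opq.
have [m0 pm mq] := opposite_ends_wall bfT opq; have [pn bp qn bq E] := opq.
have [p0 p1] := andP pn; have [q0 q1] := andP qn.
have p1n : (p.-1 < n)%N by lia.
pose a : 'I_n := Ordinal p1n; pose d : 'I_n := Ordinal q1.
have hp : hi n bf' p.-1 = p by apply: hi_wall_self.
have hq : lo bf' q = q by apply: (@lo_wall_self n).
have [wX wZ] := tiling_sides (proj1 gT); have [_ wZ'] := tiling_sides (proj1 gT').
have lad : left_of (mk n bf X Z) a d.
  apply/(mk_left_ofE _ _ gT); rewrite /= E hp hq; split=> //.
  have la : (lo bf' p.-1 < p)%N by rewrite (leq_ltn_trans (lo_le _ _)) // prednK.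
  rewrite Hs ?hi_le //; last 3 first.
  - by rewrite (leq_trans (ltnW la)).
  - by case=> e _; move: la; rewrite e ltnn.
  - by case=> e _; move: la; rewrite e ltnNge (ltnW (ltn_trans pm mq)).
  have := wZ' _ p1n; have := wZ' _ q1; rewrite hp hq; lra.
have nlbc : ~ left_of (mk n bf X Z) b c.
  by move/(mk_left_ofE _ _ gT) => [_ _]; rewrite b2 c2 => /(lt_trans lt1); rewrite ltxx.
have lbc' : left_of (mk n bf X Z') b c.
  apply/(mk_left_ofE _ _ gT'); rewrite b1 c1 b2 c2; split=> //.
  have zb := wZ _ (ltn_ord b); have zc := wZ _ (ltn_ord c); rewrite b2 in zb; rewrite c2 in zc.
  rewrite -Hs; first 1 last.
  - by apply: leq_trans (lo_le _ _) (ltnW (ltn_ord c)).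
  - exact: hi_le.
  - by case=> e _; rewrite e in zc; lra.
  - by case=> e _; rewrite e in zc; lra.
  lra.
have nlad : ~ left_of (mk n bf X Z') a d.
  by move/(mk_left_ofE _ _ gT') => [_]; rewrite /= hp hq => /(lt_trans lt2); rewrite ltxx.
have D1 (i j : 'I_n) : left_of (mk n bf X Z) i j -> ~ left_of (mk n bf X Z') i j -> (i, j) = (a, d).
  move=> l nl; case: (left_of_lost gT gT' tr l nl) => [[_ [ei ej]]|[oqp _]].
    by congr pair; apply: val_inj.
  by case: (opposite_ends_excl gT opq oqp).
have D2 (i j : 'I_n) : left_of (mk n bf X Z') i j -> ~ left_of (mk n bf X Z) i j -> (i, j) = (b, c).
  move=> l nl; case: (left_of_lost gT' gT tr' l nl) => [[oqp _]|[_ [i1 j1 i2 j2]]].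
    by case: (opposite_ends_excl gT opq oqp).
  have tT := proj1 gT.
  congr pair; apply: (overlap tT) => /=; rewrite ?i1 ?i2 ?j1 ?j2 ?b1 ?b2 ?c1 ?c2 ?ltrN2.
  - by rewrite -i1; apply: wX.
  - by rewrite -b1; apply: wX.
  - by rewrite -{1}i2; apply: wZ.
  - by rewrite -{1}b2; apply: wZ.
  - by rewrite -c1; apply: wX.
  - by rewrite -j1; apply: wX.
  - by rewrite -{1}c2; apply: wZ.
  by rewrite -{1}j2; apply: wZ.
exists (lo bf q), a, b, c, d; split=> //.
- exact: opposite_ends_data.
- exact: opposite_ends_data.
move=> i j; split=> [l|].
  case: (pselect (left_of (mk n bf X Z) i j)) => [l'|nl]; last by right; apply: D2.
  by left; split=> // -[ei ej]; apply: nlad; rewrite -ei -ej.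
case=> [[l ne]|[-> ->]//].
by apply: contrapT => nl; apply: ne; apply: D1.
Qed.

(** By [left_of_lost], the exchange of two lines affects a left contact only if their walls end at
    one wall from opposite sides. *)
Lemma swap_cases Z Z' p q : generic_tiling (mk n bf X Z) -> generic_tiling (mk n bf X Z') ->
  transposed Z Z' p q ->
  [\/ forall i j, left_of (mk n bf X Z') i j <-> left_of (mk n bf X Z) i j,
      slide_core Z Z' p q | slide_core Z' Z q p].
Proof.
move=> gT gT' tr; have tr' := transposed_sym tr.
case: (pselect (opposite_ends n bf p q)) => [opq|npq].
  by constructor 2; apply: slide_coreP.
case: (pselect (opposite_ends n bf q p)) => [oqp|nqp].
  by constructor 3; apply: slide_coreP.
constructor 1 => i j; split=> l; apply: contrapT => nl.
  by case: (left_of_lost gT' gT tr' l nl) => -[].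
by case: (left_of_lost gT gT' tr l nl) => -[].
Qed.

End Swap.

Definition none_between (R : realType) n (Z : nat -> R) p q :=
  forall r, (r <= n)%N -> ~~ (Z q < Z r < Z p).

Lemma no_end_between (R : realType) n bf (X Z : nat -> R) p q W' : generic_tiling (mk n bf X Z) -> none_between n Z p q ->
  wall (mk n bf X Z) W' -> horizontal W' -> ~~ (- Z p < bot W' < - Z q).
Proof.
move=> gT nb wW' hW'; have [k <-] := horizontal_wall_bot (proj1 gT) wW' hW'.
by rewrite /= !ltrN2 andbC; apply: nb; apply: hi_le.
Qed.

Section Steps.
Variables (R : realType) (n : nat) (bf : rel nat).
Hypothesis bfT : torder n bf.
Implicit Types (X Z : nat -> R) (i j : 'I_n).
Let bfT' := torder_flip bfT.

Lemma vslide_core X Z Z' p q : generic_tiling (mk n bf X Z) ->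
  generic_tiling (mk n bf X Z') -> Z q < Z p -> none_between n Z p q ->
  slide_core n bf X Z Z' p q -> vslide (mk n bf X Z) (mk n bf X Z').
Proof.
move=> gT gT' lt nb [m [a [b [c [d [[d1 d2 d3] _ _ _ rel]]]]]].
exists (vwall n bf X Z m), (hwall n bf X Z p), (hwall n bf X Z q), a, b, c, d; split=> //.
  rewrite !hwallE /= ltrN2; split=> // W' [[w h _]|[w h _]].
    exact: (no_end_between gT nb w h).
  exact: (no_end_between gT nb w h).
by move=> i j; split; [rewrite (mk_belowE bfT _ _ gT) (mk_belowE bfT _ _ gT')|apply: rel].
Qed.

Lemma step_Z X Z Z' p q : generic_tiling (mk n bf X Z) -> generic_tiling (mk n bf X Z') ->
  transposed n Z Z' p q -> none_between n Z p q -> none_between n Z' q p ->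
  mosaic_step (mk n bf X Z) (mk n bf X Z').
Proof.
move=> gT gT' tr nb nb'; split=> //.
have [_ _ lt1 lt2 _] := tr.
case: (swap_cases bfT gT gT' tr) => [same|core|core].
- left=> i j; split; last by rewrite same.
  by rewrite (mk_belowE bfT _ _ gT) (mk_belowE bfT _ _ gT').
- by right; constructor 1; apply: vslide_core core.
by right; constructor 3; apply: vslide_core core.
Qed.

(** The reflection reverses the direction along the wall: a slide upwards from [X] to [X'] in the
    reflected picture is a slide to the right from [X'] to [X]. *)
Lemma hslide_core X X' Z p q : generic_tiling (mk n bf X Z) ->
  generic_tiling (mk n bf X' Z) -> X' p < X' q -> none_between n X' q p ->
  slide_core n (flip bf) Z X X' p q -> hslide (mk n bf X' Z) (mk n bf X Z).
Proof.
move=> gT gT' lt nb [m [a [b [c [d [_ dat lad nlbc rel]]]]]].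
have aT := generic_tiling_anti gT; have aT' := generic_tiling_anti gT'.
rewrite !anti_mk in aT aT'.
apply/hslideE; exists (vwall n (flip bf) Z X' m), (hwall n (flip bf) Z X' p),
  (hwall n (flip bf) Z X' q), a, b, c, d; split.
- by rewrite anti_mk.
- by rewrite !hwallE /= ltrN2.
- rewrite anti_mk !hwallE /= => W' [[w h _]|[w h _]].
    exact: (no_end_between aT' nb w h).
  exact: (no_end_between aT' nb w h).
move=> i j; split.
  rewrite -!below_anti !anti_mk.
  by rewrite (mk_belowE bfT' _ _ aT) (mk_belowE bfT' _ _ aT').
rewrite -!left_of_anti !anti_mk rel; split.
  move=> l; case: (pselect ((i, j) = (d, a))) => [|ne]; first by right.
  left; split; last by case=> ei ej; apply: nlbc; rewrite -ei -ej.
  by left; split=> // -[ei ej]; apply: ne; rewrite ei ej.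
case=> [[[[l _]|[ei ej]] ne]|[-> ->]] //.
by case: ne; rewrite ei ej.
Qed.

Lemma step_X X X' Z p q : generic_tiling (mk n bf X Z) -> generic_tiling (mk n bf X' Z) ->
  transposed n X X' p q -> none_between n X p q -> none_between n X' q p ->
  mosaic_step (mk n bf X Z) (mk n bf X' Z).
Proof.
move=> gT gT' tr nb nb'; split=> //.
have [_ _ lt1 lt2 _] := tr.
have aT := generic_tiling_anti gT; have aT' := generic_tiling_anti gT'.
rewrite !anti_mk in aT aT'.
case: (swap_cases bfT' aT aT' tr) => [same|core|core].
- left=> i j; split; first by rewrite -!left_of_anti !anti_mk same.
  rewrite -!below_anti !anti_mk.
  by rewrite (mk_belowE bfT' _ _ aT) (mk_belowE bfT' _ _ aT').
- by right; constructor 4; apply: hslide_core core.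
by right; constructor 2; apply: hslide_core core.
Qed.

(** The finer coordinates only break ties. Strict overlaps survive; conversely an overlap in the
    finer tiling is at least a weak overlap in the coarser one, and with closed edges this is
    already a contact. *)
Lemma refine_left_of X Z X' Z' i j : generic_tiling (mk n bf X Z) ->
  generic_tiling (mk n bf X' Z') ->
  (forall u v, (u <= n)%N -> (v <= n)%N -> Z u < Z v -> Z' u < Z' v) ->
  left_of (mk n bf X Z) i j <-> left_of (mk n bf X' Z') i j.
Proof.
move=> gT gT' H.
have lon (k : 'I_n) : (lo (flip bf) k <= n)%N := leq_trans (lo_le _ _) (ltnW (ltn_ord k)).
have hin (k : 'I_n) : (hi n (flip bf) k <= n)%N := hi_le _ (ltn_ord k).
rewrite (mk_left_ofE bfT _ _ gT'); split.
  by move/(mk_left_ofE bfT _ _ gT) => [E h1 h2]; split=> //; apply: H.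
case=> E h1 h2; apply/(left_of_weakE _ _ (proj1 gT)); rewrite /= !lerN2 E; split=> //.
  by rewrite leNgt; apply/negP=> /H - /(_ (hin _) (lon _)) /(lt_trans h1); rewrite ltxx.
by rewrite leNgt; apply/negP=> /H - /(_ (hin _) (lon _)) /(lt_trans h2); rewrite ltxx.
Qed.

End Steps.

Lemma refine_same (R : realType) n bf (X Z X' Z' : nat -> R) : torder n bf ->
  generic_tiling (mk n bf X Z) -> generic_tiling (mk n bf X' Z') ->
  (forall u v, (u <= n)%N -> (v <= n)%N -> X u < X v -> X' u < X' v) ->
  (forall u v, (u <= n)%N -> (v <= n)%N -> Z u < Z v -> Z' u < Z' v) ->
  same_incidences (mk n bf X Z) (mk n bf X' Z').
Proof.
move=> bfT gT gT' HX HZ i j; split; last exact: refine_left_of.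
rewrite -!left_of_anti !anti_mk; apply: refine_left_of => //; first exact: torder_flip.
  by rewrite -anti_mk; apply: generic_tiling_anti.
by rewrite -anti_mk; apply: generic_tiling_anti.
Qed.

(** * Connecting coordinate choices by adjacent exchanges *)

Section Perms.
Variable N : nat.
Implicit Types (s t : 'S_N).

(** Otherwise [t] increases along the values of [s], so composing it with the inverse of [s] gives
    an increasing permutation, which is squeezed to the identity by [up] and [down]. *)
Lemma adjacent_inversion s t : s != t ->
  exists u v, s v = (s u).+1 :> nat /\ (t v < t u)%N.
Proof.
move=> ne; apply: contrapT => H; case/eqP: ne.
have step u v : s v = (s u).+1 :> nat -> (t u < t v)%N.
  move=> E; rewrite ltnNge leq_eqVlt; apply/negP=> /orP[/eqP/val_inj/perm_inj vu|lt].
    by move: E; rewrite vu => /eqP; rewrite -[X in X == _]addn0 -addn1 eqn_add2l.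
  by apply: H; exists u, v.
have up r (rN : (r < N)%N) : (r <= t (s^-1%g (Ordinal rN)))%N.
  elim: r rN => [//|r IH] rN; have rN' : (r < N)%N by lia.
  by apply: leq_ltn_trans (IH rN') _; apply: step; rewrite !permKV.
have down d r (rN : (r < N)%N) : (N - r.+1 <= d)%N -> (t (s^-1%g (Ordinal rN)) <= r)%N.
  elim: d r rN => [|d IH] r rN dr.
    by have := ltn_ord (t (s^-1%g (Ordinal rN))); lia.
  case: (ltnP r.+1 N) => rN'; last by have := ltn_ord (t (s^-1%g (Ordinal rN))); lia.
  have := IH r.+1 rN' ltac:(lia).
  suff : (t (s^-1%g (Ordinal rN)) < t (s^-1%g (Ordinal rN')))%N by lia.
  by apply: step; rewrite !permKV.
apply/permP=> x; apply: val_inj => /=; have sx := ltn_ord (s x).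
have := up _ sx; have := down N _ sx ltac:(lia).
have -> : Ordinal sx = s x by apply: val_inj.
by rewrite permK => h1 h2; apply/eqP; rewrite eqn_leq h1 h2.
Qed.

Lemma perm_path (P : 'S_N -> Prop) (E : 'S_N -> 'S_N -> Prop) t :
  (forall s, P s -> E s s) ->
  (forall s s' s'', E s s' -> E s' s'' -> E s s'') ->
  (forall s u v, P s -> s v = (s u).+1 :> nat -> (t v < t u)%N ->
     P (tperm u v * s)%g /\ E s (tperm u v * s)%g) ->
  forall s, P s -> E s t.
Proof.
move=> Er Et Es.
(* As in the rearrangement inequality, this sum strictly increases when an adjacent inversion
   relative to [t] is removed; being bounded, it serves as the termination measure. *)
pose w s := (\sum_x s x * t x)%N.
have wB s : (w s <= N * (N * N))%N.
  rewrite /w -[X in (X * _)%N]card_ord -sum_nat_const; apply: leq_sum => x _.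
  by apply: leq_mul; apply: ltnW.
have main d s : (N * (N * N) - w s < d)%N -> P s -> E s t.
  elim: d s => [//|d IH] s ds Ps; case: (eqVneq s t) => [<-|ne]; first exact: Er.
  have [u [v [uv tuv]]] := adjacent_inversion ne.
  have [P' E'] := Es s u v Ps uv tuv; apply: Et E' _; apply: IH P'.
  suff : (w s < w (tperm u v * s)%g)%N by have := wB (tperm u v * s)%g; lia.
  have ne' : v != u by apply/eqP=> e; rewrite e in uv; lia.
  rewrite /w (bigD1 u) //= (bigD1 v) //= [X in (_ < X)%N](bigD1 u) //= [X in (_ < _ + X)%N](bigD1 v) //=.
  rewrite !permM tpermL tpermR.
  have -> : (\sum_(i | (i != u) && (i != v)) (tperm u v * s)%g i * t i)%N =
      (\sum_(i | (i != u) && (i != v)) s i * t i)%N.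
    by apply: eq_bigr => x /andP[xu xv]; rewrite permM tpermD // eq_sym.
  by move: (\sum_(i | _) _)%N => c; nia.
move=> s; exact: (main _ _ (ltnSn _)).
Qed.

End Perms.


Lemma swap_ltn N (s : 'S_N) u v a b : s v = (s u).+1 :> nat ->
  ~ (a = v /\ b = u) -> ~ (a = u /\ b = v) ->
  (s (tperm u v a) < s (tperm u v b))%N = (s a < s b)%N.
Proof.
move=> uv n1 n2.
have si x y : x != y -> s x <> s y :> nat by move=> /eqP xy /val_inj/perm_inj.
have ne : u != v by apply/eqP=> e; rewrite e in uv; lia.
case: (tpermP u v a) n1 n2 => [->|->|/eqP au /eqP av]; case: (tpermP u v b) => [->|->|/eqP bu /eqP bv] n1 n2.
all: try (by rewrite ?uv ?ltnn; lia).
all: try (by case: n1); try (by case: n2).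
all: have := si _ _ ne; try have := si _ _ au; try have := si _ _ av;
  try have := si _ _ bu; try have := si _ _ bv; rewrite ?uv; lia.
Qed.

Section Ranks.
Variables (R : realType) (n : nat).

Definition rank (s : 'S_n.+1) (c : nat) : R := (s (inord c))%:R.

Lemma rank_inj s : inj_upto n (rank s).
Proof.
move=> a b an bn /eqP; rewrite eqr_nat => /eqP/val_inj/perm_inj E.
by have := congr1 (@nat_of_ord _) E; rewrite !inordK.
Qed.

Lemma rank_ex (f : nat -> R) : exists s, forall u v, (u <= n)%N -> (v <= n)%N ->
  f u < f v -> rank s u < rank s v.
Proof.
pose le (a b : 'I_n.+1) := f a <= f b.
pose l := sort le (enum 'I_n.+1).
have leT : total le by move=> a b; apply: le_total.
have letr : transitive le by move=> a b c; apply: le_trans.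
have inl a : a \in l by rewrite mem_sort mem_enum.
have sl : size l = n.+1 by rewrite size_sort size_enum_ord.
have il a : (index a l < n.+1)%N by rewrite -[X in (_ < X)%N]sl index_mem.
have inj : injective (fun a => Ordinal (il a)).
  by move=> a b /(congr1 val) /=; apply: index_inj.
exists (perm inj) => u v un vn uv; rewrite /rank ltr_nat !permE /= ltnNge; apply/negP=> h.
have := @sorted_leq_index _ le letr _ l (sort_sorted leT _) _ _ (inl _) (inl _) h.
by move=> /(_ (fun _ => lexx _)); rewrite /le !inordK // leNgt uv.
Qed.

Lemma rank_swap (s : 'S_n.+1) u v : s v = (s u).+1 :> nat ->
  [/\ transposed n (rank s) (rank (tperm u v * s)%g) v u,
     none_between n (rank s) v u & none_between n (rank (tperm u v * s)%g) u v].
Proof.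
move=> uv; have uE : inord u = u by apply: inord_val.
have vE : inord v = v by apply: inord_val.
have ne : u != v by apply/eqP=> e; rewrite e in uv; lia.
split.
- split; [by rewrite -ltnS|by rewrite -ltnS| | |].
  + by rewrite /rank uE vE ltr_nat uv.
  + by rewrite /rank uE vE !permM tpermL tpermR ltr_nat uv.
  move=> a b an bn n1 n2; rewrite /rank !ltr_nat !permM.
  have n1' : ~ (inord a = v /\ inord b = u).
    by case=> e1 e2; apply: n1; rewrite -e1 -e2 !inordK.
  have n2' : ~ (inord a = u /\ inord b = v).
    by case=> e1 e2; apply: n2; rewrite -e1 -e2 !inordK.
  by rewrite swap_ltn.
- by move=> r rn; rewrite /rank uE vE !ltr_nat uv; lia.
by move=> r rn; rewrite /rank uE vE !ltr_nat !permM tpermL tpermR uv; lia.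
Qed.

End Ranks.

Section Connected.
Variables (R : realType) (n : nat) (bf : rel nat).
Hypothesis n0 : (0 < n)%N.
Hypothesis bfT : torder n bf.

Lemma rank_generic (s t : 'S_n.+1) : increasing_sides n bf (rank R s) ->
  increasing_sides n (flip bf) (rank R t) -> generic_tiling (mk n bf (rank R s) (rank R t)).
Proof.
move=> ws wt; have tT := mk_tiling n0 bfT ws wt.
by split=> //; apply: mk_generic => //; apply: rank_inj.
Qed.

(** The two sides of a tile are in the same order for [s] and for the target [t], so they are never
    the pair exchanged; the path stays among realizations. *)
Lemma increasing_swap bf0 (s t : 'S_n.+1) u v : increasing_sides n bf0 (rank R s) ->
  increasing_sides n bf0 (rank R t) -> s v = (s u).+1 :> nat -> (t v < t u)%N ->
  increasing_sides n bf0 (rank R (tperm u v * s)%g).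
Proof.
move=> ws wt uv tuv k kn; have := ws k kn; have := wt k kn; rewrite /rank !ltr_nat !permM.
move: (inord (lo _ _)) (inord (hi _ _ _)) => a b tab sab.
case: (pselect (a = v /\ b = u)) => [[e1 e2]|n1]; first by rewrite e1 e2 uv in sab; lia.
case: (pselect (a = u /\ b = v)) => [[e1 e2]|n2]; first by rewrite e1 e2 in tab; lia.
by rewrite swap_ltn.
Qed.

(** The conditions on the two coordinate functions are independent, so columns and rows can be moved
    one after the other. Passing to ranks makes all values distinct, which keeps every intermediate
    tiling generic. *)
Lemma mosaic_mk (X Z X' Z' : nat -> R) : generic_tiling (mk n bf X Z) ->
  generic_tiling (mk n bf X' Z') -> mosaic_equivalent (mk n bf X Z) (mk n bf X' Z').
Proof.
move=> gT gT'.
have [wX wZ] := tiling_sides (proj1 gT); have [wX' wZ'] := tiling_sides (proj1 gT').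
have [s Hs] := rank_ex n X; have [t Ht] := rank_ex n Z.
have [s' Hs'] := rank_ex n X'; have [t' Ht'] := rank_ex n Z'.
have inc bf0 (f : nat -> R) (r : 'S_n.+1) : (forall u v, (u <= n)%N -> (v <= n)%N -> f u < f v ->
    rank R r u < rank R r v) -> increasing_sides n bf0 f -> increasing_sides n bf0 (rank R r).
  move=> H w k kn; apply: H (w k kn); last exact: hi_le.
  exact: leq_trans (lo_le _ _) (ltnW kn).
have ws := inc _ _ _ Hs wX; have wt := inc _ _ _ Ht wZ.
have ws' := inc _ _ _ Hs' wX'; have wt' := inc _ _ _ Ht' wZ'.
have g := rank_generic.
apply: rt_trans (mk n bf (rank R s) (rank R t)) _ _ _.
  by apply: rt_step; split; [by []|exact: g|left; apply: refine_same => //; exact: g].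
apply: rt_trans (mk n bf (rank R s') (rank R t')) _ _ _; last first.
  apply: rt_step; split; [exact: g|by []|left=> i j].
  have := refine_same bfT gT' (g _ _ ws' wt') Hs' Ht' i j; tauto.
apply: rt_trans (mk n bf (rank R s') (rank R t)) _ _ _.
  apply: (@perm_path _ (fun r => increasing_sides n bf (rank R r))
    (fun r r' => mosaic_equivalent (mk n bf (rank R r) (rank R t)) (mk n bf (rank R r') (rank R t)))
    s') => //.
  - by move=> r _; apply: rt_refl.
  - by move=> r1 r2 r3; apply: rt_trans.
  move=> r u v wr uv tuv; have w' := increasing_swap wr ws' uv tuv; split=> //.
  have [tr nb nb'] := rank_swap R uv.
  by apply: rt_step; apply: step_X tr nb nb' => //; apply: g.
apply: (@perm_path _ (fun r => increasing_sides n (flip bf) (rank R r))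
  (fun r r' => mosaic_equivalent (mk n bf (rank R s') (rank R r)) (mk n bf (rank R s') (rank R r')))
  t') => //.
- by move=> r _; apply: rt_refl.
- by move=> r1 r2 r3; apply: rt_trans.
move=> r u v wr uv tuv; have w' := increasing_swap wr wt' uv tuv; split=> //.
have [tr nb nb'] := rank_swap R uv.
by apply: rt_step; apply: step_Z tr nb nb' => //; apply: g.
Qed.

End Connected.

(** * The map rho *)

Section Staircase.
Local Open Scope nat_scope.
Variables (n : nat) (bf : rel nat).
Hypothesis bfT : torder n bf.
Local Notation bf' := (flip bf).
Lemma lo_notin i j : lo bf j <= i < j -> j < n -> bf j i.
Proof.
by move=> ij jn; apply: (bf_neg bfT); [lia|lia|lia|apply: (proj1 (lo_leP bf j i)); lia].
Qed.

Lemma hi_notin i j : j < i < hi n bf j -> j < n -> bf i j.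
Proof.
move=> ij jn; have [?|[iN H]] := proj1 (hi_gtP bf i jn) ltac:(lia); first lia.
by apply: (bf_neg bfT); [lia|lia|lia|apply: H; lia].
Qed.

Lemma lo_prev k : 0 < lo bf k -> bf (lo bf k).-1 k.
Proof. by move=> h; have [_] := proj1 (lo_eqP bf k h) erefl. Qed.

Lemma hi_next k : k < n -> hi n bf k < n -> bf k (hi n bf k).
Proof. by move=> kn h; have [_] := proj1 (hi_eqP bf kn h) erefl. Qed.

End Staircase.

Section Rho.
Local Open Scope nat_scope.
Variables (n : nat) (bf : rel nat).
Hypothesis bfT : torder n bf.
Local Notation bf' := (flip bf).
Let bfT' := torder_flip bfT.
Variables (k j : nat).
Hypotheses (kn : (k < n)) (jn : (j < n)) (jk : bf j k).

Let contra i : bf i j -> bf k i -> False.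
Proof.
by move=> h1 h3; have := bf_asym bfT (bf_tr bfT h1 jk); rewrite h3.
Qed.

Let jkE : j <> k. Proof. by move=> E; move: jk; rewrite E (to_irr bfT). Qed.

Let nkj : ~~ bf k j. Proof. exact: (bf_asym bfT jk). Qed.

(** Here [j] is a tile drawn before [k] that contains the diagonal point [k]. This is the case in
    which the top left corner is sought upwards, and it forces a vertical wall at that point. *)
Lemma corner_drawn : 0 < k -> k <= hi n bf j -> lo bf' j <= k -> bf k.-1 k.
Proof.
move=> k0 h1 h2; case: (ltngtP k j) => [kj|kj|/esym//].
  by case/negP: nkj; apply: (@lo_notin _ _ bfT' k j) => //; lia.
case: (eqVneq j k.-1) => [<-//|/eqP ne].
by apply: (bf_tr bfT) jk; apply: (hi_notin bfT) => //; lia.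
Qed.

(** If [j] rose higher, the label just above the top of tile [k] would be drawn after [k] and yet
    before [j]. The left, right and bottom bounds likewise produce a label that violates the order
    [j], [k]. *)
Lemma top_bound : k <= hi n bf j -> (lo bf' k <= lo bf' j).
Proof.
move=> h1; rewrite leqNgt; apply/negP=> lt.
have l0 : 0 < lo bf' k by lia.
have ki := lo_prev l0; have lk := lo_le bf' k; set i := (lo bf' k).-1 in ki.
rewrite /flip in ki.
case: (ltngtP i j) => [ij|ji|e]; last by have := bf_asym bfT ki; rewrite e jk.
  by apply: (contra _ ki); apply: (@lo_notin _ _ bfT' i j) => //; lia.
by apply: (contra _ ki); apply: (hi_notin bfT) => //; lia.
Qed.

Lemma left_bound : 0 < k -> bf k k.-1 -> k <= hi n bf' j -> lo bf' j <= k ->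
  (hi n bf j <= lo bf k).
Proof.
move=> k0 bk h1 h2; rewrite leqNgt; apply/negP=> lt.
case: (ltngtP k j) => [kj|kj|/esym//].
  by case/negP: nkj; apply: (@lo_notin _ _ bfT' k j) => //; lia.
have jL : j < lo bf k.
  rewrite ltnNge; apply/negP=> h.
  by case/negP: nkj; apply: (lo_notin bfT) => //; lia.
have lk := lo_le bf k.
have Lk : lo bf k < k.
  rewrite ltn_neqAle lk andbT; apply/eqP=> e.
  have l0 : 0 < lo bf k by lia.
  by have := lo_prev l0; rewrite e => h; have := bf_asym bfT h; rewrite bk.
apply: (@contra (lo bf k)); first by apply: (hi_notin bfT) => //; lia.
by apply: (lo_notin bfT) => //; lia.
Qed.

Lemma corner_drawn' : k.+1 < n -> lo bf' j <= k.+1 -> k.+1 <= hi n bf j ->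
  bf k.+1 k.
Proof.
move=> k1 h1 h2; case: (ltngtP j k) => [lt|gt|//].
  by case/negP: nkj; apply: (hi_notin bfT) => //; lia.
case: (eqVneq j k.+1) => [<-//|/eqP ne].
by apply: (bf_tr bfT) jk; apply: (@lo_notin _ _ bfT' k.+1 j) => //; lia.
Qed.

Lemma right_bound : lo bf' j <= k.+1 -> (hi n bf j <= hi n bf k).
Proof.
move=> h1; rewrite leqNgt; apply/negP=> lt.
have hj := hi_le bf jn; have hk := hi_gt bf kn.
have km := hi_next kn (leq_trans lt hj); set m := hi n bf k in lt hk km.
case: (ltngtP j m) => [jm|mj|e]; last by have := bf_asym bfT km; rewrite -e jk.
  by apply: (contra _ km); apply: (hi_notin bfT) => //; lia.
by apply: (contra _ km); apply: (@lo_notin _ _ bfT' m j) => //; lia.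
Qed.

Lemma bottom_bound : k.+1 < n -> bf k k.+1 -> k.+1 <= hi n bf j ->
  (hi n bf' k <= lo bf' j).
Proof.
move=> k1 bk h1; rewrite leqNgt; apply/negP=> lt.
case: (ltngtP j k) => [lt'|gt|//].
  by case/negP: nkj; apply: (hi_notin bfT) => //; lia.
have hk := hi_gt bf' kn; have hk' := hi_le bf' kn.
set m := hi n bf' k in lt hk hk'.
have mj : m <= j.
  rewrite leqNgt; apply/negP=> h.
  by case/negP: nkj; apply: (@hi_notin _ _ bfT' j k) => //; lia.
have m1 : k.+1 < m.
  rewrite ltn_neqAle hk andbT; apply/eqP=> e.
  have mn : hi n bf' k < n by rewrite -/m -e.
  by have := hi_next kn mn; rewrite -/m -e /flip => h; have := bf_asym bfT h; rewrite bk.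
apply: (@contra m.-1); first by apply: (@lo_notin _ _ bfT' m.-1 j) => //; lia.
by apply: (@hi_notin _ _ bfT' m.-1 k) => //; lia.
Qed.

End Rho.

Section RhoTiles.
Variables (R : realType) (n : nat) (bf : rel nat).
Hypothesis bfT : torder n bf.
Local Notation bf' := (flip bf).
Let bfT' := torder_flip bfT.

(** The vertical and the horizontal line [m] cross in the diagonal point [(m, n - m)], whence the
    shift by [n] in the negated heights. *)
Definition rho_tiling : layout R n := mk n bf (fun m => m%:R) (fun m => m%:R - n%:R).

Lemma sup_eq (S : set R) v : S v -> (forall u, S u -> u <= v) -> sup S = v.
Proof.
move=> Sv H; apply/eqP; rewrite eq_le; apply/andP; split.
  by apply: ge_sup; [exists v|].
by apply: ub_le_sup => //; exists v.
Qed.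

Lemma rho_tileP (j : 'I_n) (p : R * R) : pts (tile rho_tiling j) p <->
  [/\ (lo bf j)%:R <= p.1, p.1 <= (hi n bf j)%:R,
      (lo bf' j)%:R <= n%:R - p.2 & n%:R - p.2 <= (hi n bf' j)%:R].
Proof.
rewrite /pts /=; split=> [[/andP[a b] /andP[c d]]|[a b c d]].
  by split=> //; lra.
by split; apply/andP; split=> //; lra.
Qed.

Definition drawn_before (k : nat) (p : R * R) :=
  [\/ p.1 = 0 /\ 0 <= p.2 <= n%:R, 0 <= p.1 <= n%:R /\ p.2 = 0 |
      exists2 j : 'I_n, bf j k & pts (tile rho_tiling j) p].

Variables (D : set (R * R)) (k : 'I_n).
Hypothesis DE : forall p, D p <-> drawn_before k p.

Let kn := ltn_ord k.

Lemma D_tile (j : 'I_n) p : bf j k -> pts (tile rho_tiling j) p -> D p.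
Proof. by move=> b h; apply/DE; constructor 3; exists j. Qed.

Lemma rho_top_left : new_top_left D (diag R n k) = ((lo bf k)%:R, n%:R - (lo bf' k)%:R).
Proof.
rewrite /new_top_left; have kR : (k%:R : R) < n%:R by rewrite ltr_nat.
have lk := lo_le bf' k; have lk' := lo_le bf k.
have k0R : 0 <= k%:R :> R by rewrite ler0n.
case: asboolP => [dD|nD] /=.
  have k1 : k = 0%N :> nat \/ (0 < k)%N /\ bf k.-1 k.
    case: (posnP k) => [|k0]; first by left.
    right; split=> //; move/DE: dD => [[/= e _]|[/= _ e]|[j jk /rho_tileP[/= h1 h2 h3 h4]]].
    - by move/eqP: e; rewrite pnatr_eq0; lia.
    - by lra.
    apply: (@corner_drawn _ _ bfT k j) => //.
      by move: h2; rewrite ler_nat.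
    by move: h3; rewrite subKr ler_nat.
  have -> : lo bf k = k.
    case: k1 => [e|[k0 b]]; first by move: lk'; rewrite e; lia.
    exact: (@lo_wall_self n).
  congr pair; apply: sup_eq.
    split; last by rewrite lerD2l lerN2 ler_nat.
    case: k1 => [e|[k0 b]].
      apply/DE; constructor 1 => /=; split; first by rewrite e.
      by move: lk; rewrite e leqn0 => /eqP ->; rewrite subr0 ler0n lexx.
    have lt : (lo bf' k < k)%N.
      rewrite ltn_neqAle lk andbT; apply/eqP=> e.
      have l0 : (0 < lo bf' k)%N by lia.
      by have := lo_prev l0; rewrite e /flip => h; have := bf_asym bfT h; rewrite b.
    (* All labels in this interval are drawn before [k]. By the rule for cells, the last drawn of
       them covers the cell in column [k.-1] and row [lo bf' k], so the supremum is attained on its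
       boundary. *)
    case: (last_in_interval bfT (b := lo bf' k) (a := k.-1)) => [|e ek He]; first by lia.
    have en : (e < n)%N by lia.
    apply: (@D_tile (Ordinal en)).
      by apply: (@lo_notin _ _ bfT' e k) => //; lia.
    apply/rho_tileP => /=; rewrite subKr !ler_nat.
    have := lo_le bf e; have := hi_gt bf' en; split; [lia| | |lia].
      suff : (k.-1 < hi n bf e)%N by lia.
      apply/(hi_gtP _ _ en); right; split; first lia.
      by move=> i ie; apply: (bf_asym bfT); apply: He; lia.
    apply/lo_leP => i ie; rewrite /flip; apply: (bf_asym bfT); apply: He; lia.
  move=> u [/DE Du un]; case: Du => [[/= e /andP[_ h]]|[/= _ e]|[j jk /rho_tileP[/= h1 h2 h3 h4]]].
  - have {}e : k = 0%N :> nat by apply/eqP; rewrite -(pnatr_eq0 R) e.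
    by move: lk; rewrite e leqn0 => /eqP ->; rewrite subr0.
  - by lra.
  have : (lo bf' k <= lo bf' j)%N.
    by apply: (@top_bound _ _ bfT) => //; move: h2; rewrite ler_nat.
  by rewrite -(ler_nat R); lra.
have k0 : (0 < k)%N.
  rewrite lt0n; apply/eqP=> e; apply: nD; apply/DE; constructor 1.
  by rewrite /= e subr0 lexx ler0n.
have k1n : (k.-1 < n)%N by lia.
have b : bf k k.-1.
  apply: (bf_neg bfT); [lia|lia|lia|]; apply/negP=> b; apply: nD.
  apply: (@D_tile (Ordinal k1n)) => //; apply/rho_tileP => /=; rewrite subKr !ler_nat.
  have := lo_le bf k.-1; have := lo_le bf' k.-1; have := hi_gt bf k1n; have := hi_gt bf' k1n.
  by split; lia.
have -> : lo bf' k = k by apply: (@lo_wall_self n).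
congr pair; apply: sup_eq.
  split; last by rewrite ler_nat.
  case: (posnP (lo bf k)) => [->|l0].
    by apply/DE; constructor 1 => /=; split=> //; lra.
  (* The supremum is attained on the right side of the tile whose number determines [lo bf k]. *)
  have jn : ((lo bf k).-1 < n)%N by lia.
  apply: (@D_tile (Ordinal jn)); first exact: lo_prev.
  apply/rho_tileP => /=; rewrite subKr !ler_nat.
  have := lo_le bf (lo bf k).-1; have := lo_le bf' (lo bf k).-1; have := hi_gt bf jn.
  split; [lia|lia|lia|].
  suff : (k.-1 < hi n bf' (lo bf k).-1)%N by lia.
  apply/(hi_gtP _ _ jn); right; split; first lia.
  move=> i ik; rewrite /flip; apply: (bf_asym bfT); apply: (bf_tr bfT (lo_prev l0)).
  by apply: (@lo_notin _ _ bfT) => //; lia.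
move=> u [/DE Du un]; case: Du => [[/= -> _]|[/= _ e]|[j jk /rho_tileP[/= h1 h2 h3 h4]]].
- by rewrite ler0n.
- by lra.
have : (hi n bf j <= lo bf k)%N.
  apply: (@left_bound _ _ bfT) => //.
    by move: h4; rewrite subKr ler_nat.
  by move: h3; rewrite subKr ler_nat.
by rewrite -(ler_nat R); lra.
Qed.

Lemma rho_bottom_right :
  new_bottom_right D (diag R n k.+1) = ((hi n bf k)%:R, n%:R - (hi n bf' k)%:R).
Proof.
rewrite /new_bottom_right; have kR : (k.+1%:R : R) <= n%:R by rewrite ler_nat.
have hk := hi_gt bf' kn; have hk' := hi_gt bf kn; have hn := hi_le bf' kn; have hn' := hi_le bf kn.
have k0R : 0 < k.+1%:R :> R by rewrite ltr0n.
case: asboolP => [dD|nD] /=.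
  have k1 : k.+1 = n \/ (k.+1 < n)%N /\ bf k.+1 k.
    case: (ltngtP k.+1 n) => [k1|k1|k1]; [right|lia|by left].
    split=> //; move/DE: dD => [[/= e _]|[/= _ e]|[j jk /rho_tileP[/= h1 h2 h3 h4]]].
    - by lra.
    - by move: k1; rewrite -(ltr_nat R); lra.
    apply: (@corner_drawn' _ _ bfT k j) => //; first by move: h3; rewrite subKr ler_nat.
    by move: h2; rewrite ler_nat.
  have -> : hi n bf' k = k.+1.
    case: k1 => [e|[k0 b]]; first by lia.
    by apply/hi_eqP => //; split=> //; lia.
  congr pair; apply: sup_eq.
    split; last by rewrite ler_nat.
    case: k1 => [e|[k0 b]].
      apply/DE; constructor 2 => /=; split; last by rewrite e subrr.
      by rewrite ler0n ler_nat.
    case: (last_in_interval bfT (b := k.+1) (a := (hi n bf k).-1)) => [|e ek He].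
      have lt : (k.+1 < hi n bf k)%N.
        rewrite ltn_neqAle hk' andbT; apply/eqP=> e.
        have l0 : (hi n bf k < n)%N by lia.
        by have := hi_next kn l0; rewrite -e => h; have := bf_asym bfT h; rewrite b.
      by lia.
    have en : (e < n)%N by lia.
    apply: (@D_tile (Ordinal en)).
      by apply: (hi_notin bfT) => //; lia.
    apply/rho_tileP => /=; rewrite subKr !ler_nat.
    have := lo_le bf e; have := hi_gt bf' en; split; [lia| | |lia].
      suff : ((hi n bf k).-1 < hi n bf e)%N by lia.
      apply/(hi_gtP _ _ en); right; split; first lia.
      by move=> i ie; apply: (bf_asym bfT); apply: He; lia.
    apply/lo_leP => i ie; rewrite /flip; apply: (bf_asym bfT); apply: He; lia.
  move=> u [/DE Du un]; case: Du => [[/= e _]|[/= /andP[_ h] e]|[j jk /rho_tileP[/= h1 h2 h3 h4]]].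
  - by lra.
  - have : (n <= k.+1)%N by rewrite -(ler_nat R); lra.
    by move=> nk; have -> : hi n bf k = n by lia.
  have : (hi n bf j <= hi n bf k)%N.
    by apply: (@right_bound _ _ bfT) => //; move: h3; rewrite subKr ler_nat.
  by rewrite -(ler_nat R); lra.
have k1 : (k.+1 < n)%N.
  rewrite ltn_neqAle kn andbT; apply/eqP=> e; apply: nD; apply/DE; constructor 2.
  by rewrite /= e subrr lexx ler0n.
have b : bf k k.+1.
  apply: (bf_neg bfT); [lia|lia|lia|]; apply/negP=> b; apply: nD.
  apply: (@D_tile (Ordinal k1)) => //; apply/rho_tileP => /=; rewrite subKr !ler_nat.
  have := hi_gt bf k1; have := hi_gt bf' k1; have := lo_le bf k.+1; have := lo_le bf' k.+1.
  by split; lia.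
have -> : hi n bf k = k.+1 by apply/hi_eqP => //; split=> //; lia.
congr pair; apply: sup_eq.
  split; last by rewrite lerD2l lerN2 ler_nat.
  case: (ltngtP (hi n bf' k) n) => [l0||->]; [|lia|]; last first.
    by apply/DE; constructor 2 => /=; split; [rewrite ler0n|rewrite subrr].
  apply: (@D_tile (Ordinal l0)); first exact: (hi_next kn l0).
  apply/rho_tileP => /=; rewrite subKr !ler_nat.
  have := lo_le bf' (hi n bf' k); have := hi_gt bf l0; have := hi_gt bf' l0.
  split; [|lia|lia|lia].
  apply/lo_leP => i ik; apply: (bf_asym bfT); apply: (bf_tr bfT (hi_next kn l0)).
  by apply: (@hi_notin _ _ bfT' i k) => //; lia.
move=> u [/DE Du un]; case: Du => [[/= e _]|[/= _ ->]|[j jk /rho_tileP[/= h1 h2 h3 h4]]].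
- by lra.
- by rewrite subr_ge0 ler_nat.
have : (hi n bf' k <= lo bf' j)%N.
  by apply: (@bottom_bound _ _ bfT) => //; move: h2; rewrite ler_nat.
by rewrite -(ler_nat R); lra.
Qed.

Lemma rho_new_rectangle : new_rectangle D k = tile rho_tiling k.
Proof.
by rewrite /new_rectangle rho_top_left rho_bottom_right /= !opprB.
Qed.

End RhoTiles.

Section RhoPerm.
Variables (R : realType) (n : nat) (x : 'S_n).

Definition word : seq nat := [seq val k | k <- one_line x].

Definition before : rel nat := fun i j => (index i word < index j word)%N.

Lemma beforeE (k l : 'I_n) : before k l = (index k (one_line x) < index l (one_line x))%N.
Proof. by rewrite /before /word !index_map //; apply: val_inj. Qed.

Lemma mem_one_line k : k \in one_line x.
Proof.
by apply/mapP; exists (x^-1%g k); rewrite ?mem_enum ?permKV.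
Qed.

Lemma uniq_one_line : uniq (one_line x).
Proof. by rewrite map_inj_uniq ?enum_uniq //; apply: perm_inj. Qed.

Lemma before_order : torder n before.
Proof.
split=> [i|j i k|i j iN jN ij]; rewrite /before ?ltnn //; first exact: ltn_trans.
have -> : i = Ordinal iN by []. have -> : j = Ordinal jN by [].
rewrite -neq_ltn; apply: contra ij => /eqP.
rewrite /word !index_map; try exact: val_inj.
move=> e; have E : Ordinal iN = Ordinal jN by exact: (@index_inj _ (Ordinal iN) (one_line x) _ _ (mem_one_line _) (mem_one_line _) e).
by have /= -> := congr1 val E.
Qed.

Lemma drawn_rcons (s : seq 'I_n) k :
  @drawn R n (rcons s k) = @drawn R n s `|` pts (new_rectangle (@drawn R n s) k).
Proof. by rewrite /drawn foldl_rcons. Qed.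

Lemma drawn_take i : (i <= n)%N ->
  forall p, @drawn R n (take i (one_line x)) p <->
  [\/ p.1 = 0 /\ 0 <= p.2 <= n%:R, 0 <= p.1 <= n%:R /\ p.2 = 0 |
      exists2 j : 'I_n, (index j (one_line x) < i)%N & pts (tile (rho_tiling R n before) j) p].
Proof.
have sz : size (one_line x) = n by rewrite size_map size_enum_ord.
elim: i => [_ p|i IH iN p].
  rewrite take0 /drawn /=; split.
    case=> -[/= /andP[a b] /andP[c d]]; [constructor 1|constructor 2];
      by split; try (apply/andP; split=> //); apply/eqP; rewrite eq_le ?a ?b ?c ?d.
  by case=> [[e h]|[h e]|[j] //]; [left|right]; split=> /=; rewrite ?e ?lexx.
have in' : (i < n)%N by lia.
have k0 : 'I_n by exact: Ordinal in'.
set k := nth k0 (one_line x) i.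
have ik : index k (one_line x) = i by rewrite index_uniq ?sz // uniq_one_line.
rewrite (take_nth k0) ?sz // drawn_rcons -/k.
rewrite (@rho_new_rectangle R n before before_order) //; last first.
  move=> q; rewrite IH ?(ltnW iN) // /drawn_before.
  split=> -[h|h|[j j1 j2]]; try (by constructor 1); try (by constructor 2);
    constructor 3; exists j => //; by rewrite beforeE ik in j1 *.
split.
  case=> [/(IH (ltnW iN))[h|h|[j j1 j2]]|h].
  - by constructor 1.
  - by constructor 2.
  - by constructor 3; exists j => //; apply: ltnW.
  by constructor 3; exists k => //; rewrite ik.
case=> [h|h|[j j1 j2]].
- by left; apply/(IH (ltnW iN)); constructor 1.
- by left; apply/(IH (ltnW iN)); constructor 2.
move: j1; rewrite ltnS leq_eqVlt => /orP[/eqP e|lt].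
  right; suff -> : k = j by [].
  by rewrite /k -e nth_index // mem_one_line.
by left; apply/(IH (ltnW iN)); constructor 3; exists j.
Qed.

Lemma rhoE : @rho R n x = mk n before (fun m => m%:R) (fun m => m%:R - n%:R).
Proof.
rewrite /rho /mk; congr Layout; first by rewrite /rho_frame subrr oppr0 sub0r opprK.
apply: funext => k.
rewrite (@rho_new_rectangle R n before before_order) //.
move=> p; rewrite drawn_take; last first.
  by apply: leq_trans (index_size _ _) _; rewrite size_map size_enum_ord.
rewrite /drawn_before.
by split=> -[h|h|[j j1 j2]]; try (by constructor 1); try (by constructor 2);
  constructor 3; exists j => //; rewrite beforeE in j1 *.
Qed.

Lemma rho_generic : (0 < n)%N -> generic_tiling (@rho R n x).
Proof.
move=> n0; rewrite rhoE.
have side bf k : (k < n)%N -> (lo bf k < hi n bf k)%N.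
  by move=> kn; apply: leq_ltn_trans (lo_le _ _) (hi_gt _ kn).
have tT : tiling (mk n before (fun m => m%:R) (fun m => m%:R - n%:R : R)).
  apply: mk_tiling n0 before_order _ _ => k kn; first by rewrite ltr_nat side.
  by rewrite ltrD2r ltr_nat side.
split=> //; apply: mk_generic => // a b _ _.
  by move/eqP; rewrite eqr_nat => /eqP.
by move/addIr/eqP; rewrite eqr_nat => /eqP.
Qed.

End RhoPerm.

(** * Redrawing a tiling *)

Lemma head_rev (A : Type) (x : A) s : head x (rev s) = last x s.
Proof. by case/lastP: s => // s a; rewrite rev_rcons last_rcons. Qed.

Section ListFacts.
Variables (A B : Type).
Implicit Types (s p q : seq A) (a : A).

Lemma cat_split s1 s2 p a q : s1 ++ s2 = p ++ a :: q ->
  (exists q1, s1 = p ++ a :: q1 /\ q = q1 ++ s2) \/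
  (exists p2, p = s1 ++ p2 /\ s2 = p2 ++ a :: q).
Proof.
elim: s1 p => [|b s1 IH] [|c p] /=.
- by move=> ->; right; exists [::].
- by move=> ->; right; exists (c :: p).
- by case=> <- <-; left; exists s1.
by case=> <- /IH [[q1 [-> ->]]|[p2 [-> ->]]]; [left; exists q1|right; exists p2].
Qed.

Lemma filter_split (P : pred A) s p a q : filter P s = p ++ a :: q ->
  exists s1 s2, [/\ s = s1 ++ a :: s2, filter P s1 = p & filter P s2 = q].
Proof.
elim: s p => [|b s IH] p /=; first by case: p.
case: (boolP (P b)) => Pb.
  case: p => [|c p] /= [].
    by move=> -> <-; exists [::], s.
  by move=> <- /IH [s1 [s2 [-> <- <-]]]; exists (b :: s1), s2; rewrite /= Pb.
by move=> /IH [s1 [s2 [-> <- <-]]]; exists (b :: s1), s2; rewrite /= (negbTE Pb).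
Qed.

Lemma head_cat (x : B) (s t : seq B) y : head x (s ++ y :: t) = head y s.
Proof. by case: s. Qed.

Lemma head_map_filter (f : A -> B) (P : pred A) x d s :
  head x [seq f a | a <- s & P a] = if has P s then f (nth d s (find P s)) else x.
Proof. by elim: s => //= a s IH; case: (P a). Qed.

Lemma last_has (f : A -> B) (P : pred A) x y s : has P s ->
  last x [seq f a | a <- s & P a] = last y [seq f a | a <- s & P a].
Proof. by elim: s => //= a s IH; case: (P a). Qed.

(** Scan from the front: as long as the current item, not blocked from the left, is blocked from the
    right, the next one is not blocked from the left. The scan stops at the last item at the
    latest. *)
Lemma unblocked (BL : seq A -> A -> Prop) (BR : A -> seq A -> Prop) g : g <> [::] ->
  (forall a q, g = a :: q -> ~ BL [::] a) ->
  (forall p a, g = p ++ [:: a] -> ~ BR a [::]) ->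
  (forall p a b q, g = p ++ a :: b :: q -> BR a (b :: q) -> BL (p ++ [:: a]) b -> False) ->
  exists p a q, [/\ g = p ++ a :: q, ~ BL p a & ~ BR a q].
Proof.
case: g => // a0 q0 _ first last mid.
have main q p a : a0 :: q0 = p ++ a :: q -> ~ BL p a ->
    exists p a q, [/\ a0 :: q0 = p ++ a :: q, ~ BL p a & ~ BR a q].
  elim: q p a => [|b q IH] p a E nb; first by exists p, a, [::]; split=> //; apply: last E.
  case: (pselect (BR a (b :: q))) => [br|nbr]; last by exists p, a, (b :: q).
  apply: (IH (p ++ [:: a]) b); first by rewrite -catA.
  by move=> bl; apply: mid E br bl.
by apply: (main q0 [::] a0) => //; apply: first.
Qed.

End ListFacts.

Section Sides.
Variables (R : realType) (A : Type) (t : A -> nat) (N : nat).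
Implicit Types (s p q : seq A) (l r : A -> R).

(* The items of s are drawn tiles, listed by number, and the corners of the   *)
(* undrawn region between them; t is the drawing time, N for the corners.     *)
Definition sides_ok l r FL FR s := forall p a q, s = p ++ a :: q ->
  l a = last FL [seq r b | b <- p & (t b < t a)%N] /\
  ((t a < N)%N -> r a = head FR [seq l b | b <- q & (t a < t b)%N]).

Lemma insert_ok l r FL FR s1 g s2 pre u post i :
  sides_ok l r FL FR (s1 ++ g :: s2) -> t g = N -> t u = i -> (i < N)%N ->
  all (fun b => (t b < i) || (t b == N))%N s1 ->
  all (fun b => (t b < i) || (t b == N))%N s2 ->
  (pre = [::] \/ exists g1, [/\ pre = [:: g1], t g1 = N & l g1 = l g]) ->
  ((post = [::] /\ r u = head FR [seq l b | b <- s2 & t b == N]) \/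
   exists g2, [/\ post = [:: g2], t g2 = N & l g2 = r u]) ->
  l u = l g ->
  (forall p h q, s2 = p ++ h :: q -> t h = N -> has (fun b => t b < N)%N p) ->
  sides_ok l r FL FR (s1 ++ (pre ++ u :: post) ++ s2).
Proof.
move=> ok tg tu iN a1 a2 Hpre Hpost lu tiles p a q E.
have pre_t : all (fun b => t b == N) pre.
  by case: Hpre => [->//|[g1 [-> e _]]]; rewrite /= e eqxx.
have post_t : all (fun b => t b == N) post.
  by case: Hpost => [[->]//|[g2 [-> e _]]]; rewrite /= e eqxx.
have f0 (P : pred A) w : (forall b, t b = N -> P b = false) -> all (fun b => t b == N) w ->
    [seq b <- w | P b] = [::].
  move=> H; elim: w => //= b w IH /andP[/eqP /H -> /IH]; exact.
have ts1 p' b q' : s1 = p' ++ b :: q' -> (t b < i)%N \/ t b = N.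
  by move=> e; move: a1; rewrite e all_cat /= => /and3P[_ /orP[|/eqP] ? _]; auto.
have ts2 p' b q' : s2 = p' ++ b :: q' -> (t b < i)%N \/ t b = N.
  by move=> e; move: a2; rewrite e all_cat /= => /and3P[_ /orP[|/eqP] ? _]; auto.
case: (cat_split E) => [[q1 [e1 eq]]|[p2 [ep e2]]].
  have := ok p a (q1 ++ g :: s2); rewrite e1 -catA => /(_ erefl) [h1 h2]; split=> // ta.
  rewrite (h2 ta) eq !filter_cat !map_cat /= tg ta /= head_cat.
  have tai : (t a < i)%N by case: (ts1 _ _ _ e1) => // e; rewrite e ltnn in ta.
  case: Hpre => [->|[g1 [-> tg1 lg1]]] /=.
    by rewrite tu tai /= head_cat lu.
  by rewrite tg1 ta /= head_cat lg1.
case: (cat_split e2) => [[q1 [e3 eq]]|[p3 [ep2 e3]]]; last first.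
  have := ok (s1 ++ g :: p3) a q; rewrite e3 -catA => /(_ erefl) [h1 h2]; split=> //.
  rewrite {}h1 ep ep2 !filter_cat !map_cat /= tg.
  case: (ts2 _ _ _ e3) => [ta|ta].
    have taN : (t a < N)%N := ltn_trans ta iN.
    rewrite ltnNge (ltnW taN) /= (f0 _ _ _ pre_t); last by move=> b ->; rewrite ltnNge ltnW.
    rewrite tu ltnNge (ltnW ta) /= (f0 _ _ _ post_t) //.
    by move=> b ->; rewrite ltnNge ltnW.
  rewrite ta ltnn !last_cat.
  exact: last_has (tiles _ _ _ e3 ta).
case: (cat_split e3) => [[q2 [e4 eq2]]|[p3 [ep2 e4]]].
  have [g1 [pE tg1 lg1]] : exists g1, [/\ pre = [:: g1], t g1 = N & l g1 = l g].
    by case: Hpre => // e; move: e4; rewrite e; case: (p2).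
  move: e4; rewrite pE; case: p2 ep {e2 e3} => [|c [|c' p2]] //= ep [e4 _]; rewrite -e4 tg1.
  split; last by rewrite ltnn.
  have [h1 _] := ok s1 g s2 erefl.
  by rewrite lg1 h1 ep cats0 tg.
case: p3 ep2 e4 => [|c p3] /= ep2 [e4 eq2].
  rewrite -e4 tu; split=> [|_].
    have [h1 _] := ok s1 g s2 erefl.
    rewrite lu h1 ep ep2 cats0 filter_cat (f0 _ pre) //; last first.
      by move=> b ->; rewrite ltnNge ltnW.
    rewrite cats0 tg; congr (last _ (map _ _)).
    elim: (s1) a1 => //= b w IH /andP[h /IH ->]; congr (if _ then _ else _).
    case/orP: h => [h|/eqP ->]; first by rewrite h (ltn_trans h iN).
    by rewrite ltnn ltnNge ltnW.
  rewrite eq -eq2; case: Hpost => [[-> ->]|[g2 [-> tg2 lg2]]] /=; last by rewrite tg2 iN.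
  congr (head _ (map _ _)).
  elim: (s2) a2 => //= b w IH /andP[h /IH ->]; congr (if _ then _ else _).
  case/orP: h => [h|/eqP ->]; last by rewrite iN eqxx.
  by rewrite (ltn_eqF (ltn_trans h iN)) ltnNge ltnW.
have [g2 [pE tg2 lg2]] : exists g2, [/\ post = [:: g2], t g2 = N & l g2 = r u].
  by case: Hpost => [[e _]|//]; move: eq2; rewrite e; case: (p3).
move: eq2; rewrite pE; case: p3 ep2 => [|c' p3] //= ep2 []; last by move=> _; case: (p3).
move=> e5 _.
rewrite -e5 tg2 ltnn; split=> //.
by rewrite lg2 ep ep2 -e4 !filter_cat /= tu iN !map_cat /= !last_cat.
Qed.

End Sides.

Section Coordinates.
Variables (R : realType) (n : nat) (bf : rel nat) (l r : nat -> R) (FL FR : R).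

Lemma coords_of_sides : torder n bf ->
  (forall k, (k < n)%N -> l k = last FL [seq r j | j <- iota 0 k & bf j k]) ->
  (forall k, (k < n)%N -> r k = head FR [seq l j | j <- iota k.+1 (n - k.+1) & bf k j]) ->
  (0 < n)%N ->
  exists X : nat -> R, [/\ X 0%N = FL, X n = FR &
    forall k, (k < n)%N -> l k = X (lo bf k) /\ r k = X (hi n bf k)].
Proof.
move=> bfT Hl Hr n0.
(* If line [m] carries a vertical wall, then [lo bf m = m], so the left side of tile [m] is its
   coordinate; at other inner [m] the value is arbitrary, as no tile has a side there. *)
pose X m := if m == 0%N then FL else if (m < n)%N then l m else FR.
have rX k : (k < n)%N -> r k = X (hi n bf k).
  move=> kn; rewrite Hr // (head_map_filter _ _ _ 0%N).
  set s := iota _ _; rewrite /X.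
  have -> : (hi n bf k == 0%N) = false by rewrite gtn_eqF // (leq_ltn_trans (leq0n k) (hi_gt _ kn)).
  case: (boolP (has (bf k) s)) => hs.
    have fs : (find (bf k) s < n - k.+1)%N by rewrite has_find size_iota in hs.
    by rewrite /s nth_iota // -/s; have -> : (hi n bf k < n)%N by rewrite /hi -/s; lia.
  have -> // : (hi n bf k < n)%N = false.
  by rewrite /hi -/s (hasNfind hs) size_iota; lia.
exists X; split; [by []|by rewrite /X ltnn gtn_eqF|move=> k kn; split; last exact: rX].
rewrite Hl //; case: (posnP (lo bf k)) => [l0|lp].
  have H := proj1 (lo_leP bf k 0) ltac:(by rewrite l0).
  rewrite l0 /X eqxx; rewrite (_ : [seq j <- iota 0 k | bf j k] = [::]) //.
  apply/eqP; rewrite -[_ == _]negbK -has_filter; apply/hasPn => j.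
  by rewrite mem_iota => /H.
have [jk b H] := proj1 (lo_eqP bf k lp) erefl.
set j := (lo bf k).-1 in b.
have jE : lo bf k = j.+1 by rewrite prednK.
have jn : (j < n)%N by lia.
have -> : iota 0 k = iota 0 j ++ j :: iota j.+1 (k - j.+1).
  have -> : k = (j + (k - j.+1).+1)%N by lia.
  by rewrite iotaD /=; congr (_ ++ _ :: iota _ _); lia.
rewrite filter_cat /= b map_cat last_cat /=.
rewrite (_ : [seq i <- iota j.+1 (k - j.+1) | bf i k] = [::]) /=; last first.
  apply/eqP; rewrite -[_ == _]negbK -has_filter; apply/hasPn => i.
  by rewrite mem_iota => ij; apply: H; lia.
rewrite rX //; congr X; rewrite jE; apply/hi_eqP => //; first by lia.
split; [lia| |lia].
by case: (lo_wall bfT kn erefl lp); rewrite jE.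
Qed.

End Coordinates.

Section Precedence.
Variables (R : realType) (n : nat).
Implicit Types (T : layout R n) (W : box R) (p u : 'I_n).

(* A tile p below and to the right of u, across a vertical wall, is recorded  *)
(* before u in the wall shuffle.                                              *)
Definition prec_v T p u := exists W, [/\ vertical W, avoids_interiors T W,
  pts (right_edge (tile T u)) `<=` pts W, pts (left_edge (tile T p)) `<=` pts W &
  top (tile T p) <= bot (tile T u)].

Definition prec_h T p u := exists W, [/\ horizontal W, avoids_interiors T W,
  pts (bottom_edge (tile T p)) `<=` pts W, pts (top_edge (tile T u)) `<=` pts W &
  rgt (tile T p) <= lft (tile T u)].

(** The third case covers every tile, adjacent or not, that meets the open quadrant below and to the
    left of the upper right corner of [u]; such tiles come first if the drawn region is to stay
    below a staircase. *)
Definition prec T p u := [\/ prec_v T p u, prec_h T p u |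
  [/\ p <> u, lft (tile T p) < rgt (tile T u) & bot (tile T p) < top (tile T u)]].

Lemma vertical_sub W (x y1 y2 : R) : vertical W -> y1 <= y2 -> pts (Box x x y1 y2) `<=` pts W ->
  [/\ x = lft W, bot W <= y1 & y2 <= top W].
Proof.
move=> [vW _] y12 sub.
have [/andP[a1 a2] /andP[a3 a4]] : pts W (x, y1) by apply: sub; split=> /=; lra.
have [_ /andP[a5 a6]] : pts W (x, y2) by apply: sub; split=> /=; lra.
by move: a1 a2 a3 a4 a5 a6 => /= *; split; lra.
Qed.

Lemma horizontal_sub W (x1 x2 y : R) : horizontal W -> x1 <= x2 -> pts (Box x1 x2 y y) `<=` pts W ->
  [/\ y = bot W, lft W <= x1 & x2 <= rgt W].
Proof.
move=> [vW _] x12 sub.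
have [/andP[a1 a2] /andP[a3 a4]] : pts W (x1, y) by apply: sub; split=> /=; lra.
have [/andP[a5 a6] _] : pts W (x2, y) by apply: sub; split=> /=; lra.
by move: a1 a2 a3 a4 a5 a6 => /= *; split; lra.
Qed.

Lemma right_edge_sub T W u : tiling T -> vertical W -> pts (right_edge (tile T u)) `<=` pts W ->
  [/\ rgt (tile T u) = lft W, bot W <= bot (tile T u) & top (tile T u) <= top W].
Proof. by move=> tT cW; apply: vertical_sub cW (ltW (tile_y tT u)). Qed.

Lemma left_edge_sub T W u : tiling T -> vertical W -> pts (left_edge (tile T u)) `<=` pts W ->
  [/\ lft (tile T u) = lft W, bot W <= bot (tile T u) & top (tile T u) <= top W].
Proof. by move=> tT cW; apply: vertical_sub cW (ltW (tile_y tT u)). Qed.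

Lemma bottom_edge_sub T W u : tiling T -> horizontal W -> pts (bottom_edge (tile T u)) `<=` pts W ->
  [/\ bot (tile T u) = bot W, lft W <= lft (tile T u) & rgt (tile T u) <= rgt W].
Proof. by move=> tT cW; apply: horizontal_sub cW (ltW (tile_x tT u)). Qed.

Lemma top_edge_sub T W u : tiling T -> horizontal W -> pts (top_edge (tile T u)) `<=` pts W ->
  [/\ top (tile T u) = bot W, lft W <= lft (tile T u) & rgt (tile T u) <= rgt W].
Proof. by move=> tT cW; apply: horizontal_sub cW (ltW (tile_x tT u)). Qed.

End Precedence.

(** * Partial drawings and their corners *)

Section Drawing.
Variables (R : realType) (n : nat) (T : layout R n).
Hypothesis gT : generic_tiling T.
Let tT : tiling T. Proof. by case: gT. Qed.
Variable k0 : 'I_n.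

Local Notation FL := (lft (frame T)).
Local Notation FR := (rgt (frame T)).
Local Notation FB := (bot (frame T)).
Local Notation FT := (top (frame T)).

(** Drawing time, horizontal sides, vertical sides. A corner has time [n], later than every tile,
    and only its left and bottom coordinates carry meaning; the zeros in [gap] are fillers. *)
Definition item : eqType := (nat * ((R * R) * (R * R)))%type.
Definition il (a : item) : R := a.2.1.1.
Definition ir (a : item) : R := a.2.1.2.
Definition ib (a : item) : R := a.2.2.1.
Definition it (a : item) : R := a.2.2.2.
Definition titem (t : nat) (k : 'I_n) : item :=
  (t, ((lft (tile T k), rgt (tile T k)), (bot (tile T k), top (tile T k)))).
Definition gap (x y : R) : item := (n, ((x, 0), (y, 0))).
Definition gaps (s : seq item) := [seq a <- s | a.1 == n].
Definition gap_lt (a b : item) := (il a < il b) && (ib b < ib a).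

(** The list runs from top left to bottom right, so heights are read in the reversed list. The
    undrawn region is the union of the quadrants above and to the right of the corners, which
    [st_drawn] and [st_undrawn] relate to the tiles. *)
Record state (dr : seq 'I_n) (s : seq item) : Prop := State {
  st_uniq : uniq dr;
  st_time : perm_eq [seq a.1 | a <- s & a.1 != n] (iota 0 (size dr));
  st_tile : forall a, a \in s -> a.1 != n -> a = titem a.1 (nth k0 dr a.1);
  st_x : sides_ok (fun a : item => a.1) n il ir FL FR s;
  st_y : sides_ok (fun a : item => a.1) n ib it FB FT (rev s);
  st_sorted : pairwise gap_lt (gaps s);
  st_frame : forall a, a \in gaps s -> FL <= il a < FR /\ FB <= ib a < FT;
  st_drawn : forall k a, k \in dr -> a \in gaps s ->
    rgt (tile T k) <= il a \/ top (tile T k) <= ib a;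
  st_undrawn : forall k, k \notin dr ->
    exists a, [/\ a \in gaps s, il a <= lft (tile T k) & ib a <= bot (tile T k)];
  st_prec : forall u p, u \in dr -> prec T p u -> (index p dr < index u dr)%N }.

Lemma state0 : state [::] [:: gap FL FB].
Proof.
have fx := frame_x tT; have fy := frame_y tT.
have one (l r : item -> R) (x y : R) a : l a = x -> a.1 = n ->
    sides_ok (fun a : item => a.1) n l r x y [:: a].
  by move=> la an [|b p] c q; [case=> <- _; rewrite la an ltnn|case=> _; case: p].
split=> //.
- by rewrite /= eqxx.
- by move=> a; rewrite inE => /eqP -> /=; rewrite eqxx.
- exact: one.
- exact: one.
- by rewrite /gaps /= eqxx.
- by move=> a; rewrite /gaps /= eqxx inE => /eqP ->; rewrite /il /ib /= !lexx fx fy.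
move=> k _; exists (gap FL FB); rewrite /gaps /= eqxx inE eqxx.
by have [? _ ? _] := tile_in_frame tT k.
Qed.

Lemma gaps_sides p a q : pairwise gap_lt (p ++ a :: q) ->
  (forall b, b \in p -> gap_lt b a) /\ (forall b, b \in q -> gap_lt a b).
Proof.
by rewrite pairwise_cat allrel_consr /= => /and4P[/andP[/allP h1 _] _ /allP h2 _].
Qed.

Lemma gaps_order p a q b : pairwise gap_lt (p ++ a :: q) -> b \in p ++ a :: q ->
  [\/ b \in p /\ gap_lt b a, b = a | b \in q /\ gap_lt a b].
Proof.
move=> /gaps_sides[h1 h2].
by rewrite mem_cat inE => /or3P[bp|/eqP ->|bq]; [constructor 1|constructor 2|constructor 3];
  split=> //; [apply: h1|apply: h2].
Qed.

Definition corner_tile (a : item) k := lft (tile T k) = il a /\ bot (tile T k) = ib a.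

Local Ltac rlra :=
  repeat match goal with H : @eq ?A _ _ |- _ =>
    lazymatch A with Real.sort _ => fail | _ => clear H end end; lra.

Section Select.
Variables (dr : seq 'I_n) (s : seq item).
Hypothesis st : state dr s.

(** The tile just above and to the right of the corner is undrawn, hence lies above and to the right
    of some corner. As different corners are incomparable, that corner is [a], which pins down the
    lower left corner of the tile. *)
Lemma corner_tile_ex a : a \in gaps s -> exists2 k, k \notin dr & corner_tile a k.
Proof.
move=> ag; have [/andP[f1 f2] /andP[f3 f4]] := st_frame st ag.
have [|k /occP/= []] := @occ_ex _ _ _ tT true (il a) true (ib a).
  by rewrite /in_frame /= -!ltNge; apply/and4P.
rewrite -!ltNge => k1 k2 k3 k4.
have kd : k \notin dr.
  by apply/negP=> kd; case: (st_drawn st kd ag); rewrite leNgt ?k2 ?k4.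
exists k => //; have [b [bg b1 b2]] := st_undrawn st kd.
have [p [q E]] : exists p q, gaps s = p ++ a :: q by case/splitPr: ag => p q; exists p, q.
have ss := st_sorted st; rewrite E in ss bg.
case: (gaps_order ss bg) => [[_ /andP[_ h]]|e|[_ /andP[h _]]].
- by have := lt_le_trans h (le_trans b2 k3); rewrite ltxx.
- by split; apply/eqP; rewrite eq_le -?e ?b1 ?b2 ?k1 ?k3 // e ?k1 ?k3 // -e ?b1 ?b2.
- by have := lt_le_trans h (le_trans b1 k1); rewrite ltxx.
Qed.

(** Either the tile at [a] would overhang the next corner, or a wall shuffle requires an undrawn
    tile first. *)
Definition blocked_right (a : item) (q : seq item) := exists2 u, corner_tile a u &
  (exists b q', q = b :: q' /\ il b < rgt (tile T u)) \/ (exists2 p, p \notin dr & prec_v T p u).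

Definition blocked_left (p : seq item) (a : item) := exists2 u, corner_tile a u &
  (exists p' b, p = p' ++ [:: b] /\ ib b < top (tile T u)) \/ (exists2 p, p \notin dr & prec_h T p u).

Lemma first_unblocked a q : gaps s = a :: q -> ~ blocked_left [::] a.
Proof.
move=> E [u [u1 _] [[p' [b [e _]]]|[p pd [W [_ _ _ _ h]]]]]; first by case: (p') e.
have [h0 [hg h1 _]] := st_undrawn st pd; have ss := st_sorted st; rewrite E in ss hg.
have xp := tile_x tT p.
by case: (@gaps_order [::] a q h0 ss hg) => [[]//|e|[_ /andP[lt _]]]; [rewrite e in h1|]; rlra.
Qed.

Lemma last_unblocked p a : gaps s = p ++ [:: a] -> ~ blocked_right a [::].
Proof.
move=> E [u [_ u1] [[b [q' [//]]]|[p0 pd [W [_ _ _ _ h]]]]].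
have [h0 [hg _ h1]] := st_undrawn st pd; have ss := st_sorted st; rewrite E in ss hg.
have yp := tile_y tT p0.
by case: (@gaps_order p a [::] h0 ss hg) => [[_ /andP[_ lt]]|e|[]//]; [|rewrite e in h1]; rlra.
Qed.

(** If [u] overhangs [b] and [u'] rises above the level of [a], they overlap. A tile blocking
    through a wall shuffle is undrawn, and the corner below and to the left of it can only be the
    other of the two corners. Squeezed between them, it coincides with [u] or [u'], contradicting
    the sides of that tile or making [u] and [u'] touch in a corner only. *)
Lemma consecutive_unblocked p a b q : gaps s = p ++ a :: b :: q ->
  blocked_right a (b :: q) -> blocked_left (p ++ [:: a]) b -> False.
Proof.
move=> E [u cu Hr] [u' cu' Hl]; have [u1 u2] := cu; have [u3 u4] := cu'.
have ss := st_sorted st; rewrite E in ss.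
have xx := tile_x tT; have yy := tile_y tT.
have /andP[ab1 ab2] : gap_lt a b.
  by move: ss; rewrite pairwise_cat /= => /and3P[_ _ /andP[/andP[h _] _]].
have posA h : h \in gaps s -> il h < il b -> (h = a \/ ib a < ib h).
  rewrite E => hg lt; have ss' := ss; rewrite -cat1s catA in ss' hg.
  case: (gaps_order ss' hg) => [[hp _]|e|[_ /andP[h1 _]]]; [|by rewrite e ltxx in lt|rlra].
  rewrite mem_cat inE in hp; case/orP: hp => [hp|/eqP]; last by left.
  by case: (gaps_sides ss) => [/(_ _ hp)/andP[_ ?] _]; right.
have posB h : h \in gaps s -> ib h < ib a -> (h = b \/ il b < il h).
  rewrite E => hg lt; case: (gaps_order ss hg) => [[_ /andP[_ h1]]|e|[hq _]]; [rlra|by rewrite e ltxx in lt|].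
  have ss' := ss; rewrite -cat1s catA in ss'.
  rewrite inE in hq; case/orP: hq => [/eqP|hq]; first by left.
  by case: (gaps_sides ss') => [_ /(_ _ hq)/andP[? _]]; right.
have [xu xu' yu yu'] := And4 (xx u) (xx u') (yy u) (yy u').
have HL2 : top (tile T u') <= ib a -> exists p2, [/\ rgt (tile T p2) <= lft (tile T u'),
    top (tile T u') = ib a, bot (tile T p2) = ib a & il a <= lft (tile T p2)].
  move=> tu'; case: Hl => [[p' [b' [e lt]]]|[p2 pd [W2 [w1 _ w3 w4 w5]]]].
    have eb : b' = a by have := congr1 (last a) e; rewrite !last_cat.
    by rewrite eb in lt; rlra.
  have [h2 [hg h3 h4]] := st_undrawn st pd.
  have [v1 _ _] := bottom_edge_sub tT w1 w3; have [v2 _ _] := top_edge_sub tT w1 w4.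
  have xp := xx p2; exists p2.
  have [e|lt] := posA _ hg ltac:(rlra); last by rlra.
  by rewrite e in h3 h4; split=> //; rlra.
case: (ltP (il b) (rgt (tile T u))) => r1.
  case: (ltP (ib a) (top (tile T u'))) => l1.
    by have e : u = u' by [apply: (overlap tT); rlra]; rewrite e in u1; rlra.
  have [p2 [w1 w2 w3 w4]] := HL2 l1.
  have [xp yp] := conj (xx p2) (yy p2).
  by have e : u = p2 by [apply: (overlap tT); rlra]; rewrite e in r1; rlra.
case: Hr => [[b' [q' [[<- _] lt]]]|[p0 pd [W [w1 w2 w3 w4 w5]]]]; first rlra.
have [v1 _ _] := right_edge_sub tT w1 w3; have [v2 _ _] := left_edge_sub tT w1 w4.
have [h [hg h1 h2]] := st_undrawn st pd; have [xp yp] := conj (xx p0) (yy p0).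
have [hb|lt] := posB _ hg ltac:(rlra); last by rlra.
rewrite hb in h1 h2.
have same : bot (tile T p0) < top (tile T u') -> u' = p0 by move=> ?; apply: (overlap tT); rlra.
case: (ltP (ib a) (top (tile T u'))) => l1.
  by have e := same ltac:(rlra); rewrite e in l1; rlra.
have [_ [_ z _ _]] := HL2 l1; have e := same ltac:(rlra); rewrite -e in w4.
by have [v3 _ _] := left_edge_sub tT w1 w4; apply: (no_touch_down gT (etrans v1 (esym v3))); rewrite u2 z.
Qed.

Lemma select_gap : (size dr < n)%N -> exists s1 g s2 u, [/\ s = s1 ++ g :: s2, g.1 = n,
  u \notin dr, corner_tile g u &
  [/\ top (tile T u) <= last FT [seq ib b | b <- gaps s1],
      rgt (tile T u) <= head FR [seq il b | b <- gaps s2],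
      forall p, prec_v T p u -> p \in dr & forall p, prec_h T p u -> p \in dr]].
Proof.
move=> sn.
have [k kd] : exists k, k \notin dr.
  apply: contrapT => H; have : (#|'I_n| <= size dr)%N.
    rewrite -(card_uniqP (st_uniq st)); apply/subset_leq_card/fintype.subsetP=> k _.
    by apply/negPn/negP=> kd; apply: H; exists k.
  by rewrite card_ord leqNgt sn.
have gne : gaps s <> [::] by have [a [ag _ _]] := st_undrawn st kd; move=> e; rewrite e in ag.
have [p [a [q [E nl nr]]]] := unblocked gne first_unblocked last_unblocked consecutive_unblocked.
have [s1 [s2 [sE e1 e2]]] := filter_split E.
have ag : a \in gaps s by rewrite E mem_cat mem_head orbT.
have [u ud cu] := corner_tile_ex ag.
have an : a.1 = n by move: ag; rewrite mem_filter => /andP[/eqP].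
exists s1, a, s2, u; split=> //; rewrite {1}/gaps {1}/gaps e1 e2; split.
- case/lastP: p E nl e1 => [|p b] E nl e1; first by have [_ _ _] := tile_in_frame tT u.
  rewrite map_rcons last_rcons leNgt; apply/negP=> lt; apply: nl; exists u => //.
  by left; exists p, b; rewrite cats1.
- case: q E nr e2 => [|b q] E nr e2 /=; first by have [_] := tile_in_frame tT u.
  by rewrite leNgt; apply/negP=> lt; apply: nr; exists u => //; left; exists b, q.
- by move=> p0 pu; apply/negPn/negP=> pd; apply: nr; exists u => //; right; exists p0.
by move=> p0 pu; apply/negPn/negP=> pd; apply: nl; exists u => //; right; exists p0.
Qed.

End Select.
Section Insert.
Variables (dr : seq 'I_n) (s1 s2 : seq item) (g : item) (u : 'I_n).
Hypothesis st : state dr (s1 ++ g :: s2).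
Hypothesis gn : g.1 = n.
Hypothesis ud : u \notin dr.
Hypothesis cu : corner_tile g u.
Let top1 := last FT [seq ib b | b <- gaps s1].
Let rgt2 := head FR [seq il b | b <- gaps s2].
Hypothesis tu : top (tile T u) <= top1.
Hypothesis ru : rgt (tile T u) <= rgt2.
Hypothesis pv : forall p, prec_v T p u -> p \in dr.
Hypothesis ph : forall p, prec_h T p u -> p \in dr.

(** If [u] rises exactly to the level of the preceding corner, the staircase has no new corner above
    [u]; the same holds for [post] on the right. *)
Let pre : seq item := if top (tile T u) < top1 then [:: gap (il g) (top (tile T u))] else [::].
Let post : seq item := if rgt (tile T u) < rgt2 then [:: gap (rgt (tile T u)) (ib g)] else [::].
Let iu : item := titem (size dr) u.
Let s' := s1 ++ (pre ++ iu :: post) ++ s2.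

Let sn : (size dr < n)%N.
Proof.
have uq : uniq (u :: dr) by rewrite /= ud (st_uniq st).
have : (size (u :: dr) <= #|'I_n|)%N.
  by rewrite -(card_uniqP uq); apply/subset_leq_card/fintype.subsetP.
by rewrite card_ord.
Qed.

Let gapsE : gaps (s1 ++ g :: s2) = gaps s1 ++ g :: gaps s2.
Proof. by rewrite /gaps filter_cat /= gn eqxx. Qed.

Let gaps_pre : gaps pre = pre.
Proof. by rewrite /pre; case: ifP => _ //; rewrite /gaps /= eqxx. Qed.

Let gaps_post : gaps post = post.
Proof. by rewrite /post; case: ifP => _ //; rewrite /gaps /= eqxx. Qed.

Let gapsE' : gaps s' = gaps s1 ++ pre ++ post ++ gaps s2.
Proof.
rewrite /s' /gaps !filter_cat /= (ltn_eqF sn) -/(gaps pre) -/(gaps post) gaps_pre gaps_post.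
by rewrite -!catA.
Qed.

Let ssort := st_sorted st.

Let before_g b : b \in gaps s1 -> il b < il g /\ ib g < ib b /\ top1 <= ib b.
Proof.
move=> bs; have [h1 _] := gaps_sides (etrans (congr1 (pairwise gap_lt) (esym gapsE)) ssort).
have /andP[l1 l2] := h1 _ bs; split=> //; split=> //.
move: bs ssort h1; rewrite /top1 gapsE; case/lastP: (gaps s1) => [//|w c] bs ss _.
rewrite map_rcons last_rcons; move: bs; rewrite mem_rcons inE => /orP[/eqP -> //|bw].
move: ss; rewrite -cats1 -catA /= => /gaps_sides[h _].
by have /andP[_ /ltW] := h _ bw.
Qed.

Let after_g b : b \in gaps s2 -> il g < il b /\ ib b < ib g /\ rgt2 <= il b.
Proof.
move=> bs; have [_ h1] := gaps_sides (etrans (congr1 (pairwise gap_lt) (esym gapsE)) ssort).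
have /andP[l1 l2] := h1 _ bs; split=> //; split=> //.
move: bs ssort h1; rewrite /rgt2 gapsE; case: (gaps s2) => [//|c w] bs ss _ /=.
move: bs; rewrite inE => /orP[/eqP -> //|bw].
move: ss; rewrite -cat1s catA => /gaps_sides[_ h].
by have /andP[/ltW] := h _ bw.
Qed.

Let time_ok b : b \in s1 ++ g :: s2 -> ((b.1 < size dr) || (b.1 == n))%N.
Proof.
move=> bs; case: (boolP (b.1 == n)) => bn; first by rewrite orbT.
have : b.1 \in [seq a.1 | a <- s1 ++ g :: s2 & a.1 != n] by apply: map_f; rewrite mem_filter bn.
by rewrite (perm_mem (st_time st)) mem_iota add0n => /andP[_ ->].
Qed.

(** Two corners with no drawn tile between them read their coordinate from the same tile. Hence
    distinct coordinates force a drawn tile in between, as [insert_ok] requires. *)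
Let no_gap_no_tile (l r : item -> R) x y a1 a2 :
  sides_ok (fun a : item => a.1) n l r x y (a1 ++ g :: a2) ->
  (forall h, h \in a2 -> h.1 = n -> l h <> l g) ->
  forall p h q, a2 = p ++ h :: q -> h.1 = n -> has (fun b : item => b.1 < n)%N p.
Proof.
move=> ok ne p h q E hn; apply/negPn/negP => nh.
have [e1 _] := ok a1 g a2 erefl.
have [e2 _] := ok (a1 ++ g :: p) h q ltac:(by rewrite E -catA).
apply: (ne h) => //; first by rewrite E mem_cat mem_head orbT.
rewrite e2 e1 gn hn filter_cat /= gn ltnn.
have -> : [seq b <- p | (b.1 < n)%N] = [::] by apply/eqP; rewrite -[_ == _]negbK -has_filter.
by rewrite cats0.
Qed.

Lemma insert_x : sides_ok (fun a : item => a.1) n il ir FL FR s'.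
Proof.
have ok := st_x st.
apply: (insert_ok ok gn (u := iu) (i := size dr)) => //.
- by apply/allP=> b bs; apply: time_ok; rewrite mem_cat bs.
- by apply/allP=> b bs; apply: time_ok; rewrite mem_cat inE bs !orbT.
- rewrite /pre; case: ifP => _; [right|by left].
  by exists (gap (il g) (top (tile T u))).
- rewrite /post; case: ltP => h; [right|left].
    by exists (gap (rgt (tile T u)) (ib g)).
  by split=> //; apply/eqP; rewrite eq_le ru h.
- by case: cu.
apply: (no_gap_no_tile ok) => h hs hn e.
have /after_g[lt _] : h \in gaps s2 by rewrite mem_filter hn eqxx.
by rewrite e ltxx in lt.
Qed.

Lemma insert_y : sides_ok (fun a : item => a.1) n ib it FB FT (rev s').
Proof.
have ok := st_y st; rewrite rev_cat rev_cons cat_rcons in ok.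
have -> : rev s' = rev s2 ++ (rev post ++ iu :: rev pre) ++ rev s1.
  by rewrite /s' !rev_cat rev_cons cat_rcons -!catA.
apply: (insert_ok ok gn (u := iu) (i := size dr)) => //.
- by apply/allP=> b; rewrite mem_rev => bs; apply: time_ok; rewrite mem_cat inE bs !orbT.
- by apply/allP=> b; rewrite mem_rev => bs; apply: time_ok; rewrite mem_cat bs.
- rewrite /post; case: ifP => _; [right|by left].
  by exists (gap (rgt (tile T u)) (ib g)).
- rewrite /pre; case: ltP => h; [right|left].
    by exists (gap (il g) (top (tile T u))).
  split=> //; rewrite filter_rev map_rev.
  by rewrite head_rev; apply/eqP; rewrite eq_le tu h.
- by case: cu.
apply: (no_gap_no_tile ok) => h; rewrite mem_rev => hs hn e.
have /before_g[_ [lt _]] : h \in gaps s1 by rewrite mem_filter hn eqxx.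
by rewrite e ltxx in lt.
Qed.

Lemma mem_gaps' b : b \in gaps s' ->
  [\/ b \in gaps s1, top (tile T u) < top1 /\ b = gap (il g) (top (tile T u)),
      rgt (tile T u) < rgt2 /\ b = gap (rgt (tile T u)) (ib g) | b \in gaps s2].
Proof.
rewrite gapsE' !mem_cat => /or4P[h|h|h|h]; [by constructor 1| | |by constructor 4].
  by move: h; rewrite /pre; case: ifP => // lt; rewrite inE => /eqP ->; constructor 2.
by move: h; rewrite /post; case: ifP => // lt; rewrite inE => /eqP ->; constructor 3.
Qed.

Lemma undrawn_sep k : k <> u -> il g <= lft (tile T k) -> ib g <= bot (tile T k) ->
  rgt (tile T u) <= lft (tile T k) \/ top (tile T u) <= bot (tile T k).
Proof.
move=> ku h1 h2; case: (leP (rgt (tile T u)) (lft (tile T k))) => h3; first by left.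
right; rewrite leNgt; apply/negP=> h4; apply: ku; apply: (overlap tT) => //.
  by case: cu => -> _; apply: le_lt_trans h1 (tile_x tT k).
by case: cu => _ ->; apply: le_lt_trans h2 (tile_y tT k).
Qed.

Let gg : g \in gaps (s1 ++ g :: s2).
Proof. by rewrite gapsE mem_cat mem_head orbT. Qed.

Lemma undrawn' k : k \notin rcons dr u ->
  exists a, [/\ a \in gaps s', il a <= lft (tile T k) & ib a <= bot (tile T k)].
Proof.
rewrite mem_rcons inE negb_or => /andP[/eqP ku kd].
have [a [ag a1 a2]] := st_undrawn st kd.
have m1 b : b \in gaps s1 -> b \in gaps s' by rewrite gapsE' !mem_cat => ->.
have m2 b : b \in gaps s2 -> b \in gaps s' by rewrite gapsE' !mem_cat => ->; rewrite !orbT.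
have [xk yk] := conj (tile_x tT k) (tile_y tT k).
have [f1 f2 f3 f4] := tile_in_frame tT k.
move: ag; rewrite gapsE mem_cat inE => /or3P[h|/eqP e|h]; [by exists a; split=> //; apply: m1| |
  by exists a; split=> //; apply: m2].
rewrite e in a1 a2.
case: (undrawn_sep ku a1 a2) => h.
  case: (ltP (rgt (tile T u)) rgt2) => lt.
    exists (gap (rgt (tile T u)) (ib g)); split=> //.
    by rewrite gapsE' /post lt !mem_cat mem_head !orbT.
  move: lt m2; rewrite /rgt2; case: (gaps s2) after_g => [|b w] ag /= lt m2.
    by have := le_lt_trans (le_trans lt h) xk; rewrite ltNge f2.
  exists b; split; [by apply: m2; rewrite mem_head|exact: le_trans lt h|].
  have [_ [lt' _]] := ag b (mem_head _ _).
  exact: le_trans (ltW lt') a2.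
case: (ltP (top (tile T u)) top1) => lt.
  exists (gap (il g) (top (tile T u))); split=> //.
  by rewrite gapsE' /pre lt !mem_cat mem_head !orbT.
move: lt m1; rewrite /top1; case/lastP: (gaps s1) before_g => [|w b] ag /= lt m1.
  by have := le_lt_trans (le_trans lt h) yk; rewrite ltNge f4.
rewrite map_rcons last_rcons in lt.
have bw : b \in rcons w b by rewrite mem_rcons mem_head.
exists b; split; [exact: m1| |exact: le_trans lt h].
by have [lt' _] := ag b bw; apply: le_trans (ltW lt') a1.
Qed.

(** An undrawn [v] would lie above and to the right of some corner. At [g] it would overlap [u]; the
    other corners are out of reach because [u] stays below the preceding ones and left of the
    following ones. *)
Lemma drawn_below v : v <> u -> lft (tile T v) < rgt (tile T u) ->
  bot (tile T v) < top (tile T u) -> v \in dr.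
Proof.
move=> vu h1 h2; apply/negPn/negP=> vd.
have [a [ag a1 a2]] := st_undrawn st vd.
move: ag; rewrite gapsE mem_cat inE => /or3P[h|/eqP e|h].
- have [_ [_ l]] := before_g h.
  by have := lt_le_trans (le_lt_trans a2 h2) (le_trans tu l); rewrite ltxx.
- rewrite e in a1 a2; case: (undrawn_sep vu a1 a2); first by rewrite leNgt h1.
  by rewrite leNgt h2.
have [_ [_ l]] := after_g h.
by have := lt_le_trans (le_lt_trans a1 h1) (le_trans ru l); rewrite ltxx.
Qed.

Lemma sorted' : pairwise gap_lt (gaps s').
Proof.
have [xu yu] := conj (tile_x tT u) (tile_y tT u); have [u1 u2] := cu.
have ss := ssort; rewrite gapsE pairwise_cat allrel_consr /= in ss.
case/and4P: ss => /andP[_ r12] p1 _ p2.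
have pre_in b : b \in pre -> top (tile T u) < top1 /\ b = gap (il g) (top (tile T u)).
  by rewrite /pre; case: ifP => // lt; rewrite inE => /eqP ->.
have post_in b : b \in post -> rgt (tile T u) < rgt2 /\ b = gap (rgt (tile T u)) (ib g).
  by rewrite /post; case: ifP => // lt; rewrite inE => /eqP ->.
have pre1 : pairwise gap_lt pre by rewrite /pre; case: ifP.
have post1 : pairwise gap_lt post by rewrite /post; case: ifP.
rewrite gapsE' !pairwise_cat p1 p2 pre1 post1 !allrel_catr r12 !andbT /=.
have xg : il g < rgt (tile T u) by rewrite -u1.
have yg : ib g < top (tile T u) by rewrite -u2.
repeat (apply/andP; split); apply/allrelP => a b.
- move=> /before_g[l1 [l2 l3]] /pre_in[lt ->]; rewrite /gap_lt /il /= l1 /ib /=.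
  exact: lt_le_trans lt l3.
- move=> /before_g[l1 [l2 l3]] /post_in[lt ->]; rewrite /gap_lt /il /ib /= l2 andbT.
  exact: lt_trans l1 xg.
- move=> /pre_in[lt ->] /post_in[lt' ->]; rewrite /gap_lt /il /ib /= in xg yg *.
  by rewrite xg yg.
- move=> /pre_in[lt ->] /after_g[l1 [l2 l3]]; rewrite /gap_lt /il /ib /= in l1 l2 l3 yg *.
  by rewrite l1 (lt_trans l2 yg).
- move=> /post_in[lt ->] /after_g[l1 [l2 l3]]; rewrite /gap_lt /il /ib /= in l1 l2 l3 lt *.
  by rewrite (lt_le_trans lt l3) l2.
Qed.

Lemma frame' a : a \in gaps s' -> FL <= il a < FR /\ FB <= ib a < FT.
Proof.
have [/andP[g1 g2] /andP[g3 g4]] := st_frame st gg.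
have [xu yu] := conj (tile_x tT u) (tile_y tT u); have [u1 u2] := cu.
have in1 b : b \in gaps s1 -> FL <= il b < FR /\ FB <= ib b < FT.
  by move=> h; apply: (st_frame st); rewrite gapsE mem_cat h.
have in2 b : b \in gaps s2 -> FL <= il b < FR /\ FB <= ib b < FT.
  by move=> h; apply: (st_frame st); rewrite gapsE mem_cat inE h !orbT.
case/mem_gaps' => [/in1//|[lt ->]|[lt ->]|/in2//]; rewrite /il /ib /= in g1 g2 g3 g4 u1 u2 *.
- split; first by rewrite g1 g2.
  have -> /= : FB <= top (tile T u) by apply: le_trans g3 _; rewrite -u2 ltW.
  apply: lt_le_trans lt _; rewrite /top1; case/lastP: (gaps s1) in1 => [//|w b] in1.
  rewrite map_rcons last_rcons; apply: ltW.
  by have [_ /andP[]] := in1 b ltac:(by rewrite mem_rcons mem_head).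
split; last by rewrite g3 g4.
have -> /= : FL <= rgt (tile T u) by apply: le_trans g1 _; rewrite -u1 ltW.
apply: lt_le_trans lt _; rewrite /rgt2; case: (gaps s2) in2 => [//|b w] in2 /=.
by apply: ltW; have [/andP[]] := in2 b (mem_head _ _).
Qed.

Lemma drawn' k a : k \in rcons dr u -> a \in gaps s' ->
  rgt (tile T k) <= il a \/ top (tile T k) <= ib a.
Proof.
have [xu yu] := conj (tile_x tT u) (tile_y tT u); have [u1 u2] := cu.
have in1 b : b \in gaps s1 -> b \in gaps (s1 ++ g :: s2) by rewrite gapsE mem_cat => ->.
have in2 b : b \in gaps s2 -> b \in gaps (s1 ++ g :: s2).
  by rewrite gapsE mem_cat inE => ->; rewrite !orbT.
rewrite mem_rcons inE => /orP[/eqP ->|kd] /mem_gaps'.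
  case=> [/before_g[_ [_ l]]|[_ ->]|[_ ->]|/after_g[_ [_ l]]].
  - by right; apply: le_trans tu l.
  - by right; rewrite /ib /=.
  - by left; rewrite /il /=.
  by left; apply: le_trans ru l.
case=> [/in1 h|[_ ->]|[_ ->]|/in2 h]; try exact: (st_drawn st kd h).
  case: (st_drawn st kd gg) => h; [by left|right]; apply: le_trans h _.
  by rewrite /ib /= in u2 yu *; rewrite -u2 ltW.
case: (st_drawn st kd gg) => h; [left|by right]; apply: le_trans h _.
by rewrite /il /= in u1 xu *; rewrite -u1 ltW.
Qed.

Lemma state_insert : state (rcons dr u) s'.
Proof.
split.
- by rewrite rcons_uniq ud (st_uniq st).
- have f0 w : gaps w = w -> [seq a.1 | a <- w & a.1 != n] = [::].
    by move=> <-; rewrite /gaps -filter_predI; elim: w => //= b w; case: (b.1 == n).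
  have := st_time st; rewrite filter_cat map_cat /= gn eqxx /= => H.
  rewrite size_rcons -addn1 iotaD add0n /s' !filter_cat !map_cat /= (ltn_eqF sn) /=.
  rewrite (f0 _ gaps_pre) (f0 _ gaps_post) /= -cat1s perm_catCA /= perm_sym.
  by rewrite perm_catC /= perm_cons perm_sym.
- move=> a; rewrite /s' !mem_cat inE.
  have not_gap w : gaps w = w -> a \in w -> a.1 != n -> False.
    by move=> <-; rewrite mem_filter => /andP[->].
  have old : a \in s1 ++ g :: s2 -> a.1 != n -> a = titem a.1 (nth k0 (rcons dr u) a.1).
    move=> h an; have := time_ok h; rewrite (negbTE an) orbF => lt.
    by rewrite nth_rcons lt; apply: (st_tile st).
  case/or3P=> [h an|/or3P[h an|/eqP -> _|h an]|h an].
  + by apply: old => //; rewrite mem_cat h.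
  + by case: (not_gap _ gaps_pre h an).
  + by rewrite /iu /= nth_rcons ltnn eqxx.
  + by case: (not_gap _ gaps_post h an).
  by apply: old => //; rewrite mem_cat inE h !orbT.
- exact: insert_x.
- exact: insert_y.
- exact: sorted'.
- exact: frame'.
- by move=> k a; apply: drawn'.
- exact: undrawn'.
move=> v p; rewrite mem_rcons inE => /orP[/eqP ->|vd] pr.
  have pd : p \in dr.
    by case: pr => [/pv|/ph|[pu h1 h2]] //; apply: drawn_below.
  rewrite -cats1 !index_cat pd (negbTE ud) /= eqxx addn0.
  by rewrite index_mem.
have lt := st_prec st vd pr.
have pd : p \in dr by rewrite -index_mem (leq_trans lt) // index_size.
by rewrite -cats1 !index_cat pd vd.
Qed.

End Insert.

Lemma states m : (m <= n)%N -> exists dr s, state dr s /\ size dr = m.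
Proof.
elim: m => [_|m IH mn]; first by exists [::], [:: gap FL FB]; split=> //; apply: state0.
have [dr [s [st sm]]] := IH (ltnW mn).
have [|s1 [g [s2 [u [sE gn ud cu [h1 h2 h3 h4]]]]]] := select_gap st; first by rewrite sm.
rewrite sE in st.
have st' := state_insert st gn ud cu h1 h2 h3 h4.
by eexists; eexists; split; [exact: st'|rewrite size_rcons sm].
Qed.

End Drawing.


Definition renumber (R : realType) n (T : layout R n) (s : 'S_n) : layout R n :=
  Layout (frame T) (fun k => tile T (s k)).

Lemma index_one_line n (x : 'S_n) k : index k (one_line x) = x^-1%g k.
Proof.
rewrite -{1}(permKV x k) /one_line index_map; last exact: perm_inj.
by rewrite index_enum_ord.
Qed.

Lemma last_rev (A : Type) (x : A) s : last x (rev s) = head x s.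
Proof. by rewrite -head_rev revK. Qed.

Lemma head_map' (A B : Type) (f : A -> B) x s : head (f x) (map f s) = f (head x s).
Proof. by case: s. Qed.

Section Realize.
Variables (R : realType) (n : nat) (T : layout R n).
Hypothesis gT : generic_tiling T.
Hypothesis n0 : (0 < n)%N.
Let tT : tiling T. Proof. by case: gT. Qed.

Lemma box_eq (a b : box R) : lft a = lft b -> rgt a = rgt b -> bot a = bot b ->
  top a = top b -> a = b.
Proof. by case: a b => [? ? ? ?] [? ? ? ?] /= -> -> -> ->. Qed.

Lemma realization : exists (x s : 'S_n) X Z, renumber T s = mk n (before x) X Z /\
  forall p u, prec T (s p) (s u) -> before x p u.
Proof.
have [dr [l [st sz]]] := states gT (Ordinal n0) (leqnn n).
have all_dr k : k \in dr.
  have : dr =i 'I_n.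
    apply/subset_cardP; last by apply/fintype.subsetP.
    by rewrite (card_uniqP (st_uniq st)) sz card_ord.
  by move=> ->.
have ng : gaps n l = [::].
  case E : (gaps n l) => [//|a w].
  have ag : a \in gaps n l by rewrite E mem_head.
  by have [k kd _] := corner_tile_ex gT st ag; rewrite all_dr in kd.
have allt a : a \in l -> a.1 != n.
  move=> al; apply/negP=> an; have : a \in gaps n l by rewrite mem_filter an al.
  by rewrite ng.
have pm := st_time st; rewrite (eq_in_filter (a2 := predT)) ?filter_predT ?sz in pm; last first.
  by move=> a /allt ->.
set ts := map _ l in pm.
have sts : size ts = n by rewrite (perm_size pm) size_iota.
have sl : size l = n by rewrite -sts size_map.
have uts : uniq ts by rewrite (perm_uniq pm) iota_uniq.
have tlt k : (k < n)%N -> (nth 0%N ts k < n)%N.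
  move=> kn; have : nth 0%N ts k \in iota 0 n by rewrite -(perm_mem pm) mem_nth ?sts.
  by rewrite mem_iota.
(* The position in the list is the number of a tile, and [y] maps it to the drawing time, so the
   word is [y^-1]; [s] below returns the name of that tile in [T]. *)
pose yf (k : 'I_n) := Ordinal (tlt k (ltn_ord k)).
have yi : injective yf.
  move=> i j /(congr1 val) /= /eqP; rewrite nth_uniq ?sts // => /eqP.
  exact: val_inj.
pose y := perm yi.
have si : injective (fun k => nth (Ordinal n0) dr (y k)).
  move=> i j /eqP; rewrite nth_uniq ?sz //; last exact: st_uniq st.
  by move=> /eqP/val_inj/perm_inj.
pose s := perm si.
pose d : item R := gap n 0 0.
have lE (k : 'I_n) : nth d l k = titem T (y k) (s k).
  have kl : nth d l k \in l by rewrite mem_nth ?sl.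
  have tE : (nth d l k).1 = y k by rewrite permE /= /ts (nth_map d) ?sl.
  by rewrite (st_tile st kl (allt _ kl)) tE /s permE.
have bE (i j : nat) : (i < n)%N -> (j < n)%N ->
    before y^-1%g i j = ((nth d l i).1 < (nth d l j).1)%N.
  move=> iN jN; rewrite (beforeE _ (Ordinal iN) (Ordinal jN)) !index_one_line invgK.
  by rewrite (lE (Ordinal iN)) (lE (Ordinal jN)).
have bT := before_order y^-1%g.
have splitE k : (k < n)%N -> l = [seq nth d l j | j <- iota 0 k] ++ nth d l k ::
    [seq nth d l j | j <- iota k.+1 (n - k.+1)].
  move=> kn; rewrite -[LHS](mkseq_nth d) sl /mkseq.
  have {1}-> : n = (k + (n - k.+1).+1)%N by lia.
  by rewrite iotaD map_cat.
have xs : exists X, [/\ X 0%N = lft (frame T), X n = rgt (frame T) &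
    forall k, (k < n)%N -> il (nth d l k) = X (lo (before y^-1%g) k) /\
      ir (nth d l k) = X (hi n (before y^-1%g) k)].
  apply: coords_of_sides => // k kn; have [h1 h2] := st_x st (splitE k kn).
    rewrite {}h1 filter_map -map_comp; congr (last _ (map _ _)); apply: eq_in_filter => j.
    by rewrite mem_iota => jk; rewrite bE //; lia.
  have tn : ((nth d l k).1 < n)%N by rewrite (lE (Ordinal kn)) /=.
  rewrite {}h2 // filter_map -map_comp; congr (head _ (map _ _)); apply: eq_in_filter => j.
  by rewrite mem_iota => jk; rewrite bE //; lia.
have ys : exists Z, [/\ Z 0%N = - top (frame T), Z n = - bot (frame T) &
    forall k, (k < n)%N -> - it (nth d l k) = Z (lo (flip (before y^-1%g)) k) /\
      - ib (nth d l k) = Z (hi n (flip (before y^-1%g)) k)].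
  apply: coords_of_sides => //; first exact: torder_flip.
    move=> k kn; have tn : ((nth d l k).1 < n)%N by rewrite (lE (Ordinal kn)) /=.
    have E := congr1 rev (splitE k kn); rewrite rev_cat rev_cons cat_rcons in E.
    have [_ h2] := st_y st E; rewrite {}h2 // filter_rev map_rev head_rev -[LHS]last_map.
    rewrite filter_map -!map_comp; congr (last _ (map _ _)); apply: eq_in_filter => j.
    by rewrite mem_iota => jk; rewrite /flip bE //; lia.
  move=> k kn; have E := congr1 rev (splitE k kn); rewrite rev_cat rev_cons cat_rcons in E.
  have [h1 _] := st_y st E; rewrite {}h1 filter_rev map_rev last_rev -[LHS]head_map'.
  rewrite filter_map -!map_comp; congr (head _ (map _ _)); apply: eq_in_filter => j.
  by rewrite mem_iota => jk; rewrite /flip bE //; lia.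
have [X [X0 Xn XE]] := xs; have [Z [Z0 Zn ZE]] := ys.
exists y^-1%g, s, X, Z; split=> [|p u pr].
  rewrite /renumber /mk; congr Layout.
    by apply: box_eq; rewrite /= ?X0 ?Xn ?Z0 ?Zn ?opprK.
  apply: funext => k; have [x1 x2] := XE k (ltn_ord k); have [z1 z2] := ZE k (ltn_ord k).
  by apply: box_eq; rewrite /= -?x1 -?x2 -?z1 -?z2 lE ?opprK.
have := st_prec st (all_dr (s u)) pr.
by rewrite beforeE !index_one_line invgK !permE !index_uniq ?sz // (st_uniq st).
Qed.

End Realize.

(** * Invariance under slides *)

Section Absorb.
Variables (R : realType) (n : nat).
Implicit Types (T : layout R n) (W : box R).

(** The union of two collinear segments with a common point is again a segment avoiding all
    interiors, so maximality of [W'] applies to it. *)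
Lemma wall_absorb T W W' p : vertical W -> pts W `<=` pts (frame T) -> avoids_interiors T W ->
  wall T W' -> vertical W' -> pts W p -> pts W' p -> pts W `<=` pts W'.
Proof.
move=> [v1 v2] fW aW [_ fW' aW' _ mW'] [v3 v4] [/andP[p1 p2] /andP[p3 p4]] [/andP[p5 p6] /andP[p7 p8]].
pose U := Box (lft W) (lft W) (Num.min (bot W) (bot W')) (Num.max (top W) (top W')).
have UE q : pts U q -> pts W q \/ pts W' q.
  case=> /= /andP[q1 q2] /andP[q3 q4].
  have qx : lft W' <= q.1 <= rgt W' by lra.
  have qx' : lft W <= q.1 <= rgt W by lra.
  case: (leP (bot W) q.2) => h1; case: (leP q.2 (top W)) => h2.
  - by left; split=> //; apply/andP.
  - right; split=> //; move: q4; rewrite le_max leNgt h2 /= => ->.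
    by rewrite andbT; lra.
  - right; split=> //; move: q3; rewrite ge_min leNgt h1 /= => ->; lra.
  - by lra.
have WU q : pts W q -> pts U q.
  case=> /andP[q1 q2] /andP[q3 q4]; split=> /=; first lra.
  by rewrite ge_min le_max q3 q4.
have WU' q : pts W' q -> pts U q.
  case=> /andP[q1 q2] /andP[q3 q4]; split=> /=; first lra.
  by rewrite ge_min le_max q3 q4 !orbT.
have UW' : pts U `<=` pts W'.
  apply: mW' => //.
  - by left; split=> //=; case: (leP (bot W) (bot W')); case: (leP (top W) (top W')); lra.
  - by move=> q /UE[/fW|/fW'].
  - move=> i; rewrite -subset0 => q [qi /UE[] qW].
      by rewrite -(aW i).
    by rewrite -(aW' i).
by move=> q /WU/UW'.
Qed.

End Absorb.

Section WallEnds.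
Variables (R : realType) (n : nat) (bf : rel nat) (X Z : nat -> R).
Hypothesis bfT : torder n bf.
Hypothesis gT : generic_tiling (mk n bf X Z).
Let T := mk n bf X Z.
Local Notation bf' := (flip bf).
Let tT : tiling T. Proof. by case: gT. Qed.
Let wZ : increasing_sides n bf' Z. Proof. by case: (tiling_sides tT). Qed.

Variable W : box R.
Hypothesis wW : wall T W.
Hypothesis vW : vertical W.

Let vwallE m p : (0 < m < n)%N -> bf m.-1 m -> pts W p -> pts (vwall n bf X Z m) p ->
  [/\ pts (vwall n bf X Z m) `<=` pts W, - Z (hi n bf' m.-1) <= bot W & top W <= - Z (lo bf' m)].
Proof.
move=> mn bm pW pV; have [_ fW aW _ _] := wW.
have sub := wall_absorb vW fW aW (vwall_wall bfT gT mn bm) (vwall_vertical bfT gT mn bm) pW pV.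
have [v1 v2] := vW; split.
- exact: wall_absorb (vwall_vertical bfT gT mn bm) (vwall_in_frame bfT gT mn bm)
    (vwall_avoids bfT gT mn bm) wW vW pV pW.
- by have [_ /andP[]] : pts (vwall n bf X Z m) (lft W, bot W) by apply: sub; split=> /=; lra.
by have [_ /andP[]] : pts (vwall n bf X Z m) (lft W, top W) by apply: sub; split=> /=; lra.
Qed.

Let left_edge_in_vwall (e : 'I_n) m : lo bf e = m -> pts (left_edge (tile T e)) `<=` pts W ->
  [/\ (0 < m < n)%N, bf m.-1 m, pts (vwall n bf X Z m) `<=` pts W,
     - Z (hi n bf' m.-1) <= bot W & top W <= - Z (lo bf' m)].
Proof.
move=> em sub; have [_ fW _ nW _] := wW; have ye := tile_y tT e.
have [l1 _ _] := left_edge_sub tT vW sub; have [v1 v2] := vW.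
have m0 : (0 < m)%N.
  rewrite lt0n; apply/negP=> /eqP m0; apply: nW; constructor 1 => q qW.
  have [_ fq] := fW q qW; have [/andP[q1 q2] _] := qW.
  by split=> //=; move: l1; rewrite /= em m0 => l1; lra.
have [mn bm] := lo_wall bfT (ltn_ord e) em m0; have mn' : (0 < m < n)%N by rewrite m0 mn.
have pe : pts (left_edge (tile T e)) (lft (tile T e), bot (tile T e)) by split=> /=; rewrite ?lexx ?ltW.
by have [] := vwallE mn' bm (sub _ pe) (left_edge_vwall bfT gT m0 em pe).
Qed.

Let right_edge_in_vwall (e : 'I_n) m : hi n bf e = m -> pts (right_edge (tile T e)) `<=` pts W ->
  [/\ (0 < m < n)%N, bf m.-1 m, pts (vwall n bf X Z m) `<=` pts W,
     - Z (hi n bf' m.-1) <= bot W & top W <= - Z (lo bf' m)].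
Proof.
move=> em sub; have [_ fW _ nW _] := wW; have ye := tile_y tT e.
have [l1 _ _] := right_edge_sub tT vW sub; have [v1 v2] := vW.
have mn : (m < n)%N.
  rewrite ltn_neqAle -{2}em hi_le // andbT; apply/negP=> /eqP mn; apply: nW; constructor 2 => q qW.
  have [_ fq] := fW q qW; have [/andP[q1 q2] _] := qW.
  by split=> //=; move: l1; rewrite /= em mn => l1; lra.
have [m0 bm] := hi_wall bfT (ltn_ord e) em mn; have mn' : (0 < m < n)%N by rewrite m0 mn.
have pe : pts (right_edge (tile T e)) (rgt (tile T e), bot (tile T e)) by split=> /=; rewrite ?lexx ?ltW.
by have [] := vwallE mn' bm (sub _ pe) (right_edge_vwall bfT gT mn em pe).
Qed.

(** Not being the highest tile on the right, [e] exceeds the number of its wall, so its top lies on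
    the horizontal wall [e]. Its bottom is later treated as the top of the tile under it; on the
    left the roles of top and bottom are exchanged. *)
Lemma mk_right_tile_top (e : 'I_n) : pts (left_edge (tile T e)) `<=` pts W ->
  top (tile T e) < top W -> exists2 W', ends_right T W W' & bot W' = top (tile T e).
Proof.
move=> sub lt; have [/andP[m0 mn] bm _ b1 b2] := left_edge_in_vwall erefl sub.
have ze := wZ (ltn_ord e); have km : (lo bf e < e)%N.
  by rewrite ltn_neqAle lo_le andbT; apply/eqP=> E; rewrite /= -{1}E in lt; lra.
have [lk bk _] := lo_above bfT (ltn_ord e) erefl m0 km.
have kn : (0 < e < n)%N by rewrite ltn_ord (leq_ltn_trans _ km).
exists (hwall n bf X Z e); last by rewrite hwallE /= lk.
split; [exact: (hwall_wall bfT gT)|exact: (hwall_horizontal bfT gT)|].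
by apply: sub; rewrite hwallE; split; rewrite /= ?lexx //= lk in ze *; rewrite lexx; lra.
Qed.

Lemma mk_left_tile_bottom (e : 'I_n) : pts (right_edge (tile T e)) `<=` pts W ->
  bot W < bot (tile T e) -> exists2 W', ends_left T W W' & bot W' = bot (tile T e).
Proof.
move=> sub lt; have [/andP[m0 mn] bm _ b1 b2] := right_edge_in_vwall erefl sub.
have ze := wZ (ltn_ord e); have km : (e.+1 < hi n bf e)%N.
  by rewrite ltn_neqAle hi_gt // andbT; apply/eqP=> E; rewrite /= in lt; rewrite -E /= in b1; lra.
have [lk bk _] := hi_below bfT erefl mn km.
have kn : (0 < e.+1 < n)%N by rewrite /= (ltn_trans km mn).
exists (hwall n bf X Z e.+1); last by rewrite hwallE /= lk.
split; [exact: (hwall_wall bfT gT)|exact: (hwall_horizontal bfT gT)|].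
by apply: sub; rewrite hwallE; split; rewrite /= ?lexx //= lk in ze *; rewrite lexx; lra.
Qed.

Lemma mk_right_tile_bottom (e : 'I_n) : pts (left_edge (tile T e)) `<=` pts W ->
  bot W < bot (tile T e) -> exists2 W', ends_right T W W' & bot W' = bot (tile T e).
Proof.
move=> sub lt; have [mn bm subV b1 b2] := left_edge_in_vwall erefl sub.
have [le1 le2] := left_side_bounds bfT gT mn bm erefl; have [m0 _] := andP mn.
have [||k [k1 k2 k3]] := right_tile_at bfT (P := fun c => Z c <= Z (hi n bf' e)) mn bm.
- by have := wZ (ltn_ord e); rewrite /=; lra.
- by rewrite /= in lt; rewrite /= -ltNge; lra.
rewrite /= in k2; rewrite /= -ltNge in k3; have ye := tile_y tT e.
have [xk xe] := conj (tile_x tT k) (tile_x tT e); have [yW yk] := conj (proj2 vW) (tile_y tT k).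
have zE : top (tile T k) = bot (tile T e).
  by apply: (abut_below tT); rewrite /= in xk xe ye yk *; rewrite -k1 in xe;
    rewrite ?lerN2 ?ltrN2 -?k1 //; lra.
have [_ _ l2] := left_edge_sub tT vW sub.
rewrite -zE; apply: mk_right_tile_top; last by rewrite zE; apply: lt_le_trans ye l2.
by move=> p /(left_edge_vwall bfT gT m0 k1); apply: subV.
Qed.

Lemma mk_left_tile_top (e : 'I_n) : pts (right_edge (tile T e)) `<=` pts W ->
  top (tile T e) < top W -> exists2 W', ends_left T W W' & bot W' = top (tile T e).
Proof.
move=> sub lt; have [mn bm subV b1 b2] := right_edge_in_vwall erefl sub.
have [le1 le2] := right_side_bounds bfT gT mn bm erefl; have [_ mn'] := andP mn.
have [||k [k1 k2 k3]] := left_tile_at bfT (P := fun c => Z c < Z (lo bf' e)) mn bm.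
- by rewrite /= in lt; rewrite /=; lra.
- by have := wZ (ltn_ord e); rewrite /= -leNgt; lra.
rewrite /= in k2; rewrite /= -leNgt in k3; have ye := tile_y tT e.
have [xk xe] := conj (tile_x tT k) (tile_x tT e); have [yW yk] := conj (proj2 vW) (tile_y tT k).
have zE : bot (tile T k) = top (tile T e).
  by apply: (abut_above tT); rewrite /= in xk xe ye yk *; rewrite -k1 in xe;
    rewrite ?lerN2 ?ltrN2 -?k1 //; lra.
have [_ l2 _] := right_edge_sub tT vW sub.
rewrite -zE; apply: mk_left_tile_bottom; last by rewrite zE; apply: le_lt_trans l2 ye.
by move=> p /(right_edge_vwall bfT gT mn' k1); apply: subV.
Qed.

End WallEnds.

Section Renumber.
Variables (R : realType) (n : nat).
Implicit Types (T : layout R n) (W : box R) (s : 'S_n).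

Lemma renumberK T s : renumber (renumber T s) s^-1%g = T.
Proof.
case: T => f t; rewrite /renumber /=; congr Layout.
by apply: funext => k; rewrite permKV.
Qed.

Lemma renumber_avoids T s W : avoids_interiors T W -> avoids_interiors (renumber T s) W.
Proof. by move=> H i; apply: H. Qed.

Lemma renumber_avoidsE T s W : avoids_interiors (renumber T s) W <-> avoids_interiors T W.
Proof.
split; last exact: renumber_avoids.
by move/(renumber_avoids s^-1%g); rewrite renumberK.
Qed.

Lemma renumber_wall T s W : wall (renumber T s) W <-> wall T W.
Proof.
split=> -[h1 h2 /renumber_avoidsE h3 h4 h5]; split=> // W' w1 w2 /renumber_avoidsE w3 w4;
  exact: h5.
Qed.

Lemma renumber_generic T s : generic_tiling T -> generic_tiling (renumber T s).
Proof.
case=> -[h1 h2 h3 h4] h5; split; first split=> //.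
- by move=> i; apply: h2.
- rewrite /= -h3; apply/seteqP; split=> p [k _ pk]; first by exists (s k).
  by exists (s^-1%g k) => //=; rewrite permKV.
- by move=> i j ij; apply: h4; rewrite (inj_eq perm_inj).
move=> p i j k l ci cj ck cl; rewrite -(map_inj_uniq (@perm_inj _ s) [:: i; j; k; l]).
exact: h5 ci cj ck cl.
Qed.

End Renumber.

Section WallEnds.
Variables (R : realType) (n : nat) (T : layout R n).
Hypothesis gT : generic_tiling T.
Variables (W : box R) (e : 'I_n).
Hypothesis wW : wall T W.
Hypothesis vW : vertical W.

(** Up to numbering every generic tiling is a realization, and walls do not depend on the numbering,
    so the ends found on the grid exist in general. *)
Let wall_ends :
  [/\ pts (left_edge (tile T e)) `<=` pts W -> bot W < bot (tile T e) ->
        exists2 W', ends_right T W W' & bot W' = bot (tile T e),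
      pts (left_edge (tile T e)) `<=` pts W -> top (tile T e) < top W ->
        exists2 W', ends_right T W W' & bot W' = top (tile T e),
      pts (right_edge (tile T e)) `<=` pts W -> bot W < bot (tile T e) ->
        exists2 W', ends_left T W W' & bot W' = bot (tile T e) &
      pts (right_edge (tile T e)) `<=` pts W -> top (tile T e) < top W ->
        exists2 W', ends_left T W W' & bot W' = top (tile T e)].
Proof.
have n0 : (0 < n)%N by apply: leq_ltn_trans (leq0n e) (ltn_ord e).
have [x [s [X [Z [E _]]]]] := realization gT n0; have bT := before_order x.
have g := renumber_generic s gT; have w := proj2 (renumber_wall T s W) wW.
have -> : tile T e = tile (renumber T s) (s^-1%g e) by rewrite /= permKV.
have EL W' : ends_left (renumber T s) W W' -> ends_left T W W' by case=> /renumber_wall.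
have ER W' : ends_right (renumber T s) W W' -> ends_right T W W' by case=> /renumber_wall.
rewrite E in g w EL ER *; split=> h1 h2.
- by have [W' /ER ? ?] := mk_right_tile_bottom bT g w vW h1 h2; exists W'.
- by have [W' /ER ? ?] := mk_right_tile_top bT g w vW h1 h2; exists W'.
- by have [W' /EL ? ?] := mk_left_tile_bottom bT g w vW h1 h2; exists W'.
by have [W' /EL ? ?] := mk_left_tile_top bT g w vW h1 h2; exists W'.
Qed.

Definition right_tile_bottom := let: And4 h _ _ _ := wall_ends in h.
Definition right_tile_top := let: And4 _ h _ _ := wall_ends in h.
Definition left_tile_bottom := let: And4 _ _ h _ := wall_ends in h.
Definition left_tile_top := let: And4 _ _ _ h := wall_ends in h.

End WallEnds.

Section Contacts.
Variables (R : realType) (n : nat).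
Implicit Types (T : layout R n) (W : box R).

Section Slide.
Variables (T : layout R n) (W W1 W2 : box R) (a b c d : 'I_n).
Hypothesis gT : generic_tiling T.
Hypothesis sd : slide_data T W W1 W2 a b c d.
Let tT : tiling T. Proof. by case: gT. Qed.

Lemma slide_data_coords : [/\ [/\ rgt (tile T a) = lft W, rgt (tile T b) = lft W,
    lft (tile T c) = lft W & lft (tile T d) = lft W],
  [/\ bot (tile T a) = bot W1, top (tile T b) = bot W1, bot (tile T c) = bot W2 &
      top (tile T d) = bot W2] &
  bot W <= bot W1 <= top W /\ bot W <= bot W2 <= top W].
Proof.
case: sd => -[wW vW [w1 h1 p1] [w2 h2 p2]] [a1 a2 b1 b2] [c1 c2 d1 d2].
have [-> _ _] := right_edge_sub tT vW a1; have [-> _ _] := bottom_edge_sub tT h1 a2.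
have [-> _ _] := right_edge_sub tT vW b1; have [-> _ _] := top_edge_sub tT h1 b2.
have [-> _ _] := left_edge_sub tT vW c1; have [-> _ _] := bottom_edge_sub tT h2 c2.
have [-> _ _] := left_edge_sub tT vW d1; have [-> _ _] := top_edge_sub tT h2 d2.
by case: p1 p2 => _ ? [_ ?].
Qed.

(** Tile [a] reaches up to [W2] and tile [d] down to [W1], since otherwise a wall would end at the
    top of [a] or the bottom of [d], between the two levels. *)
Lemma slide_contacts_up : bot W1 < bot W2 -> no_end T W (bot W1) (bot W2) ->
  [/\ left_of T a c, left_of T b d & left_of T a d].
Proof.
move=> lt ne; have [[xa xb xc xd] [ya yb yc yd] [/andP[w1 w2] /andP[w3 w4]]] := slide_data_coords.
have [ha hb hc hd] := And4 (tile_y tT a) (tile_y tT b) (tile_y tT c) (tile_y tT d).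
case: sd => -[wW vW _ _] [a1 _ _ _] [_ _ d1 _].
have ta : bot W2 <= top (tile T a).
  rewrite leNgt; apply/negP=> h.
  have [|W' e1 e2] := left_tile_top gT wW vW a1; first exact: lt_le_trans h w4.
  by have := ne W' (or_introl e1); rewrite e2 h -ya ha.
have bd : bot (tile T d) <= bot W1.
  rewrite leNgt; apply/negP=> h.
  have [|W' e1 e2] := right_tile_bottom gT wW vW d1; first exact: le_lt_trans w1 h.
  by have := ne W' (or_intror e1); rewrite e2 h -yd hd.
by split; apply/(left_of_weakE _ _ tT); split; rewrite ?xa ?xb ?xc ?xd ?ya ?yb ?yc ?yd //; lra.
Qed.

Lemma slide_contacts_down : bot W2 < bot W1 -> no_end T W (bot W2) (bot W1) ->
  [/\ left_of T b d, left_of T a c & left_of T b c].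
Proof.
move=> lt ne; have [[xa xb xc xd] [ya yb yc yd] [/andP[w1 w2] /andP[w3 w4]]] := slide_data_coords.
have [ha hb hc hd] := And4 (tile_y tT a) (tile_y tT b) (tile_y tT c) (tile_y tT d).
case: sd => -[wW vW _ _] [_ _ b1 _] [c1 _ _ _].
have tc : bot W1 <= top (tile T c).
  rewrite leNgt; apply/negP=> h.
  have [|W' e1 e2] := right_tile_top gT wW vW c1; first exact: lt_le_trans h w2.
  by have := ne W' (or_intror e1); rewrite e2 h -yc hc.
have bb : bot (tile T b) <= bot W2.
  rewrite leNgt; apply/negP=> h.
  have [|W' e1 e2] := left_tile_bottom gT wW vW b1; first exact: le_lt_trans w3 h.
  by have := ne W' (or_introl e1); rewrite e2 h -yb hb.
by split; apply/(left_of_weakE _ _ tT); split; rewrite ?xa ?xb ?xc ?xd ?ya ?yb ?yc ?yd //; lra.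
Qed.

Lemma slide_data_neq : a <> b /\ c <> d.
Proof.
have [_ [ya yb yc yd] _] := slide_data_coords.
have [ha hb hc hd] := And4 (tile_y tT a) (tile_y tT b) (tile_y tT c) (tile_y tT d).
by split=> E; [rewrite E in ya; rewrite E in ha|rewrite E in yc; rewrite E in hc]; lra.
Qed.

End Slide.

(** What is left of the incidences when a contact may disappear: tiles in contact keep their sides
    on a common line. The last two conditions recover which tiles border on the frame. *)
Definition left_compatible T T' := [/\
  forall i j, left_of T i j -> rgt (tile T' i) = lft (tile T' j),
  forall i j, left_of T' i j -> exists i', left_of T i' j &
  forall i j, left_of T' i j -> exists j', left_of T i j'].

Lemma same_left_compatible T T' : tiling T' ->
  (forall i j, left_of T i j <-> left_of T' i j) -> left_compatible T T'.
Proof.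
move=> tT' H; split=> i j.
- by move/H/(left_of_weakE _ _ tT') => [].
- by move/H; exists i.
by move/H; exists j.
Qed.

Lemma slide_compatible T T' a b c d : tiling T -> tiling T' ->
  (forall i j, left_of T' i j <-> (left_of T i j /\ (i, j) <> (a, d)) \/ (i, j) = (b, c)) ->
  a <> b -> c <> d -> left_of T a c -> left_of T b d -> left_of T a d ->
  left_compatible T T' /\ left_compatible T' T.
Proof.
move=> tT tT' rel ab cd ac bd ad.
have E i j : left_of T i j -> rgt (tile T i) = lft (tile T j).
  by move/(left_of_weakE _ _ tT) => [].
have E' i j : left_of T' i j -> rgt (tile T' i) = lft (tile T' j).
  by move/(left_of_weakE _ _ tT') => [].
have ac' : left_of T' a c by apply/rel; left; split=> // -[].
have bd' : left_of T' b d by apply/rel; left; split=> // -[/esym].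
have bc' : left_of T' b c by apply/rel; right.
split; split=> i j.
- move=> ij; case: (pselect ((i, j) = (a, d))) => [[-> ->]|ne]; last by apply: E'; apply/rel; left.
  (* Tiles [a] and [d] no longer touch, but their sides stay aligned through the contacts of [a]
     with [c], [b] with [c], and [b] with [d]. *)
  by rewrite (E' _ _ ac') -(E' _ _ bc') (E' _ _ bd').
- by move/rel => [[ij _]|[_ ->]]; [exists i|exists a].
- by move/rel => [[ij _]|[-> _]]; [exists j|exists d].
- move/rel => [[ij _]|[-> ->]]; first exact: E.
  by rewrite (E _ _ bd) -(E _ _ ad) (E _ _ ac).
- move=> ij; case: (pselect ((i, j) = (a, d))) => [[_ ->]|ne]; first by exists b.
  by exists i; apply/rel; left.
move=> ij; case: (pselect ((i, j) = (a, d))) => [[-> _]|ne]; first by exists c.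
by exists j; apply/rel; left.
Qed.

Definition compatible T T' := left_compatible T T' /\ left_compatible (anti T) (anti T').

Lemma vslide_compatible T T' : generic_tiling T -> generic_tiling T' -> vslide T T' ->
  compatible T T' /\ compatible T' T.
Proof.
move=> gT gT' [W [W1 [W2 [a [b [c [d [h1 [lt ne] [a1 a2 b1 b2] [c1 c2 d1 d2] rel]]]]]]]].
have sd : slide_data T W W1 W2 a b c d by split.
have [ac bd ad] := slide_contacts_up gT sd lt ne; have [ab cd] := slide_data_neq gT sd.
have [s1 s2] := slide_compatible (proj1 gT) (proj1 gT') (fun i j => proj2 (rel i j)) ab cd ac bd ad.
have tA := tiling_anti (proj1 gT); have tA' := tiling_anti (proj1 gT').
split; split=> //; apply: same_left_compatible => // i j; rewrite !left_of_anti.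
  by have [h _] := rel j i; rewrite h.
by have [h _] := rel j i; rewrite h.
Qed.

Lemma hslide_compatible T T' : generic_tiling T -> generic_tiling T' -> hslide T T' ->
  compatible T T' /\ compatible T' T.
Proof.
move=> gT gT' /hslideE[W [W1 [W2 [a [b [c [d [sd lt ne rel]]]]]]]].
have gA := generic_tiling_anti gT; have gA' := generic_tiling_anti gT'.
have [bd ac bc] := slide_contacts_down gA sd lt ne; have [ab cd] := slide_data_neq gA sd.
have rel' i j : left_of (anti T') i j <->
    (left_of (anti T) i j /\ (i, j) <> (b, c)) \/ (i, j) = (a, d).
  rewrite !left_of_anti; have [_ ->] := rel j i.
  by split=> -[[h1 h2]|[-> ->]]; [left; split=> // -[e1 e2]; apply: h2; rewrite e1 e2|right|
    left; split=> // -[e1 e2]; apply: h2; rewrite e1 e2|right].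
have [s1 s2] := slide_compatible (proj1 gA) (proj1 gA') rel' (nesym ab) (nesym cd) bd ac bc.
split; split=> //; apply: same_left_compatible; try exact: (proj1 gT); try exact: (proj1 gT').
  by move=> i j; have [h _] := rel i j; rewrite h.
by move=> i j; have [h _] := rel i j; rewrite h.
Qed.

Lemma mosaic_step_compatible T T' : mosaic_step T T' -> compatible T T'.
Proof.
move=> [gT gT' [same|[s|s|s|s]]].
- split; apply: same_left_compatible; [exact: (proj1 gT')| |exact: (tiling_anti (proj1 gT'))|].
    by move=> i j; have [] := same i j.
  by move=> i j; rewrite !left_of_anti; have [] := same j i.
- by case: (vslide_compatible gT gT' s).
- by case: (hslide_compatible gT gT' s).
- by case: (vslide_compatible gT' gT s).
by case: (hslide_compatible gT' gT s).
Qed.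

End Contacts.

Section Transfer.
Variables (R : realType) (n : nat) (bf : rel nat) (X Z : nat -> R) (T' : layout R n).
Hypothesis bfT : torder n bf.
Hypothesis gT : generic_tiling (mk n bf X Z).
Hypothesis tT' : tiling T'.
Let T := mk n bf X Z.
Local Notation bf' := (flip bf).
Hypothesis comp : left_compatible T T'.
Let tT : tiling T. Proof. by case: gT. Qed.
Let wX : increasing_sides n bf X. Proof. by case: (tiling_sides tT). Qed.
Let wZ : increasing_sides n bf' Z. Proof. by case: (tiling_sides tT). Qed.

Let touch (i j : 'I_n) : hi n bf i = lo bf j -> Z (lo bf' j) <= Z (hi n bf' i) ->
  Z (lo bf' i) <= Z (hi n bf' j) -> rgt (tile T' i) = lft (tile T' j).
Proof.
move=> E h1 h2; have [H _ _] := comp; apply: H; apply/(left_of_weakE _ _ tT).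
by rewrite /= E !lerN2.
Qed.

(** Two consecutive tiles on the right of a wall both touch the tile [e] on the left at their common
    boundary, so in [T'] both left sides equal the right side of [e]. Induction goes up to tile
    [m]. *)
Lemma left_sides_agree (m : 'I_n) : (0 < m)%N -> bf m.-1 m ->
  forall k : 'I_n, lo bf k = m -> lft (tile T' k) = lft (tile T' m).
Proof.
move=> m0 bm k; have mn : (0 < m < n)%N by rewrite m0 ltn_ord.
move: {2}(k : nat) (leqnn k) => d; elim: d k => [|d IH] k kd km.
  by have := lo_le bf k; rewrite km; move: m0 kd; case: (k : nat) => //; case: (m : nat).
case: (eqVneq k m) => [->//|ne].
have mk : (m < k)%N by rewrite ltn_neqAle eq_sym ne -km lo_le.
have [lk bk [c [cmk c1 c2]]] := lo_above bfT (ltn_ord k) km m0 mk.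
have cn : (c < n)%N by have := ltn_ord k; lia.
pose oc := Ordinal cn.
have [g1 g2] := left_side_bounds bfT gT mn bm km.
have zk := wZ (ltn_ord k); have zc := wZ cn; rewrite lk in zk g1; rewrite c2 in zc.
have [|e [e1 e2]] := left_tile_at bfT (P := fun c => Z c <= Z k) mn bm g1;
  rewrite -ltNge; [exact: lt_le_trans zk g2|move=> e3].
have t1 : rgt (tile T' e) = lft (tile T' k).
  by apply: touch; rewrite ?e1 ?km ?lk // ltW //; apply: le_lt_trans e2 zk.
have t2 : rgt (tile T' e) = lft (tile T' oc).
  by apply: touch; rewrite ?e1 ?c1 ?c2 //= ltW //; apply: lt_trans zc e3.
by rewrite -t1 t2; apply: IH => //=; lia.
Qed.

Lemma right_sides_agree m (m1 : 'I_n) : (0 < m < n)%N -> bf m.-1 m -> m1 = m.-1 :> nat ->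
  forall k : 'I_n, hi n bf k = m -> rgt (tile T' k) = rgt (tile T' m1).
Proof.
move=> mn bm m1E k.
move: {2}(m - k)%N (leqnn (m - k)) => d; elim: d k => [|d IH] k kd km.
  by have := hi_gt bf (ltn_ord k); rewrite km; lia.
case: (eqVneq k m1) => [->//|ne].
have km' : (k.+1 < m)%N.
  have := hi_gt bf (ltn_ord k); rewrite km => h; move/eqP: ne => ne.
  have : k <> m.-1 :> nat by move=> e; apply: ne; apply: val_inj; rewrite /= e m1E.
  by lia.
have mn' : (m < n)%N by case/andP: mn.
have [lk bk [b [bkm b1 b2]]] := hi_below bfT km mn' km'.
have bn : (b < n)%N by lia.
pose ob := Ordinal bn.
have [g1 g2] := right_side_bounds bfT gT (k := ob) mn bm b1.
have zk := wZ (ltn_ord k); have zb := wZ bn; rewrite lk in zk; rewrite /= b2 in g1 zb.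
have [|e [e1 e2]] := right_tile_at bfT (P := fun c => Z c <= Z k.+1) mn bm g1;
  rewrite -ltNge; [exact: lt_le_trans zb g2|move=> e3].
have t1 : rgt (tile T' k) = lft (tile T' e).
  by apply: touch; rewrite ?e1 ?km ?lk // ltW //; apply: lt_trans zk e3.
have t2 : rgt (tile T' ob) = lft (tile T' e).
  by apply: touch; rewrite ?e1 ?b1 ?b2 //= ltW //; apply: le_lt_trans e2 zb.
by rewrite t1 -t2; apply: IH => //=; lia.
Qed.

Lemma transfer_x : (0 < n)%N -> exists X', [/\ X' 0%N = lft (frame T'), X' n = rgt (frame T') &
  forall k : 'I_n, lft (tile T' k) = X' (lo bf k) /\ rgt (tile T' k) = X' (hi n bf k)].
Proof.
move=> n0; pose X' m := if m == 0%N then lft (frame T') else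
  if insub m is Some k then lft (tile T' (k : 'I_n)) else rgt (frame T').
have X'E (k : 'I_n) : (0 < k)%N -> X' k = lft (tile T' k).
  by rewrite /X' lt0n => /negbTE ->; rewrite valK.
have X'n : X' n = rgt (frame T').
  by rewrite /X' gtn_eqF // insubF // ltnn.
have [c1 c2 c3] := comp; exists X'; split=> // k.
have [f1 f2 _ _] := tile_in_frame tT' k; split.
  case: (posnP (lo bf k)) => [l0|lp].
    (* A tile away from the left frame edge in [T'] has a left neighbour there, hence one in [T],
       which is impossible if its left side is line [0]. *)
    rewrite l0 /X' eqxx; apply/eqP; rewrite eq_le f1 andbT leNgt; apply/negP=> lt.
    have [i /c2[j /(left_of_weakE _ _ tT)[/= E _ _]]] := left_neighbour tT' lt.
    have := wX (ltn_ord j); rewrite E l0.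
    by rewrite ltNge (side_gt0 bfT wX (ltn_ord j)).
  have [mn bm] := lo_wall bfT (ltn_ord k) erefl lp.
  rewrite (left_sides_agree (m := Ordinal mn) lp bm) //.
  by rewrite -(X'E (Ordinal mn)).
case: (eqVneq (hi n bf k) n) => [hn|ne].
  rewrite hn X'n //; apply/eqP; rewrite eq_le f2 /= leNgt; apply/negP=> lt.
  have [i /c3[j /(left_of_weakE _ _ tT)[/= E _ _]]] := right_neighbour tT' lt.
  have := wX (ltn_ord j); rewrite -E hn.
  by rewrite ltNge (side_ltn bfT wX (ltn_ord j)).
have mn : (hi n bf k < n)%N by rewrite ltn_neqAle ne hi_le.
have [m0 bm] := hi_wall bfT (ltn_ord k) erefl mn.
set m := hi n bf k in mn m0 bm *.
have m1n : (m.-1 < n)%N by lia.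
have mn' : (0 < m < n)%N by rewrite m0 mn.
pose om : 'I_n := Ordinal mn.
have lm : lo bf om = m by apply: lo_wall_self.
have zm := wZ mn.
have [_ g2] := left_side_bounds bfT gT mn' bm lm.
have [|e [e1 e2]] := left_tile_at bfT (P := fun c => Z c <= Z (lo bf' om)) mn' bm (lexx _);
  rewrite -ltNge; [exact: lt_le_trans zm g2|move=> e3].
have t : rgt (tile T' e) = lft (tile T' om).
  by apply: touch; rewrite ?e1 ?lm //= ltW //; apply: le_lt_trans e2 zm.
rewrite (right_sides_agree (m1 := Ordinal m1n) mn' bm) //.
rewrite -(right_sides_agree (m1 := Ordinal m1n) mn' bm erefl e1) t.
by rewrite -(X'E om).
Qed.

End Transfer.

Definition realized (R : realType) n bf (T : layout R n) := exists X Z, T = mk n bf X Z.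

Lemma realized_step (R : realType) n bf (T T' : layout R n) : (0 < n)%N -> torder n bf ->
  mosaic_step T T' -> realized bf T -> realized bf T'.
Proof.
move=> n0 bfT st [X [Z TE]]; have [cl ca] := mosaic_step_compatible st.
have [gT gT' _] := st; rewrite TE in gT cl ca; rewrite anti_mk in ca.
have gA := generic_tiling_anti gT; rewrite anti_mk in gA.
have [X' [x0 xn xk]] := transfer_x bfT gT (proj1 gT') cl n0.
have [Z' [z0 zn zk]] := transfer_x (torder_flip bfT) gA (tiling_anti (proj1 gT')) ca n0.
exists X', Z'; move: x0 xn xk z0 zn zk; case: (T') => f t /= x0 xn xk z0 zn zk.
rewrite /mk; congr Layout.
  by apply: box_eq; rewrite /= ?x0 ?xn ?z0 ?zn ?opprK.
apply: funext => k; have [h1 h2] := xk k; have [h3 h4] := zk k.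
by apply: box_eq; rewrite /= -?h1 -?h2 -?h3 -?h4 ?opprK.
Qed.

Lemma realized_mosaic (R : realType) n bf (T T' : layout R n) : (0 < n)%N -> torder n bf ->
  mosaic_equivalent T T' -> realized bf T -> realized bf T'.
Proof.
move=> n0 bfT; elim=> [T1 T2 st|//|T1 T2 T3 _ IH1 _ IH2 r]; first exact: realized_step st.
exact/IH2/IH1.
Qed.

(** * Wall shuffles *)

Section SortedWords.
Variables (R : realType) (n : nat) (x : 'S_n) (h : 'I_n -> R) (P : 'I_n -> Prop).
Let B : rel 'I_n := fun k l => before x k l.
Let H : rel 'I_n := fun k l => h k <= h l.
Let w := [seq k <- enum 'I_n | `[< P k >]].

Let mem_w k : (k \in w) = `[< P k >]. Proof. by rewrite mem_filter mem_enum andbT. Qed.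

Let Btr : transitive B.
Proof. by move=> j i k; apply: (bf_tr (before_order x)). Qed.

Let Birr : irreflexive B. Proof. by move=> i; apply: (to_irr (before_order x)). Qed.

Let Htr : transitive H. Proof. by move=> j i k; apply: le_trans. Qed.

Let sorted_one_line : sorted B (one_line x).
Proof.
apply: pairwise_sorted; case E : (one_line x) => [//|k0 w0]; rewrite -E.
apply/(pairwiseP k0) => i j ii jj ij.
by rewrite /B beforeE !index_uniq // uniq_one_line.
Qed.

Let sorted_subword u : sorted B (subword x u).
Proof. by apply: sorted_filter; [exact: Btr|exact: sorted_one_line]. Qed.

(** Both words are strictly increasing for the order of [x] and have the same members. *)
Lemma shuffle_subword : (forall k l, P k -> P l -> k <> l -> h k <= h l -> before x k l) ->
  sort H w = subword x (sort H w).
Proof.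
move=> Hw; have us : uniq (sort H w) by rewrite sort_uniq filter_uniq // enum_uniq.
apply: (irr_sorted_eq Btr Birr _ (sorted_subword _)); last first.
  by move=> k; rewrite mem_filter mem_one_line andbT.
apply: pairwise_sorted.
have : pairwise [rel k l | (k != l) && H k l] (sort H w).
  rewrite pairwise_relI -uniq_pairwise us /= -(sorted_pairwise Htr).
  by apply: sort_sorted => k l; apply: le_total.
apply: (@sub_in_pairwise _ (mem w)); last by apply/allP => k; rewrite mem_sort.
by move=> k l; rewrite !mem_w => /asboolP kw /asboolP lw /andP[/eqP kl hkl]; apply: Hw.
Qed.

Lemma subword_order k l : sort H w = subword x (sort H w) -> P k -> P l -> h k <> h l ->
  (h k < h l) = before x k l.
Proof.
move=> E /asboolP kw /asboolP lw hkl; rewrite -!mem_w in kw lw.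
have sB := sorted_subword (sort H w); rewrite -E in sB.
have sH : sorted H (sort H w) by apply: sort_sorted => i j; apply: le_total.
have lt_before i j : i \in w -> j \in w -> h i < h j -> before x i j.
  move=> iw jw hij; have [is' js] : i \in sort H w /\ j \in sort H w by rewrite !mem_sort.
  case: (ltnP (index i (sort H w)) (index j (sort H w))) => il.
    exact: (sorted_ltn_index Btr sB).
  have := @sorted_leq_index _ H Htr (fun i => lexx _) _ sH j i js is' il.
  by rewrite /H leNgt hij.
apply/idP/idP => [|b]; first exact: lt_before.
rewrite lt_neqAle; apply/andP; split; first exact/eqP.
by rewrite leNgt; apply/negP=> /(lt_before _ _ lw kw); apply/negP/(bf_asym (before_order x)).
Qed.

End SortedWords.

Section Existence.
Variables (R : realType) (n : nat) (x : 'S_n) (T : layout R n).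
Hypothesis gT : generic_tiling T.
Hypothesis px : forall p u, prec T p u -> before x p u.
Let tT : tiling T. Proof. by case: gT. Qed.

(** Two records in order of height fall under [prec]. If the first is on the right and the second on
    the left, the first tile ends below the second, which is [prec_v]; in all other cases the first
    tile meets the quadrant of the third clause. *)
Lemma vshuffle_ok W : wall T W -> vertical W -> vshuffle T W = subword x (vshuffle T W).
Proof.
move=> [_ _ aW _ _] vW; apply: shuffle_subword => k l rk rl kl.
have [xk xl yk yl] := And4 (tile_x tT k) (tile_x tT l) (tile_y tT k) (tile_y tT l).
rewrite /record_height; case: asboolP => hk; case: asboolP => hl lekl; apply: px.
- have [ek _ _] := right_edge_sub tT vW (proj1 hk); have [el _ _] := right_edge_sub tT vW (proj1 hl).
  by constructor 3; split=> //; lra.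
- case: rl => // -[sl _]; have [ek _ _] := right_edge_sub tT vW (proj1 hk).
  have [el _ _] := left_edge_sub tT vW sl.
  have ne := no_touch_down gT (etrans ek (esym el)).
  have lt : bot (tile T k) < top (tile T l) by rewrite lt_neqAle lekl andbT; apply/eqP.
  by constructor 3; split=> //; lra.
- case: rk => // -[sk _]; constructor 1; exists W; split=> //; exact: proj1 hl.
case: rk => // -[sk _]; case: rl => // -[sl _].
have [ek _ _] := left_edge_sub tT vW sk; have [el _ _] := left_edge_sub tT vW sl.
by constructor 3; split=> //; lra.
Qed.

Lemma hshuffle_ok W : wall T W -> horizontal W -> hshuffle T W = subword x (hshuffle T W).
Proof.
move=> [_ _ aW _ _] vW; apply: shuffle_subword => k l rk rl kl.
have [xk xl yk yl] := And4 (tile_x tT k) (tile_x tT l) (tile_y tT k) (tile_y tT l).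
rewrite /record_abscissa; case: asboolP => hk; case: asboolP => hl lekl; apply: px.
- have [ek _ _] := bottom_edge_sub tT vW (proj1 hk); have [el _ _] := bottom_edge_sub tT vW (proj1 hl).
  by constructor 3; split=> //; lra.
- case: rl => // -[sl _]; constructor 2; exists W; split=> //; exact: proj1 hk.
- case: rk => // -[sk _]; have [ek _ _] := top_edge_sub tT vW sk.
  have [el _ _] := bottom_edge_sub tT vW (proj1 hl).
  have lt : lft (tile T k) < rgt (tile T l).
    rewrite lt_neqAle lekl andbT; apply/eqP=> e.
    by apply: (no_touch_down gT (esym e)); rewrite ek el.
  by constructor 3; split=> //; lra.
case: rk => // -[sk _]; case: rl => // -[sl _].
have [ek _ _] := top_edge_sub tT vW sk; have [el _ _] := top_edge_sub tT vW sl.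
by constructor 3; split=> //; lra.
Qed.

End Existence.

Lemma prec_renumber (R : realType) n (T : layout R n) (s : 'S_n) p u :
  prec (renumber T s) p u -> prec T (s p) (s u).
Proof.
case=> [[W [w1 /renumber_avoidsE w2 w3 w4 w5]]|[W [w1 /renumber_avoidsE w2 w3 w4 w5]]|[pu h1 h2]].
- by constructor 1; exists W.
- by constructor 2; exists W.
by constructor 3; split=> // /perm_inj.
Qed.

Section Recorded.
Variables (R : realType) (n : nat) (x : 'S_n) (T : layout R n).
Hypothesis gT : generic_tiling T.

Lemma slide_data_vorder W W1 W2 a b c d : slide_data T W W1 W2 a b c d ->
  vshuffle T W = subword x (vshuffle T W) -> (bot W1 < bot W2) = before x a d.
Proof.
have [tT _] := gT; move=> sd ok.
have [[xa _ _ xd] [ya _ _ yd] _] := slide_data_coords gT sd.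
case: sd => -[wW vW e1 e2] [a1 a2 _ _] [_ _ d1 d2].
have ra : recorded_left T W a by split=> //; exists W1.
have rd : recorded_right T W d by split=> //; exists W2.
have nd : ~ recorded_left T W d.
  by case=> s _; have [e _ _] := right_edge_sub tT vW s; have := tile_x tT d; lra.
have ha : record_height T W a = bot W1 by rewrite /record_height asboolT.
have hd : record_height T W d = bot W2 by rewrite /record_height asboolF.
rewrite -ha -hd; apply: (subword_order ok); [by left|by right|rewrite ha hd => e].
by apply: (no_touch_down gT (etrans xa (esym xd))); rewrite ya yd e.
Qed.

Lemma slide_data_horder W W1 W2 a b c d : slide_data (anti T) W W1 W2 a b c d ->
  (forall W, wall T W -> horizontal W -> hshuffle T W = subword x (hshuffle T W)) ->
  (bot W1 < bot W2) = before x d a.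
Proof.
have gA := generic_tiling_anti gT; have [tT _] := gT; move=> sd oks.
have [[xa _ _ xd] [ya _ _ yd] _] := slide_data_coords gA sd.
move: sd; rewrite -{1}(aboxK W) -{1}(aboxK W1) -{1}(aboxK W2) => /slide_data_anti.
move=> [[wW hW e1 e2] [a1 a2 _ _] [_ _ d1 d2]]; have ok := oks _ wW hW.
have ra : recorded_above T (abox W) a by split=> //; exists (abox W1).
have rd : recorded_below T (abox W) d by split=> //; exists (abox W2).
have nd : ~ recorded_above T (abox W) d.
  case=> s _; have [e _ _] := bottom_edge_sub tT hW s; have [e' _ _] := top_edge_sub tT hW d1.
  by have := tile_y tT d; lra.
have ha : record_abscissa T (abox W) a = - bot W1.
  by rewrite /record_abscissa asboolT // -ya /= opprK.
have hd : record_abscissa T (abox W) d = - bot W2.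
  by rewrite /record_abscissa asboolF // -yd /= opprK.
rewrite -ltrN2 -ha -hd; apply: (subword_order ok); [by right|by left|rewrite ha hd => /oppr_inj e].
by apply: (no_touch_down gA (etrans xa (esym xd))); rewrite ya yd e.
Qed.

End Recorded.

(** * Incidences determined by the order of opposite ends *)

Section Uniqueness.
Variables (R : realType) (n : nat) (bf : rel nat).
Hypothesis bfT : torder n bf.
Local Notation bf' := (flip bf).

Lemma opposite_ends_slide (X Z : nat -> R) p q : generic_tiling (mk n bf X Z) ->
  opposite_ends n bf p q -> exists W b c (a d : 'I_n),
    [/\ slide_data (mk n bf X Z) W (hwall n bf X Z p) (hwall n bf X Z q) a b c d,
        a = p.-1 :> nat, d = q :> nat & Z p <> Z q].
Proof.
move=> gT opq; have [b [c [b1 b2 c1 c2]]] := opposite_ends_tiles bfT opq.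
have [pn bp qn bq E] := opq.
have an : (p.-1 < n)%N by lia.
have dn : (q < n)%N by lia.
have sd := opposite_ends_data bfT gT opq (a := Ordinal an) (d := Ordinal dn) erefl erefl b1 b2 c1 c2.
exists (vwall n bf X Z (lo bf q)), b, c, (Ordinal an), (Ordinal dn); split=> // e.
have [[xa _ _ xd] [ya _ _ yd] _] := slide_data_coords gT sd.
by apply: (no_touch_down gT (etrans xa (esym xd))); rewrite ya yd !hwallE /= e.
Qed.

Lemma left_of_order (X Z X' Z' : nat -> R) i j : generic_tiling (mk n bf X Z) ->
  generic_tiling (mk n bf X' Z') ->
  (forall p q, opposite_ends n bf p q -> (Z q < Z p) = (Z' q < Z' p)) ->
  left_of (mk n bf X Z) i j -> left_of (mk n bf X' Z') i j.
Proof.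
move=> gT gT' H l; apply: contrapT => nl.
case: (left_of_change bfT gT gT' l nl) => [[o h1 h2]|[o [_ _ h1 h2]]].
  by move: h1; rewrite (H _ _ o) ltNge h2.
have := H _ _ o; rewrite lt_gtF // => /esym/negbT; rewrite -leNgt => h3.
have [W [b [c [a [d [_ _ _ ne]]]]]] := opposite_ends_slide gT' o.
by apply: ne; apply/eqP; rewrite eq_le h2 h3.
Qed.

End Uniqueness.

(** * Surjectivity of the map *)

Section Main.
Variables (R : realType) (n : nat) (x : 'S_n).
Hypothesis n0 : (0 < n)%N.

Definition shuffles_agree (T : layout R n) :=
  (forall W, wall T W -> vertical W -> vshuffle T W = subword x (vshuffle T W)) /\
  (forall W, wall T W -> horizontal W -> hshuffle T W = subword x (hshuffle T W)).

(** At opposite ends [p] and [q] the recorded tiles are [p.-1] and [q], so the order of the ends is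
    the order of these two labels in [x], the same for both tilings. *)
Lemma shuffles_same_incidences (X Z X' Z' : nat -> R) :
  generic_tiling (mk n (before x) X Z) -> generic_tiling (mk n (before x) X' Z') ->
  shuffles_agree (mk n (before x) X Z) -> shuffles_agree (mk n (before x) X' Z') ->
  same_incidences (mk n (before x) X Z) (mk n (before x) X' Z').
Proof.
move=> gT gT' [v h] [v' h']; have bT := before_order x; have bT' := torder_flip bT.
have gA := generic_tiling_anti gT; have gA' := generic_tiling_anti gT'; rewrite !anti_mk in gA gA'.
have vord X1 Z1 p q : generic_tiling (mk n (before x) X1 Z1) ->
    shuffles_agree (mk n (before x) X1 Z1) -> opposite_ends n (before x) p q ->
    (Z1 q < Z1 p) = before x p.-1 q.
  move=> g [ok _] opq; have [W [b [c [a [d [sd ea ed _]]]]]] := opposite_ends_slide bT g opq.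
  have [[wW vW _ _] _ _] := sd.
  by have := slide_data_vorder g sd (ok W wW vW); rewrite !hwallE /= ltrN2 ea ed.
have hord X1 Z1 p q : generic_tiling (mk n (before x) X1 Z1) ->
    shuffles_agree (mk n (before x) X1 Z1) -> opposite_ends n (flip (before x)) p q ->
    (X1 q < X1 p) = before x q p.-1.
  move=> g [_ ok] opq; have g' := generic_tiling_anti g; rewrite anti_mk in g'.
  have [W [b [c [a [d [sd ea ed _]]]]]] := opposite_ends_slide bT' g' opq.
  rewrite -anti_mk in sd.
  by have := slide_data_horder g sd ok; rewrite !hwallE /= ltrN2 ea ed.
move=> i j; split.
  rewrite -!left_of_anti !anti_mk; split; apply: (left_of_order bT') => // p q opq.
    by rewrite (hord X Z) // (hord X' Z').
  by rewrite (hord X Z) // (hord X' Z').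
split; apply: (left_of_order bT) => // p q opq.
  by rewrite (vord X Z) // (vord X' Z').
by rewrite (vord X Z) // (vord X' Z').
Qed.

End Main.

Lemma mosaic_generic (R : realType) n (T T' : layout R n) :
  mosaic_equivalent T T' -> generic_tiling T -> generic_tiling T'.
Proof. by elim=> [? ? []//|//|? ? ? _ IH1 _ IH2 /IH1/IH2]. Qed.

Lemma equivalent_trans (R : realType) n (T1 T2 T3 : layout R n) :
  equivalent T1 T2 -> equivalent T2 T3 -> equivalent T1 T3.
Proof.
move=> [s Hs] [t Ht]; exists (s * t)%g => i j; rewrite !permM.
have [h1 h2] := Hs i j; have [h3 h4] := Ht (s i) (s j).
by split; [rewrite h1 h3|rewrite h2 h4].
Qed.

Lemma equivalent_sym (R : realType) n (T1 T2 : layout R n) :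
  equivalent T1 T2 -> equivalent T2 T1.
Proof.
move=> [s Hs]; exists s^-1%g => i j.
by have := Hs (s^-1%g i) (s^-1%g j); rewrite !permKV => -[h1 h2]; split; split; move/h1 || move/h2.
Qed.

Lemma same_equivalent (R : realType) n (T1 T2 : layout R n) :
  same_incidences T1 T2 -> equivalent T1 T2.
Proof. by move=> H; exists 1%g => i j; rewrite !perm1; apply: H. Qed.

Lemma renumber_equivalent (R : realType) n (T : layout R n) (s : 'S_n) :
  equivalent (renumber T s) T.
Proof. by exists s. Qed.

Theorem proposition4p2 (R : realType) (n : nat) (hn : (0 < n)%N) :
  set_surj [set: {perm 'I_n}]%classic (gRec R n) (gamma R n).
Proof.
move=> C [T gT ->]; have [x [s [X [Z [E px]]]]] := realization gT hn.
exists x => //; have bT := before_order x.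
have gS := renumber_generic s gT.
have agree : shuffles_agree x (renumber T s).
  have px' p u : prec (renumber T s) p u -> before x p u by move/prec_renumber/px.
  by split=> W; [apply: vshuffle_ok|apply: hshuffle_ok].
(* For one inclusion the renumbered [T] itself serves as the numbered tiling in [gamma x]; for the
   other, any admissible numbering is realized over [x] with shuffles taken from [x], hence has the
   incidences of the renumbered [T]. *)
apply/seteqP; split=> T2 [g2]; last first.
  move=> eq2; split=> //; exists (renumber T s); case: (agree) => a1 a2; split=> //.
    exact: equivalent_trans (renumber_equivalent T s) eq2.
  rewrite rhoE E; apply: mosaic_mk => //; first by rewrite -rhoE; apply: rho_generic.
  by rewrite -E.
move=> [T3 [eq32 mos v h]]; split=> //.
have [X' [Z' E3]] : realized (before x) T3.
  by apply: (realized_mosaic hn bT mos); rewrite rhoE; do 2 eexists.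
have g3 : generic_tiling T3 by apply: mosaic_generic mos (rho_generic R x hn).
apply: equivalent_trans eq32; apply: equivalent_trans (equivalent_sym (renumber_equivalent T s)) _.
apply: same_equivalent; rewrite E E3; apply: shuffles_same_incidences; by rewrite -?E -?E3.
Qed.
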